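(* Let $a<0$ and $a+b\le 0$, and let $\psi\in C([-1,0];\mathbb{R})$. Let $X$ be the unique continuous adapted process satisfying $$dX(t)=\Big(aX(t)+\frac{b}{1+t}\int_{-1}^t X(s)\,ds\Big)\,dt+\sigma\,dB(t),\quad t\ge 0;\qquad X(t)=\psi(t),\quad t\in[-1,0],$$ and let $U=\{U(t):t\ge0\}$ be the unique continuous adapted process satisfying $$dU(t)=aU(t)\,dt+\sigma\,dB(t),\quad t\ge0;\qquad U(0)=0.$$ Then: (i) $$\limsup_{t\to\infty}\frac{X(t)}{\sqrt{2\log t}}=\frac{\sigma}{\sqrt{2|a|}},\qquad \liminf_{t\to\infty}\frac{X(t)}{\sqrt{2\log t}}=-\frac{\sigma}{\sqrt{2|a|}},\quad\text{a.s.}$$ (ii) If $a+b<0$, then $\lim_{t\to\infty}\{X(t)-U(t)\}=0$ a.s. and $\lim_{t\to\infty}\frac{1}{1+t}\int_{-1}^tX(s)\,ds=0$ a.s. (iii) If $a+b=0$, then $\lim_{t\to\infty}\{X(t)-U(t)\}=L$ a.s., where $L$ is a proper Gaussian random variable with mean and variance $$\mathbb{E}[L]=b^2\Gamma(-b/a)\Big(\int_{-1}^0\psi(u)\,du\Big)\int_0^\infty U(1-b/a,2,-a(1+s))\,ds+b^2\Gamma(-b/a)\psi(0)\int_0^\infty e^{au}\int_u^\infty U(1-b/a,2,-a(1+s))\,ds\,du,$$ $$\mathrm{Var}[L]=\sigma^2\int_0^\infty e^{-2au}\Big(\int_u^\infty e^{aw}\int_w^\infty b^2\Gamma(-b/a)\,U(1-b/a,2,-a(1+s))\,ds\,dw\Big)^2du,$$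 and $\lim_{t\to\infty}\frac{1}{1+t}\int_{-1}^tX(s)\,ds=L$ a.s.
   Context: $a,b\in\mathbb{R}$, $\sigma>0$, $\psi$ is deterministic, and $B$ is a standard one-dimensional Brownian motion on a complete probability space with a filtration satisfying the usual conditions, to which $B$ is adapted. ''a.s.'' means almost surely. ''Proper'' means almost surely finite and non-degenerate. $\Gamma$ is the Gamma function. The three-argument symbol $U(\alpha,\beta,z)$ (not to be confused with the process $U(t)$) denotes the Tricomi confluent hypergeometric function: for real $\alpha,\beta$ and $z>0$ it is the solution of Kummer's equation $z w''(z)+(\beta-z)w'(z)-\alpha w(z)=0$ determined by $z^{\alpha}U(\alpha,\beta,z)\to1$ as $z\to\infty$. *)

(* Defs.v *)
From HB Require Import structures.
From mathcomp Require Import all_boot all_order all_algebra.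
From mathcomp Require Import all_classical all_reals all_analysis.

Set Implicit Arguments.
Unset Strict Implicit.
Unset Printing Implicit Defensive.

Import Order.TTheory GRing.Theory Num.Theory.
Import numFieldNormedType.Exports.

Local Open Scope classical_set_scope.
Local Open Scope ring_scope.

Section special_functions.
Context {R : realType}.
Implicit Types (alpha beta x z : R) (w : R -> R).

(* Euler's integral; it is the Gamma function for 0 < x only. *)
Definition Gamma x : R :=
  \int[lebesgue_measure]_(t in `]0, +oo[) (t `^ (x - 1) * expR (- t)).

Definition kummer_solution alpha beta w :=
  forall z, 0 < z ->
    [/\ derivable w z 1, derivable w^`()%classic z 1 &
        z * w^`(2)%classic z + (beta - z) * w^`()%classic z - alpha * w z = 0].

Definition is_tricomi alpha beta w :=
  kummer_solution alpha beta w /\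
  z `^ alpha * w z @[z --> +oo] --> (1 : R).

(* [is_tricomi alpha beta] determines its argument on the open half-line
   of positive reals; the values of [tricomi] elsewhere are unspecified. *)
Definition tricomi alpha beta : R -> R :=
  get [set w | is_tricomi alpha beta w].

End special_functions.

(* Processes and filtrations are indexed by R; only the times t >= 0 matter
   (t >= -1 for the process with prescribed initial segment). *)
Section processes.
Context {d : measure_display} {T : measurableType d} {R : realType}.
Variable P : probability T R.
Implicit Types (F : R -> set_system T) (B X U : R -> T -> R).

Definition filtration F :=
  [/\ (forall t : R, 0 <= t -> sigma_algebra setT (F t)),
      (forall t : R, 0 <= t -> F t `<=` measurable) &
      (forall s t : R, 0 <= s -> s <= t -> F s `<=` F t)].

Definition usual_conditions F :=
  P.-negligible `<=` F 0 /\
  forall t : R, 0 <= t -> F t = \bigcap_(s in `]t, +oo[) F s.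

Definition adapted F X :=
  forall t : R, 0 <= t -> forall A : set R, measurable A -> F t (X t @^-1` A).

(* s is the standard deviation, as in [normal_prob]. *)
Definition gaussian_law (Y : T -> R) (m s : R) :=
  forall A : set R, measurable A -> P (Y @^-1` A) = normal_prob m s A.

Definition proper_gaussian (Y : T -> R) :=
  exists m s : R, 0 < s /\ gaussian_law Y m s.

(* Since the events [A i] may be [setT], the product rule below covers every
   subfamily of the increments, i.e. it is mutual independence. *)
Definition independent_increments B :=
  forall (n : nat) (t : nat -> R) (A : nat -> set R),
    0 <= t 0 -> nondecreasing_seq t -> (forall i, measurable (A i)) ->
    P (\bigcap_(i < n) ((B (t i.+1) \- B (t i))%R @^-1` A i)) =
    (\prod_(i < n) P ((B (t i.+1) \- B (t i))%R @^-1` A i))%E.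

Definition standard_brownian_motion B :=
  [/\ (forall t : R, 0 <= t -> measurable_fun setT (B t)),
      (\forall w \ae P, B 0 w = 0),
      (\forall w \ae P, {within `[0, +oo[, continuous (B ^~ w)}),
      independent_increments B &
      forall s t : R, 0 <= s -> s < t ->
        gaussian_law (B t \- B s) 0 (Num.sqrt (t - s))].

(* The diffusion coefficient being the constant sigma, the stochastic integral
   of sigma against B over [0, t] is sigma * (B t - B 0), so that the
   integrated equations are pathwise identities. *)
Definition average_sde_solution (a b sigma : R) (psi : R -> R) B X :=
  \forall w \ae P,
    [/\ {within `[-1, +oo[, continuous (X ^~ w)},
        (forall t : R, -1 <= t <= 0 -> X t w = psi t) &
        forall t : R, 0 <= t ->
          X t w = X 0 w
            + \int[lebesgue_measure]_(s in `[0, t])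
                (a * X s w
                 + b / (1 + s) * \int[lebesgue_measure]_(r in `[-1, s]) X r w)
            + sigma * (B t w - B 0 w)].

Definition ornstein_uhlenbeck_solution (a sigma : R) B U :=
  \forall w \ae P,
    [/\ {within `[0, +oo[, continuous (U ^~ w)},
        U 0 w = 0 &
        forall t : R, 0 <= t ->
          U t w = U 0 w
            + \int[lebesgue_measure]_(s in `[0, t]) (a * U s w)
            + sigma * (B t w - B 0 w)].

End processes.

(* Main.v *)
Require Import Defs.
From HB Require Import structures.
From mathcomp Require Import all_boot all_order all_algebra.
From mathcomp Require Import all_classical all_reals all_analysis.
From mathcomp Require Import measurable_realfun ring lra.

Set Implicit Arguments.
Unset Strict Implicit.
Unset Printing Implicit Defensive.

Import Order.TTheory GRing.Theory Num.Theory.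
Import numFieldNormedType.Exports.

Local Open Scope classical_set_scope.
Local Open Scope ring_scope.

(** Fix a path and write beta = sigma (B - B 0), m(t) for the average of X
    over [-1, t] divided by 1 + t, and z = X - U.  The noise cancels in z, so
    that z' = a z + b m, while m' = (X - m) / (1 + t) is slow.

    Average and gap.  With y = U - beta, so that y' = a U, the slow variable
    p = m - (y + z) / (a (1 + t)) satisfies (1 + t) p' = - kappa p + r with
    kappa = (a + b) / a >= 0 and r = - (b / a) (y + z) / (a (1 + t)).
    Brownian paths are O((1 + t)^(3/4)), hence so is y.  Once z is known to be
    bounded, which follows by closing the loop between p and the stable
    equation of z (gap_bounded), the forcing r is O((1 + t)^(-1/4)) and p
    converges to some l, with l = 0 when kappa > 0.  Then m tends to l and z
    to - (b / a) l (average_and_gap_cvg).  This gives the convergences in (ii)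
    and in (iii), where - (b / a) = 1.

    Envelope.  As z is bounded, (i) only concerns U.  On a grid of mesh h,
    U is a Gaussian autoregression up to an error controlled by the oscillation
    of beta over one cell, which is O(sqrt h sqrt (log k)) on the k-th cell
    (brownian_oscillation, by dyadic chaining).  The upper bound for the
    autoregression is the first Borel-Cantelli lemma for its Gaussian tail; the
    lower bound is the second one, for independent events that push all the
    increments of a block of cells in the same direction
    (autoregression_lower).  Letting h tend to 0, the standard deviation of the
    stationary autoregression tends to sigma / sqrt (2 |a|)
    (ou_upper_envelope, ou_lower_envelope).

    Law of the limit.  Let a + b = 0, c = - a and w = tricomi 2 2, for which
    w(z) = e^z * (integral of e^(-1/s) for s in [0, 1/z]) (tricomi_2_2).  Put
    g(t) = c (1 + t) w(c (1 + t)).  Then g' = g / (1 + t) + c g - 1 / (1 + t),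
    which is exactly what makes L = m + g (X - m) satisfy dL = sigma g dB, and
    g(t) = O(1 / t), so that L also tends to l.  At an integer time L is a
    pathwise limit of Riemann sums of g against the increments of B
    (limit_martingale_sum); these are Gaussian, so l is Gaussian with mean
    L(0) and variance sigma^2 times the integral of g^2 (wiener_integral_law).
    The double integrals in the statement are these two numbers: c^2 times the
    integral of w(c (1 + s)) over [0, oo) is 1 - g(0), and integrating once
    more against e^(-c v) over [u, oo) gives e^(-c u) g(u)
    (tricomi22_tail, tricomi22_tail2). *)

(** * Derivatives and linear differential inequalities *)

Section calculus.
Context {R : realType}.
Implicit Types (f g y e : R -> R) (a b c s t x : R).

Lemma derM f g x df dg : is_derive x 1 f df -> is_derive x 1 g dg ->
  is_derive x 1 (fun z => f z * g z) (df * g x + f x * dg).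
Proof.
move=> hf hg; apply: (is_derive_eq (is_deriveM hf hg)).
by rewrite /GRing.scale /=; ring.
Qed.

Lemma derD f g x df dg : is_derive x 1 f df -> is_derive x 1 g dg ->
  is_derive x 1 (fun z => f z + g z) (df + dg).
Proof. by move=> hf hg; exact: is_deriveD. Qed.

Lemma derB f g x df dg : is_derive x 1 f df -> is_derive x 1 g dg ->
  is_derive x 1 (fun z => f z - g z) (df - dg).
Proof. by move=> hf hg; exact: is_deriveB. Qed.

Lemma derN f x df : is_derive x 1 f df ->
  is_derive x 1 (fun z => - f z) (- df).
Proof. by move=> hf; exact: is_deriveN. Qed.

Lemma derC c x : is_derive x 1 (fun=> c) (0 : R).
Proof. exact: is_derive_cst. Qed.

Lemma derI x : is_derive x 1 (fun z : R => z) (1 : R).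
Proof. exact: is_derive_id. Qed.

Lemma derZ c f x df : is_derive x 1 f df ->
  is_derive x 1 (fun z => c * f z) (c * df).
Proof.
by move=> hf; apply: (is_derive_eq (derM (derC c x) hf)); ring.
Qed.

Lemma derV f x df : f x != 0 -> is_derive x 1 f df ->
  is_derive x 1 (fun z => (f z)^-1) (- df / (f x) ^+ 2).
Proof.
move=> f0 hf; apply: (is_derive_eq (is_deriveV f0 hf)).
by rewrite /GRing.scale /=; ring.
Qed.

Lemma der_comp f g x df dg : is_derive (g x) 1 f df -> is_derive x 1 g dg ->
  is_derive x 1 (fun z => f (g z)) (dg * df).
Proof.
by move=> hf hg; apply: (is_derive_eq (is_derive1_comp hf hg)); ring.
Qed.

Lemma der_expR f x df : is_derive x 1 f df ->
  is_derive x 1 (fun z => expR (f z)) (df * expR (f x)).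
Proof. by move=> hf; apply: der_comp; exact: is_derive_expR. Qed.

Lemma der_powR f x p df : 0 < f x -> is_derive x 1 f df ->
  is_derive x 1 (fun z => f z `^ p) (df * (p * f x `^ (p - 1))).
Proof.
by move=> f0 hf; apply: (@der_comp (fun z => z `^ p)); first exact: is_derive1_powR.
Qed.

(** Two functions that agree on the open half-line have the same derivative
    there; this transports derivatives along integral equations, which only
    hold for positive times. *)
Lemma der_ext f g x df : 0 < x -> {in `]0, +oo[, f =1 g} ->
  is_derive x 1 f df -> is_derive x 1 g df.
Proof.
move=> x0 fg; apply: near_eq_is_derive.
near=> z; apply: fg; rewrite in_itv/= andbT; near: z.
exact: lt_nbhsr.
Unshelve. all: by end_near. Qed.

Lemma der_continuous f x df : is_derive x 1 f df -> {for x, continuous f}.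
Proof. by case=> h _; apply/differentiable_continuous/derivable1_diffP. Qed.

Lemma derive_nondecreasing f df a b : a <= b ->
  {within `[a, b], continuous f} ->
  (forall x, a < x < b -> is_derive x 1 f (df x)) ->
  (forall x, a < x < b -> 0 <= df x) -> f a <= f b.
Proof.
rewrite le_eqVlt => /orP[/eqP-> //|ab] cf hf h0.
have [x] := MVT ab (fun x (hx : x \in `]a, b[) =>
  hf x (ltac:(by move: hx; rewrite in_itv))) cf.
rewrite in_itv /= => hx; rewrite -subr_ge0 => ->.
by rewrite mulr_ge0 ?h0// subr_ge0 ltW.
Qed.

(** Variation of constants without an integral: e^(c (x - t)) (M / c - y x) is
    nondecreasing. *)
Lemma linear_ode_bound_le c M y e s t : 0 < c -> s <= t ->
  {within `[s, t], continuous y} ->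
  (forall x, s < x < t -> is_derive x 1 y (- c * y x + e x)) ->
  (forall x, s < x < t -> e x <= M) ->
  y t - expR (- c * (t - s)) * y s <= M / c * (1 - expR (- c * (t - s))).
Proof.
move=> c0 st cy dy eM.
pose w x := - (expR (c * (x - t)) * (y x - M / c)).
have dw x : s < x < t ->
    is_derive x 1 w (expR (c * (x - t)) * (M - e x)).
  move=> hx; have h1 : is_derive x 1 (fun z => c * (z - t)) c.
    by apply: (is_derive_eq (derZ _ (derB (derI _) (derC _ _)))); ring.
  apply: (is_derive_eq (derN (derM (der_expR h1)
    (derB (dy x hx) (derC _ _))))).
  field; exact: lt0r_neq0.
have := @derive_nondecreasing w _ s t st _ dw.
have cw : {within `[s, t], continuous w}.
  move=> z; apply: cvgN; apply: cvgM; last first.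
    by apply: cvgB; [exact: cy|exact: cvg_cst].
  apply: continuous_subspaceT => {}z.
  have h1 : is_derive z 1 (fun z => c * (z - t)) c.
    by apply: (is_derive_eq (derZ _ (derB (derI _) (derC _ _)))); ring.
  exact: (der_continuous (der_expR h1)).
move=> /(_ cw) h.
have {h} : w s <= w t.
  by apply: h => x hx; rewrite mulr_ge0 ?expR_ge0// subr_ge0 eM.
rewrite /w subrr mulr0 expR0 mul1r.
have -> : c * (s - t) = - c * (t - s) by ring.
move: (expR _) => E; lra.
Qed.

Lemma linear_ode_bound c M y e s t : 0 < c -> s <= t ->
  {within `[s, t], continuous y} ->
  (forall x, s < x < t -> is_derive x 1 y (- c * y x + e x)) ->
  (forall x, s < x < t -> `|e x| <= M) ->
  `|y t - expR (- c * (t - s)) * y s| <= M / c * (1 - expR (- c * (t - s))).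
Proof.
move=> c0 st cy dy eM; rewrite ler_norml; apply/andP; split; last first.
  apply: linear_ode_bound_le dy _ => // x hx.
  by rewrite (le_trans (ler_norm _))// eM.
have cNy : {within `[s, t], continuous (fun x => - y x)}.
  by move=> z; apply: cvgN; exact: cy.
have dNy x : s < x < t -> is_derive x 1 (fun x => - y x) (- c * (- y x) + - e x).
  by move=> hx; apply: (is_derive_eq (derN (dy x hx))); ring.
have := linear_ode_bound_le (M := M) c0 st cNy dNy.
have h x : s < x < t -> - e x <= M.
  by move=> hx; rewrite (le_trans (ler_norm _))// normrN eM.
move=> /(_ h); lra.
Qed.

End calculus.

(** * Integrals as functions of their upper endpoint *)

Section integral_functions.
Context {R : realType}.
Implicit Types (f : R -> R) (a b t : R).

Lemma within_itvcy_itvcc f a b : {within `[a, +oo[, continuous f} ->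
  {within `[a, b], continuous f}.
Proof. by apply: continuous_subspaceW; exact: subset_itvl. Qed.

Lemma within_itvcy_itvcy f a b : a <= b -> {within `[a, +oo[, continuous f} ->
  {within `[b, +oo[, continuous f}.
Proof. by move=> ab; apply: continuous_subspaceW; apply: subset_itvr. Qed.

Lemma within_itvcy_interior f a t : a < t ->
  {within `[a, +oo[, continuous f} -> {for t, continuous f}.
Proof.
by move=> at_ /continuous_within_itvcyP[h _]; apply: h; rewrite in_itv/= at_.
Qed.

Lemma integrable_within f a b : {within `[a, b], continuous f} ->
  lebesgue_measure.-integrable `[a, b] (EFin \o f).
Proof. by move=> h; apply: continuous_compact_integrable => //; exact: segment_compact. Qed.

Lemma rint_der f a t : a < t -> {within `[a, +oo[, continuous f} ->
  is_derive t 1 (fun t => \int[lebesgue_measure]_(s in `[a, t]) f s) (f t).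
Proof.
move=> at_ cf; have tt1 : t < t + 1 by rewrite ltrDl.
have [] := @continuous_FTC1_closed R f a t (t + 1) tt1 _ at_ _.
- exact: integrable_within (within_itvcy_itvcc cf).
- exact: within_itvcy_interior at_ cf.
- by move=> h <-; rewrite derive1E; apply/derivableP.
Qed.

Lemma rint_set1 f a : \int[lebesgue_measure]_(s in `[a, a]) f s = 0.
Proof. by rewrite set_itv1 Rintegral_set1. Qed.

Lemma rint_within f a : {within `[a, +oo[, continuous f} ->
  {within `[a, +oo[, continuous (fun t => \int[lebesgue_measure]_(s in `[a, t]) f s)}.
Proof.
move=> cf; apply/continuous_within_itvcyP; split.
  by move=> t; rewrite in_itv/= andbT => at_; exact: der_continuous (rint_der at_ cf).
rewrite rint_set1.
have a1 : a < a + 1 by rewrite ltrDl.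
have /cvg_at_right_filter := parameterized_integral_cvg_left a1
  (integrable_within (within_itvcy_itvcc cf)).
exact.
Qed.

End integral_functions.

(** * The running average and the gap to the Ornstein-Uhlenbeck path *)

Lemma powR_succ {R : realType} (x k l : R) : 0 < x -> l = k + 1 ->
  x `^ l = x `^ k * x.
Proof.
move=> x0 ->; rewrite powRD; last by rewrite (gt_eqF x0) implybT.
by rewrite powRr1// ltW.
Qed.

Lemma powRN_cvg0 {R : realType} (d : R) : 0 < d ->
  (1 + t) `^ (- d) @[t --> +oo] --> (0 : R).
Proof.
move=> d0; apply/cvgrPdist_le => /= e e0; near=> t.
have t0 : 0 <= t by near: t; apply: nbhs_pinfty_ge; rewrite num_real.
rewrite sub0r normrN ger0_norm ?powR_ge0// powRN -[leRHS]invrK.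
rewrite lef_pV2 ?posrE ?invr_gt0// ?powR_gt0; try lra.
have -> : e^-1 = (e^-1 `^ (d^-1)) `^ d.
  by rewrite -powRrM mulVf ?gt_eqF// powRr1// invr_ge0 ltW.
apply: ge0_ler_powR; rewrite ?nnegrE ?powR_ge0 ?(ltW d0)//; first lra.
suff : e^-1 `^ d^-1 <= t by lra.
by near: t; apply: nbhs_pinfty_ge; rewrite num_real.
Unshelve. all: by end_near. Qed.

Section ode_comparison.
Context {R : realType}.
Implicit Types (p e q y : R -> R) (c k s t T : R).

(** The function q = - 4 (1 + s)^(-1/4) solves (1 + s) q' = (1 + s)^(-1/4), the
    rate at which the running average of a path of growth 3/4 decays. *)
Lemma powR_quarter_der s : -1 < s ->
  is_derive s 1 (fun s => - (4 * (1 + s) `^ (- (1 / 4)))) ((1 + s) `^ (- (1 / 4)) / (1 + s)).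
Proof.
move=> s1; have s0 : 0 < 1 + s by lra.
apply: (is_derive_eq (derN (derZ 4 (der_powR (- (1 / 4)) s0 (derD (derC 1 s) (derI s)))))).
rewrite (powR_succ (k := - (1 / 4) - 1) (l := - (1 / 4)) s0); last by lra.
by field; rewrite gt_eqF.
Qed.

Lemma powR_quarter_le1 s : 0 <= s -> 0 <= (1 + s) `^ (- (1 / 4)) <= 1.
Proof.
move=> s0; rewrite powR_ge0/= powRN invf_le1; last by apply: powR_gt0; lra.
have : 1 `^ (1 / 4) <= (1 + s) `^ (1 / 4) by apply: ge0_ler_powR; rewrite ?nnegrE; lra.
by rewrite powR1.
Qed.

(** Comparison in logarithmic time: (1 + s)^k (q - p) is nondecreasing as soon
    as q is a supersolution of (1 + s) p' = - k p + e. *)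
Lemma slow_ode_bound_le p e q dq k T t : 0 <= k -> 0 <= T -> T <= t ->
  {within `[T, t], continuous p} ->
  (forall s, T < s < t -> is_derive s 1 p ((- k * p s + e s) / (1 + s))) ->
  {within `[T, t], continuous q} ->
  (forall s, T < s < t -> is_derive s 1 q (dq s)) -> 0 <= q T ->
  (forall s, T < s < t -> e s <= k * q s + (1 + s) * dq s) ->
  p t <= (1 + T) `^ k / (1 + t) `^ k * `|p T| + q t.
Proof.
move=> k0 T0 Tt cp dp cq dq_ qT eq_.
pose w s := (1 + s) `^ k * (q s - p s).
have d1 s : is_derive s 1 (fun s : R => 1 + s) 1.
  by apply: (is_derive_eq (derD (derC 1 s) (derI s))); ring.
have dw s : T < s < t -> is_derive s 1 w
    ((1 + s) `^ (k - 1) * (k * q s + (1 + s) * dq s - e s)).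
  move=> hs; have s1 : 0 < 1 + s by lra.
  apply: (is_derive_eq (derM (der_powR k s1 (d1 s)) (derB (dq_ s hs) (dp s hs)))).
  by rewrite (powR_succ s1 (esym (subrK 1 k))); field; rewrite gt_eqF.
have cw : {within `[T, t], continuous w}.
  move=> s; apply: cvgM; last by apply: cvgB; [exact: cq|exact: cp].
  apply: (@derivable_within_continuous _ _ (fun s : R => (1 + s) `^ k)) => r.
  rewrite in_itv/= => hr.
  have r1 : 0 < 1 + r by lra.
  by have [] := der_powR k r1 (d1 r).
have := derive_nondecreasing Tt cw dw.
have hnn s : T < s < t -> 0 <= (1 + s) `^ (k - 1) * (k * q s + (1 + s) * dq s - e s).
  by move=> hs; rewrite mulr_ge0 ?powR_ge0// subr_ge0 eq_.
move=> /(_ hnn); rewrite /w => h.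
have t1 : 0 < (1 + t) `^ k by apply: powR_gt0; lra.
rewrite mulrAC -lerBlDr ler_pdivlMr//.
have TT : 0 <= (1 + T) `^ k by exact: powR_ge0.
have h2 : (1 + T) `^ k * p T <= (1 + T) `^ k * `|p T|.
  by rewrite ler_wpM2l// ler_norm.
have h3 : 0 <= (1 + T) `^ k * q T by rewrite mulr_ge0.
lra.
Qed.

Lemma slow_ode_bound p e q dq k T t : 0 <= k -> 0 <= T -> T <= t ->
  {within `[T, t], continuous p} ->
  (forall s, T < s < t -> is_derive s 1 p ((- k * p s + e s) / (1 + s))) ->
  {within `[T, t], continuous q} ->
  (forall s, T < s < t -> is_derive s 1 q (dq s)) -> 0 <= q T ->
  (forall s, T < s < t -> `|e s| <= k * q s + (1 + s) * dq s) ->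
  `|p t| <= (1 + T) `^ k / (1 + t) `^ k * `|p T| + q t.
Proof.
move=> k0 T0 Tt cp dp cq dq_ qT eq_; rewrite ler_norml lerNl; apply/andP; split.
  rewrite -(normrN (p T)).
  apply: (@slow_ode_bound_le (fun s => - p s) (fun s => - e s) q dq) => //.
  - by move=> s; apply: cvgN; exact: cp.
  - by move=> s hs; apply: (is_derive_eq (derN (dp s hs))); rewrite -mulNr; congr (_ / _); ring.
  - by move=> s hs; rewrite (le_trans (ler_norm _))// normrN eq_.
apply: slow_ode_bound_le cp dp cq dq_ qT _ => // s hs.
by rewrite (le_trans (ler_norm _))// eq_.
Qed.

(** A stable linear equation forgets its initial value and follows the limit
    of its forcing. *)
Lemma linear_ode_cvg c y e (l : R) : 0 < c -> {within `[0, +oo[, continuous y} ->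
  (forall s, 0 < s -> is_derive s 1 y (- c * y s + e s)) ->
  e t @[t --> +oo] --> l -> y t @[t --> +oo] --> l / c.
Proof.
move=> c0 cy dy el; apply/cvgrPdist_le => /= eps eps0.
have [T0 [_ hT]] : \forall t \near +oo, `|l - e t| <= c * (eps / 2).
  by move/cvgrPdist_le: el; apply; rewrite !mulr_gt0// invr_gt0.
pose T : R := Num.max T0 0 + 1.
have T1 : T0 < T by rewrite /T ltr_pwDr// le_max lexx.
have T2 : 0 < T by rewrite /T ltr_wpDl// le_max lexx orbT.
pose w s := y s - l / c.
have key t : T <= t -> `|w t| <= expR (- c * (t - T)) * `|w T| + eps / 2.
  move=> Tt.
  have cw : {within `[T, t], continuous w}.
    move=> s; apply: cvgB; last exact: cvg_cst.
    by apply: (within_itvcy_itvcc (within_itvcy_itvcy (ltW T2) cy)).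
  have dw s : T < s < t -> is_derive s 1 w (- c * w s + (e s - l)).
    move=> /andP[Ts _]; have s0 : 0 < s by exact: lt_trans Ts.
    apply: (is_derive_eq (derB (dy s s0) (derC (l / c) s))).
    by rewrite /w; field; rewrite gt_eqF.
  have ew s : T < s < t -> `|e s - l| <= c * (eps / 2).
    by move=> /andP[Ts _]; rewrite distrC; apply: hT; exact: lt_trans Ts.
  have := linear_ode_bound c0 Tt cw dw ew.
  have -> : c * (eps / 2) / c = eps / 2 by rewrite mulrAC divff ?mul1r// gt_eqF.
  move=> h.
  have h2 : eps / 2 * (1 - expR (- c * (t - T))) <= eps / 2.
    by rewrite ler_piMr// ?lerBlDr ?lerDl ?expR_ge0// divr_ge0// ltW.
  have := le_trans h h2; have := ler_dist_dist (w t) (expR (- c * (t - T)) * w T).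
  rewrite normrM (ger0_norm (expR_ge0 _)) => h3 h4.
  have := le_trans (ler_norm _) (le_trans h3 h4); lra.
near=> t.
rewrite distrC; apply: (le_trans (key t _)); first by near: t; apply: nbhs_pinfty_ge; rewrite num_real.
rewrite [leRHS](splitr eps) lerD2r mulNr expRN -ler_pdivlMl ?invr_gt0 ?expR_gt0// invrK.
have : expR (c * (t - T)) >= c * (t - T) by apply: le_trans (expR_ge1Dx _); rewrite lerDr.
set E := expR _ => hE; rewrite (mulrC E) -ler_pdivrMl ?divr_gt0//.
apply: le_trans hE; rewrite -ler_pdivrMl// -lerBlDr opprK.
near: t; apply: nbhs_pinfty_ge; rewrite num_real//.
Unshelve. all: by end_near. Qed.

End ode_comparison.

Definition time_avg {R : realType} (x : R -> R) (t : R) : R :=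
  (1 + t)^-1 * \int[lebesgue_measure]_(s in `[-1, t]) x s.

Section pathwise.
Context {R : realType}.
Implicit Types t s : R.
Variables (a b : R) (x u beta : R -> R).
Local Notation mu := (@lebesgue_measure R).
Local Notation I := (fun t : R => \int[mu]_(s in `[-1, t]) x s).
Local Notation m := (time_avg x).
Hypothesis a_lt0 : a < 0.
Hypothesis ab_le0 : a + b <= 0.
Hypothesis x_cont : {within `[-1, +oo[, continuous x}.
Hypothesis u_cont : {within `[0, +oo[, continuous u}.
Hypothesis beta_cont : {within `[0, +oo[, continuous beta}.
Hypothesis beta0 : beta 0 = 0.
Hypothesis x_eq : forall t, 0 <= t ->
  x t = x 0 + \int[mu]_(s in `[0, t]) (a * x s + b / (1 + s) * \int[mu]_(q in `[-1, s]) x q) + beta t.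
Hypothesis u_eq : forall t, 0 <= t ->
  u t = \int[mu]_(s in `[0, t]) (a * u s) + beta t.

Lemma within_cont_from0 : {within `[0, +oo[, continuous x}.
Proof. by apply: within_itvcy_itvcy x_cont; rewrite lerN10. Qed.

Lemma running_integral_cont : {within `[0, +oo[, continuous I}.
Proof. by apply: within_itvcy_itvcy (rint_within x_cont); rewrite lerN10. Qed.

Lemma running_integral_der t : -1 < t -> is_derive t 1 I (x t).
Proof. by move=> t1; exact: rint_der. Qed.

Let inv_cont : {within `[0, +oo[, continuous (fun t : R => (1 + t)^-1)}.
Proof.
have h (t : R) : 0 < 1 + t -> {for t, continuous (fun t : R => (1 + t)^-1)}.
  move=> t0; apply: cvgV; first by rewrite gt_eqF.
  by apply: cvgD; [exact: cvg_cst|exact: cvg_id].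
apply/continuous_within_itvcyP; split.
  by move=> t; rewrite in_itv/= andbT => t0; apply: h; lra.
by apply: cvg_at_right_filter; apply: h; lra.
Qed.

Lemma time_avg_cont : {within `[0, +oo[, continuous m}.
Proof. by move=> t; apply: cvgM; [exact: inv_cont|exact: running_integral_cont]. Qed.

Lemma time_avg_der t : 0 < t -> is_derive t 1 m ((x t - m t) / (1 + t)).
Proof.
move=> t0; have t1 : 1 + t != 0 by rewrite gt_eqF//; lra.
apply: (is_derive_eq (derM (derV (f := fun t => 1 + t) t1 (derD (derC 1 t) (derI t)))
  (running_integral_der (ltac:(lra) : -1 < t)))).
by rewrite /time_avg; field.
Qed.

Lemma drift_x_der t : 0 < t ->
  is_derive t 1 (fun t => x t - beta t) (a * x t + b * m t).
Proof.
move=> t0.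
have c1 : {within `[0, +oo[, continuous (fun s => a * x s + b / (1 + s) * \int[mu]_(q in `[-1, s]) x q)}.
  move=> s; apply: cvgD; apply: cvgM.
  - exact: cvg_cst.
  - exact: within_cont_from0.
  - by apply: cvgM; [exact: cvg_cst|exact: inv_cont].
  - exact: running_integral_cont.
have := derD (derC (x 0) t) (rint_der t0 c1).
have -> : 0 + (a * x t + b / (1 + t) * \int[mu]_(q in `[-1, t]) x q) = a * x t + b * m t.
  by rewrite add0r /time_avg mulrA.
apply: der_ext t0 _ => s; rewrite in_itv/= andbT => s0.
by rewrite (x_eq (ltW s0)) addrK.
Qed.

Lemma ou_drift_der t : 0 < t -> is_derive t 1 (fun t => u t - beta t) (a * u t).
Proof.
move=> t0.
have c1 : {within `[0, +oo[, continuous (fun s => a * u s)}.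
  by move=> s; apply: cvgM; [exact: cvg_cst|exact: u_cont].
have := rint_der t0 c1; apply: der_ext t0 _ => s; rewrite in_itv/= andbT => s0.
by rewrite (u_eq (ltW s0)) addrK.
Qed.

Definition gap_xu t := x t - u t.
Definition drift_u t := u t - beta t.
(** The average m has a forcing of size x / (1 + t) that is not small; removing
    (y + z) / (a (1 + t)), whose numerator has derivative a x + b m, turns
    a into a rate and leaves only the averages of y and z as forcing. *)
Definition slow_var t := time_avg x t - (drift_u t + gap_xu t) / (a * (1 + t)).
Definition avg_u t := drift_u t / (a * (1 + t)).

Local Notation z := gap_xu.
Local Notation y := drift_u.
Local Notation p := slow_var.
Local Notation mU := avg_u.

(** The Brownian term cancels in the difference of the two equations. *)
Lemma gap_der t : 0 < t -> is_derive t 1 z (a * z t + b * m t).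
Proof.
move=> t0; have := derB (drift_x_der t0) (ou_drift_der t0).
have -> : a * x t + b * m t - a * u t = a * z t + b * m t by rewrite /gap_xu; ring.
by apply: der_ext t0 _ => s _; rewrite /gap_xu; ring.
Qed.

Lemma gap_cont : {within `[0, +oo[, continuous z}.
Proof. by move=> s; apply: cvgB; [exact: within_cont_from0|exact: u_cont]. Qed.

Lemma drift_u_cont : {within `[0, +oo[, continuous y}.
Proof. by move=> s; apply: cvgB; [exact: u_cont|exact: beta_cont]. Qed.

Lemma slow_var_cont : {within `[0, +oo[, continuous p}.
Proof.
move=> s; apply: cvgB; first exact: time_avg_cont.
apply: cvgM; first by apply: cvgD; [exact: drift_u_cont|exact: gap_cont].
have -> : (a * (1 + s))^-1 = a^-1 * (1 + s)^-1 by rewrite invfM.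
rewrite (_ : (fun s => (a * (1 + s))^-1) = (fun s : R => a^-1 * (1 + s)^-1)).
  by apply: cvgM; [exact: cvg_cst|exact: inv_cont].
by apply/funext => q; rewrite invfM.
Qed.

Definition slow_rate : R := (a + b) / a.

Local Notation kappa := slow_rate.
(** Both a + b and a are nonpositive: the averaged system is not unstable. *)
Lemma slow_rate_ge0 : 0 <= kappa.
Proof. by rewrite /slow_rate nmulr_lge0// invr_lt0. Qed.

Definition slow_forcing t := - (b / a) * (gap_xu t / (a * (1 + t)) + avg_u t).

Local Notation r := slow_forcing.
(** Substituting x = (y + z)' / a - (b / a) m into m' = (x - m) / (1 + t). *)
Lemma slow_var_der t : 0 < t -> is_derive t 1 p ((- kappa * p t + r t) / (1 + t)).
Proof.
move=> t0; have t1 : a * (1 + t) != 0.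
  by rewrite lt_eqF// nmulr_rlt0//; lra.
have t1' : 1 + t != 0 by rewrite gt_eqF//; lra.
have a0 : a != 0 by rewrite lt_eqF.
apply: (is_derive_eq (derB (time_avg_der t0) (derM (derD (ou_drift_der t0) (gap_der t0))
  (derV (f := fun t => a * (1 + t)) t1 (derZ a (derD (derC 1 t) (derI t))))))).
by rewrite /slow_var /slow_forcing /avg_u /slow_rate /drift_u /gap_xu; field; rewrite a0 t1'.
Qed.

Variable C : R.
Hypothesis beta_growth : forall t, 0 <= t -> `|beta t| <= C * (1 + t) `^ (3 / 4).

(** The equation y' = a y + a beta is stable, so y is bounded by the maximum
    of beta so far. *)
Lemma drift_u_growth t : 0 <= t -> `|y t| <= C * (1 + t) `^ (3 / 4).
Proof.
move=> t0; have C0 : 0 <= C.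
  have := beta_growth (lexx 0); rewrite addr0 powR1 mulr1; exact: le_trans.
have na : 0 < - a by rewrite oppr_gt0.
have yd s : 0 < s < t -> is_derive s 1 y (- (- a) * y s + a * beta s).
  move=> /andP[s0 _]; apply: (is_derive_eq (ou_drift_der s0)).
  by rewrite /drift_u; ring.
have := @linear_ode_bound R (- a) (- a * (C * (1 + t) `^ (3 / 4))) y
  (fun s => a * beta s) 0 t na t0
  (within_itvcy_itvcc drift_u_cont) yd _.
have y0 : y 0 = 0.
  by rewrite /drift_u u_eq// rint_set1 beta0; ring.
set K := C * _; have -> : - a * K / - a = K.
  by rewrite mulrAC divff ?mul1r// gt_eqF.
rewrite y0 mulr0 subr0 => h; apply: (le_trans (h _)).
  move=> s /andP[s0 st]; rewrite normrM ltr0_norm// ler_pM2l//.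
  apply: (le_trans (beta_growth (ltW s0))).
  by apply: ler_wpM2l => //; apply: ge0_ler_powR; rewrite ?nnegrE; lra.
apply: ler_piMr; first by rewrite mulr_ge0// powR_ge0.
by rewrite lerBlDr lerDl expR_ge0.
Qed.

Lemma avg_u_growth t : 0 <= t -> `|mU t| <= C / - a * (1 + t) `^ (- (1 / 4)).
Proof.
move=> t0; have t1 : 0 < 1 + t by lra.
rewrite /avg_u normrM normfV normrM (ltr0_norm a_lt0) (gtr0_norm t1).
rewrite ler_pdivrMr; last by rewrite mulr_gt0// oppr_gt0.
apply: (le_trans (drift_u_growth t0)).
rewrite (powR_succ (k := - (1 / 4)) t1); last by lra.
by rewrite le_eqVlt; apply/orP; left; apply/eqP; field; rewrite lt_eqF.
Qed.

Let C_ge0 : 0 <= C.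
Proof.
by have := beta_growth (lexx 0); rewrite addr0 powR1 mulr1; exact: le_trans.
Qed.

(** The supersolution is the primitive of the bound on the forcing, which is
    summable in logarithmic time: N / (1 + s) comes from the gap and
    (1 + s)^(-1/4) from y.  The gap enters with the factor 1 / (1 + T), which
    is what allows the loop to be closed for large T. *)
Lemma slow_var_bound (N T : R) t : 0 <= T -> T <= t ->
  (forall s, T <= s <= t -> `|z s| <= N) ->
  `|p t| <= `|p T| + `|b| / - a * (N / (- a * (1 + T)) + 4 * (C / - a)).
Proof.
move=> T0 Tt zN; have A0 : 0 < - a by rewrite oppr_gt0.
have N0 : 0 <= N by apply: le_trans (zN T _); rewrite ?lexx.
pose D : R := `|b| / - a.
have D0 : 0 <= D by rewrite divr_ge0// ltW.
pose K1 : R := N / - a; pose K2 := C / - a.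
have K10 : 0 <= K1 by rewrite divr_ge0// ltW.
have K20 : 0 <= K2 by rewrite divr_ge0// ltW.
pose q s := D * (K1 * ((1 + T)^-1 - (1 + s)^-1) +
  K2 * (4 * (1 + T) `^ (- (1 / 4)) + - (4 * (1 + s) `^ (- (1 / 4))))).
pose dq s := D * (K1 / (1 + s) + K2 * (1 + s) `^ (- (1 / 4))) / (1 + s).
have qd s : 0 <= s -> is_derive s 1 q (dq s).
  move=> s0; have s1 : 1 + s != 0 by rewrite gt_eqF//; lra.
  apply: (is_derive_eq (derZ D (derD (derZ K1 (derB (derC (1 + T)^-1 s)
     (derV (f := fun s => 1 + s) s1 (derD (derC 1 s) (derI s)))))
     (derZ K2 (derD (derC (4 * (1 + T) `^ (- (1 / 4))) s) (@powR_quarter_der R s (ltac:(lra)))))))).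
  by rewrite /dq; field.
have cq : {within `[T, t], continuous q}.
  apply: (@derivable_within_continuous _ _ q) => r; rewrite in_itv/= => /andP[hr _].
  by have [] := qd r (le_trans T0 hr).
have qT : q T = 0 by rewrite /q; ring.
have eb s : T < s < t -> `|r s| <= kappa * q s + (1 + s) * dq s.
  move=> /andP[Ts st]; have s0 : 0 <= s by lra.
  have s1 : 0 < 1 + s by lra.
  have -> : (1 + s) * dq s = D * (K1 / (1 + s) + K2 * (1 + s) `^ (- (1 / 4))).
    by rewrite /dq; field; rewrite gt_eqF.
  rewrite ler_wpDl//.
    rewrite mulr_ge0 ?slow_rate_ge0// mulr_ge0// addr_ge0// mulr_ge0//.
      by rewrite subr_ge0 lef_pV2 ?posrE//; lra.
    rewrite -mulrBr mulr_ge0// subr_ge0 !powRN lef_pV2 ?posrE; try by apply: powR_gt0; lra.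
    by apply: ge0_ler_powR; rewrite ?nnegrE; lra.
  rewrite /slow_forcing normrM normrN.
  have -> : `|b / a| = D by rewrite /D normrM normfV (ltr0_norm a_lt0).
  rewrite ler_wpM2l//; apply: (le_trans (ler_normD _ _)); apply: lerD; last exact: avg_u_growth.
  rewrite normrM normfV normrM (ltr0_norm a_lt0) (gtr0_norm s1) invfM mulrA.
  rewrite ler_wpM2r ?invr_ge0 ?(ltW s1)// /K1 ler_wpM2r ?invr_ge0 ?(ltW A0)//.
  by apply: zN; lra.
have dp s : T < s < t -> is_derive s 1 p ((- kappa * p s + r s) / (1 + s)).
  by move=> /andP[Ts _]; apply: slow_var_der; lra.
have cp : {within `[T, t], continuous p}.
  exact: within_itvcy_itvcc (within_itvcy_itvcy T0 slow_var_cont).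
have hq s : T < s < t -> is_derive s 1 q (dq s).
  by move=> /andP[Ts _]; apply: qd; lra.
have qT0 : 0 <= q T by rewrite qT.
have := slow_ode_bound slow_rate_ge0 T0 Tt cp dp cq hq qT0 eb.
move=> /le_trans; apply; apply: lerD.
  rewrite ler_piMl// ler_pdivrMr; last by apply: powR_gt0; lra.
  by rewrite mul1r; apply: ge0_ler_powR; rewrite ?slow_rate_ge0 ?nnegrE//; lra.
rewrite /q ler_wpM2l//; apply: lerD.
  rewrite invfM mulrA ler_wpM2l// gerBl invr_ge0; lra.
rewrite mulrC ler_wpM2r//.
have := powR_quarter_le1 T0; have := @powR_quarter_le1 R t (ltac:(lra)); lra.
Qed.

(** A closed loop: if N is the maximum of |z| on [T, t], then p, and hence m,
    is bounded by a constant plus N times a factor that T makes small, and the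
    stable equation of z gives N <= K + N / 2 with K independent of t. *)
Lemma gap_bounded : exists N : R, forall t, 0 <= t -> `|z t| <= N.
Proof.
have A0 : 0 < - a by rewrite oppr_gt0.
pose D : R := `|b| / - a.
have D0 : 0 <= D by rewrite divr_ge0// ltW.
(* This makes D (D + 1) / (- a (1 + T)) <= 1/2, the contraction of the loop. *)
pose T : R := 2 * (D * (D + 1) / - a).
have T0 : 0 <= T by rewrite !mulr_ge0 ?addr_ge0 ?invr_ge0// ltW.
have czT t' t : 0 <= t' -> {within `[t', t], continuous (fun s => `|z s|)}.
  move=> t0' s; apply: cvg_norm.
  exact: (within_itvcy_itvcc (within_itvcy_itvcy t0' gap_cont)).
have [s0 _ hs0] := EVT_max T0 (czT 0 T (lexx _)).
pose K1 : R := `|z T| + D * (`|p T| + D * (4 * (C / - a)) + C / - a).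
exists (Num.max `|z s0| (2 * K1)) => t t0.
rewrite le_max; case: (leP t T) => tT.
  by rewrite hs0// in_itv/= t0.
have [s1 + hs1] := EVT_max (ltW tT) (czT T t T0).
rewrite in_itv/= => /andP[Ts1 s1t].
apply/orP; right; apply: (@le_trans _ _ `|z s1|).
  by apply: hs1; rewrite in_itv/= lexx ltW.
set N : R := `|z s1|.
have N0 : 0 <= N by exact: normr_ge0.
have zN s : T <= s <= t -> `|z s| <= N by move=> h; apply: hs1; rewrite in_itv.
have T1 : 0 < 1 + T by lra.
pose M : R := `|p T| + D * (N / (- a * (1 + T)) + 4 * (C / - a)) + C / - a + N / (- a * (1 + T)).
have mM s : T < s < s1 -> `|b * m s| <= `|b| * M.
  move=> /andP[Ts ss1]; rewrite normrM ler_wpM2l//.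
  have sne : 0 < 1 + s by lra.
  have -> : m s = p s + mU s + z s / (a * (1 + s)).
    by rewrite /slow_var /avg_u; field; rewrite (gt_eqF sne) (lt_eqF a_lt0).
  apply: (le_trans (ler_normD _ _)); apply: lerD.
    apply: (le_trans (ler_normD _ _)); apply: lerD.
      apply: slow_var_bound => //; first exact: ltW.
      by move=> r' hr'; apply: zN; lra.
    apply: (le_trans (avg_u_growth _)); first lra.
    rewrite ler_piMr ?divr_ge0 ?(ltW A0)//.
    by have /andP[] := @powR_quarter_le1 R s (ltac:(lra)).
  rewrite normrM normfV normrM (ltr0_norm a_lt0) (gtr0_norm sne).
  apply: ler_pM => //; first by rewrite invr_ge0 mulr_ge0// ltW.
    by apply: zN; lra.
  rewrite lef_pV2 ?posrE ?mulr_gt0// ler_pM2l//; lra.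
have dz s : T < s < s1 -> is_derive s 1 z (- (- a) * z s + b * m s).
  by move=> /andP[Ts _]; rewrite opprK; apply: gap_der; lra.
have := linear_ode_bound A0 Ts1 (within_itvcy_itvcc (within_itvcy_itvcy T0 gap_cont)) dz mM.
set E := expR _ => h.
have E0 : 0 <= E by exact: expR_ge0.
have E1 : E <= 1.
  by rewrite -expR0 ler_expR opprK mulrC nmulr_lle0// subr_ge0.
have hM : `|b| * M / - a * (1 - E) <= D * M.
  have -> : `|b| * M / - a = D * M by rewrite /D mulrAC.
  rewrite ler_piMr ?lerBlDr ?lerDl//.
  have X1 : 0 <= N / (- a * (1 + T)) by rewrite divr_ge0// mulr_ge0// ltW.
  have X2 : 0 <= C / - a by rewrite divr_ge0// ltW.
  rewrite mulr_ge0// /M; have := normr_ge0 (p T).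
  have := mulr_ge0 D0 (addr_ge0 X1 (mulr_ge0 (ler0n R 4) X2)); lra.
have h1 : N <= E * `|z T| + D * M.
  have := le_trans h hM; have := ler_dist_dist (z s1) (E * z T).
  rewrite normrM (ger0_norm E0) -/N => h3 h4.
  have := le_trans (ler_norm _) (le_trans h3 h4); lra.
have h2 : E * `|z T| <= `|z T| by rewrite ler_piMl.
have h3 : D * M = D * (`|p T| + D * (4 * (C / - a)) + C / - a) + D * (D + 1) / - a / (1 + T) * N.
  by rewrite /M; field; rewrite (gt_eqF T1) (lt_eqF a_lt0).
have h4 : D * (D + 1) / - a / (1 + T) <= 1 / 2.
  rewrite ler_pdivrMr//; rewrite /T; lra.
have h5 : D * (D + 1) / - a / (1 + T) * N <= 1 / 2 * N by rewrite ler_wpM2r.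
by rewrite /K1; lra.
Qed.

Let forcing_growth (N : R) : (forall t, 0 <= t -> `|z t| <= N) ->
  exists2 D, 0 <= D & forall s, 0 <= s -> `|r s| <= D * (1 + s) `^ (- (1 / 4)).
Proof.
move=> zN; have A0 : 0 < - a by rewrite oppr_gt0.
have N0 : 0 <= N by apply: le_trans (zN 0 _).
exists (`|b| / - a * (N / - a + C / - a)).
  by rewrite mulr_ge0 ?addr_ge0 ?divr_ge0// ltW.
move=> s s0; have s1 : 0 < 1 + s by lra.
rewrite /slow_forcing normrM normrN normrM normfV (ltr0_norm a_lt0) -[leRHS]mulrA ler_wpM2l//.
  by rewrite divr_ge0// ltW.
apply: (le_trans (ler_normD _ _)); rewrite [leRHS]mulrDl; apply: lerD; last exact: avg_u_growth.
rewrite normrM normfV normrM (ltr0_norm a_lt0) (gtr0_norm s1) invfM mulrA.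
apply: ler_pM => //; rewrite ?invr_ge0 ?(ltW s1)//.
- by rewrite mulr_ge0// invr_ge0 ltW.
- by rewrite ler_wpM2r ?zN// invr_ge0 ltW.
- rewrite -[(1 + s)^-1]powR_inv1 ?(ltW s1)//; apply: ler_powR; lra.
Qed.

(** If a + b < 0 the equation of p is stable in logarithmic time and its
    forcing tends to 0.  If a + b = 0 the rate vanishes, and p converges
    because p' is integrable, being O((1 + s)^(-5/4)). *)
Lemma slow_var_cvg : exists2 l : R, (a + b < 0 -> l = 0) & p t @[t --> +oo] --> l.
Proof.
have [N /forcing_growth[D D0 rD]] := gap_bounded.
have dp s : 0 < s -> is_derive s 1 p ((- kappa * p s + r s) / (1 + s)).
  exact: slow_var_der.
move: ab_le0; rewrite le_eqVlt => /orP[/eqP ab0|ab]; last first.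
  exists 0 => //.
  have k0 : 0 < kappa by rewrite /slow_rate nmulr_lgt0// invr_lt0.
  (* The supersolution decays like (1 + s)^(- d), slower than the equation and no faster than its forcing. *)
  pose d : R := Num.min (kappa / 2) (1 / 4).
  have d0 : 0 < d by rewrite /d lt_min divr_gt0//=; lra.
  have dk : d < kappa by apply: (@le_lt_trans _ _ (kappa / 2)); [rewrite ge_min lexx|lra].
  have d4 : d <= 1 / 4 by rewrite /d ge_min lexx orbT.
  pose q s := D / (kappa - d) * (1 + s) `^ (- d).
  pose dq s := - d * q s / (1 + s).
  have qd s : -1 < s -> is_derive s 1 q (dq s).
    move=> s1; have s0 : 0 < 1 + s by lra.
    apply: (is_derive_eq (derZ (D / (kappa - d)) (der_powR (- d) s0 (derD (derC 1 s) (derI s))))).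
    rewrite /dq /q (powR_succ (k := - d - 1) (l := - d) s0); last by lra.
    by field; rewrite (gt_eqF s0) subr_eq0 gt_eqF.
  have bound t : 0 <= t -> `|p t| <= (1 + t) `^ (- kappa) * `|p 0| + q t.
    move=> t0.
    have cq : {within `[0, t], continuous q}.
      apply: (@derivable_within_continuous _ _ q) => s; rewrite in_itv/= => /andP[hs _].
      by have [] := qd s (ltac:(lra)).
    have q0 : 0 <= q 0 by rewrite mulr_ge0 ?powR_ge0// divr_ge0// subr_ge0 ltW.
    have := slow_ode_bound (ltW k0) (lexx 0) t0 (within_itvcy_itvcc slow_var_cont)
      (fun s (hs : 0 < s < t) => dp s (proj1 (andP hs))) cq
      (fun s (hs : 0 < s < t) => qd s (lt_trans (ltrN10 _) (proj1 (andP hs)))) q0.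
    rewrite addr0 powR1 div1r -powRN; apply => s /andP[s0 st].
    apply: (le_trans (rD _ (ltW s0))).
    have s1 : 0 < 1 + s by lra.
    have -> : kappa * q s + (1 + s) * dq s = D * (1 + s) `^ (- d).
      by rewrite /dq /q; field; rewrite (gt_eqF s1) subr_eq0 gt_eqF.
    by rewrite ler_wpM2l//; apply: ler_powR; lra.
  have lim0 : (1 + t) `^ (- kappa) * `|p 0| + q t @[t --> +oo] --> (0 : R).
    rewrite -[X in _ --> X]addr0; apply: cvgD.
      by rewrite -[X in _ --> X](mul0r `|p 0|); apply: cvgM; [exact: powRN_cvg0|exact: cvg_cst].
    rewrite -[X in _ --> X](mulr0 (D / (kappa - d))); apply: cvgM; [exact: cvg_cst|exact: powRN_cvg0].
  apply/norm_cvg0P; apply: (squeeze_cvgr _ (cvg_cst 0) lim0).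
  near=> t; rewrite normr_ge0/=; apply: bound.
  by near: t; apply: nbhs_pinfty_ge; rewrite num_real.
have k0 : kappa = 0 by rewrite /slow_rate ab0 mul0r.
have bound T t : 0 <= T -> T <= t -> `|p t - p T| <= 4 * D * (1 + T) `^ (- (1 / 4)).
  move=> T0 Tt.
  pose q s := D * (4 * (1 + T) `^ (- (1 / 4)) + - (4 * (1 + s) `^ (- (1 / 4)))).
  pose dq s := D * ((1 + s) `^ (- (1 / 4)) / (1 + s)).
  have qd s : -1 < s -> is_derive s 1 q (dq s).
    move=> s1; apply: (is_derive_eq (derZ D (derD (derC (4 * (1 + T) `^ (- (1 / 4))) s) (powR_quarter_der s1)))).
    by rewrite add0r.
  have cq : {within `[T, t], continuous q}.
    apply: (@derivable_within_continuous _ _ q) => s; rewrite in_itv/= => /andP[hs _].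
    by have [] := qd s (ltac:(lra)).
  have qT : q T = 0 by rewrite /q; ring.
  have qT0 : 0 <= q T by rewrite qT.
  have cp : {within `[T, t], continuous (fun s => p s - p T)}.
    move=> s; apply: cvgB; last exact: cvg_cst.
    by apply: (within_itvcy_itvcc (within_itvcy_itvcy T0 slow_var_cont)).
  have dp' s : T < s < t -> is_derive s 1 (fun s => p s - p T) ((- kappa * (p s - p T) + r s) / (1 + s)).
    move=> /andP[Ts _]; apply: (is_derive_eq (derB (dp s (le_lt_trans T0 Ts)) (derC (p T) s))).
    by rewrite k0; ring.
  have dq' s : T < s < t -> is_derive s 1 q (dq s).
    by move=> /andP[Ts _]; apply: qd; lra.
  have := slow_ode_bound slow_rate_ge0 T0 Tt cp dp' cq dq' qT0.
  rewrite subrr normr0 mulr0 add0r => h; apply: (le_trans (h _)) => [s /andP[Ts st]|].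
    have s1 : 0 < 1 + s by lra.
    rewrite k0 mul0r add0r /dq.
    have -> : (1 + s) * (D * ((1 + s) `^ (- (1 / 4)) / (1 + s))) = D * (1 + s) `^ (- (1 / 4)).
      by field; rewrite gt_eqF.
    by apply: rD; lra.
  have X : 0 <= D * (1 + t) `^ (- (1 / 4)) by rewrite mulr_ge0// powR_ge0.
  by rewrite /q; lra.
have : cauchy (p t @[t --> +oo]).
  apply: cauchy_exP => e e0.
  have lim0 : 4 * D * (1 + t) `^ (- (1 / 4)) @[t --> +oo] --> (0 : R).
    rewrite -[X in _ --> X](mulr0 (4 * D)); apply: cvgM; [exact: cvg_cst|].
    by apply: powRN_cvg0; lra.
  have [T [T0 hT]] : exists T : R, 0 <= T /\ 4 * D * (1 + T) `^ (- (1 / 4)) < e.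
    near (pinfty_nbhs R) => T; exists T; split.
      by near: T; apply: nbhs_pinfty_ge; rewrite num_real.
    have := ler_norm (4 * D * (1 + T) `^ (- (1 / 4))).
    move/le_lt_trans; apply; rewrite -normrN -sub0r; near: T.
    by move/cvgrPdist_lt : lim0; apply.
  exists (p T); suff: \forall t \near +oo, ball (p T) e (p t) by [].
  near=> t; rewrite /= /ball /= distrC.
  apply: le_lt_trans (bound T t T0 _) hT.
  by near: t; apply: nbhs_pinfty_ge; rewrite num_real.
move/cauchy_cvgP/cvg_ex => [l hl]; exists l => //; rewrite ab0 ltxx //.
Unshelve. all: by end_near. Qed.

(** The averages of y and z vanish, so m has the same limit as p; z then
    follows its forcing b m. *)
Lemma average_and_gap_cvg : exists2 l : R, (a + b < 0 -> l = 0) &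
  m t @[t --> +oo] --> l /\ z t @[t --> +oo] --> - (b / a) * l.
Proof.
have [l l0 pl] := slow_var_cvg; exists l => //.
have [N zN] := gap_bounded.
have A0 : 0 < - a by rewrite oppr_gt0.
have N0 : 0 <= N by apply: le_trans (zN 0 _).
have q0 : m t - p t @[t --> +oo] --> (0 : R).
  have lim0 : (N / - a + C / - a) * (1 + t) `^ (- (1 / 4)) @[t --> +oo] --> (0 : R).
    rewrite -[X in _ --> X](mulr0 (N / - a + C / - a)); apply: cvgM; [exact: cvg_cst|].
    by apply: powRN_cvg0; lra.
  apply/norm_cvg0P; apply: (squeeze_cvgr _ (cvg_cst 0) lim0).
  near=> t; rewrite normr_ge0/=.
  have t0 : 0 <= t by near: t; apply: nbhs_pinfty_ge; rewrite num_real.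
  have t1 : 0 < 1 + t by lra.
  have -> : m t - p t = z t / (a * (1 + t)) + mU t.
    by rewrite /slow_var /avg_u; field; rewrite (gt_eqF t1) (lt_eqF a_lt0).
  apply: (le_trans (ler_normD _ _)); rewrite [leRHS]mulrDl; apply: lerD; last exact: avg_u_growth.
  rewrite normrM normfV normrM (ltr0_norm a_lt0) (gtr0_norm t1) invfM mulrA.
  apply: ler_pM => //; rewrite ?invr_ge0 ?(ltW t1)//.
  - by rewrite mulr_ge0// invr_ge0 ltW.
  - by rewrite ler_wpM2r ?zN// invr_ge0 ltW.
  - rewrite -[(1 + t)^-1]powR_inv1 ?(ltW t1)//; apply: ler_powR; lra.
have ml : m t @[t --> +oo] --> l.
  have h : (fun t => (m t - p t) + p t) = m by apply/funext => t; rewrite subrK.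
  by rewrite -h -[l]add0r; exact: cvgD.
split => //.
have -> : - (b / a) * l = b * l / - a by field; rewrite lt_eqF.
have dz s : 0 < s -> is_derive s 1 z (- (- a) * z s + b * m s).
  by move=> s0; rewrite opprK; exact: gap_der.
have bml : b * m t @[t --> +oo] --> b * l by apply: cvgM; [exact: cvg_cst|exact: ml].
exact: (linear_ode_cvg A0 gap_cont dz bml).
Unshelve. all: by end_near. Qed.

End pathwise.

(** * The Tricomi function with both parameters equal to two *)

Section tricomi22.
Context {R : realType}.
Local Notation mu := (@lebesgue_measure R).
Implicit Types (s t y z : R) (w : R -> R).

(** Extended by 0 to the left, exp (- 1/s) is continuous, so that its primitive
    from 0 makes sense; it vanishes at 0 to all orders. *)
Definition exp_inv s : R := if s <= 0 then 0 else expR (- s^-1).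
Definition exp_inv_int y : R := \int[mu]_(s in `[0, y]) exp_inv s.
(** The substitution s = 1/r turns the integral of exp (- 1/s) over [0, 1/z]
    into that of r^(-2) exp (- r) over [z, oo); the value at z is then U(2, 2, z). *)
Definition tricomi22 z : R := expR z * exp_inv_int z^-1.

Lemma exp_inv_ge0 s : 0 <= exp_inv s.
Proof. by rewrite /exp_inv; case: ifP => // _; exact: expR_ge0. Qed.

Lemma exp_inv_gt0E s : 0 < s -> exp_inv s = expR (- s^-1).
Proof. by move=> s0; rewrite /exp_inv leNgt s0. Qed.

Lemma exp_inv_le s : 0 <= s -> exp_inv s <= s.
Proof.
rewrite le_eqVlt => /orP[/eqP <-|s0]; first by rewrite /exp_inv lexx.
rewrite exp_inv_gt0E// expRN -[leRHS]invrK lef_pV2 ?posrE ?invr_gt0 ?expR_gt0//.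
by apply: le_trans (expR_ge1Dx _); rewrite lerDr.
Qed.

Lemma exp_inv_der s : 0 < s ->
  is_derive s 1 exp_inv (expR (- s^-1) / s ^+ 2).
Proof.
move=> s0; have s1 : s != 0 by rewrite gt_eqF.
have : is_derive s 1 (fun s => expR (- s^-1)) (expR (- s^-1) / s ^+ 2).
  apply: (is_derive_eq (der_expR (derN (derV (f := id) s1 (derI s))))).
  by rewrite /=; field.
by apply: der_ext s0 _ => t; rewrite in_itv/= andbT => t0; rewrite exp_inv_gt0E.
Qed.

Lemma exp_inv_cont : {within `[0, +oo[, continuous exp_inv}.
Proof.
apply/continuous_within_itvcyP; split.
  by move=> s; rewrite in_itv/= andbT => s0; exact: der_continuous (exp_inv_der s0).
have -> : exp_inv 0 = 0 by rewrite /exp_inv lexx.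
have id0 : (s : R) @[s --> 0^'+] --> (0 : R) by apply: cvg_at_right_filter; exact: cvg_id.
apply: (squeeze_cvgr _ (cvg_cst 0) id0).
near=> s; rewrite exp_inv_ge0 exp_inv_le//.
Unshelve. all: by end_near. Qed.

Lemma exp_inv_int_der y : 0 < y -> is_derive y 1 exp_inv_int (exp_inv y).
Proof. by move=> y0; apply: rint_der => //; exact: exp_inv_cont. Qed.

Lemma exp_inv_int_cont : {within `[0, +oo[, continuous exp_inv_int}.
Proof. exact: rint_within exp_inv_cont. Qed.

Lemma exp_inv_int0 : exp_inv_int 0 = 0.
Proof. exact: rint_set1. Qed.

Lemma exp_inv_int_ge0 y : 0 <= y -> 0 <= exp_inv_int y.
Proof. by move=> y0; apply: Rintegral_ge0 => s _; exact: exp_inv_ge0. Qed.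

Let id_cont : {within `[0, +oo[, continuous (fun y : R => y)}.
Proof. by apply: continuous_subspaceT => y; exact: cvg_id. Qed.

(** Both sides vanish at 0 and s^2 exp (- 1/s) has derivative
    (2 s + 1) exp (- 1/s). *)
Lemma exp_inv_int_le y : 0 <= y -> exp_inv_int y <= y ^+ 2 * exp_inv y.
Proof.
move=> y0; rewrite -subr_ge0.
have := @derive_nondecreasing _ (fun y => y * y * exp_inv y - exp_inv_int y)
  (fun y => 2 * y * exp_inv y) 0 y y0.
rewrite exp_inv_int0 !mul0r subrr expr2; apply.
- apply: within_itvcy_itvcc => s; apply: cvgB; last exact: exp_inv_int_cont.
  by apply: cvgM; [apply: cvgM; exact: id_cont|exact: exp_inv_cont].
- move=> s /andP[s0 _].
  apply: (is_derive_eq (derB (derM (derM (derI s) (derI s)) (exp_inv_der s0)) (exp_inv_int_der s0))).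
  by rewrite exp_inv_gt0E//; field; rewrite gt_eqF.
- by move=> s /andP[s0 _]; rewrite !mulr_ge0 ?exp_inv_ge0// ltW.
Qed.

(** The next order of the asymptotic expansion at 0 of the integral; the
    difference of the derivatives is 6 s^2 exp (- 1/s). *)
Lemma exp_inv_int_ge y : 0 <= y ->
  (y ^+ 2 - 2 * y ^+ 3) * exp_inv y <= exp_inv_int y.
Proof.
move=> y0; rewrite -subr_ge0.
have := @derive_nondecreasing _ (fun y => exp_inv_int y - (y * y - 2 * (y * y * y)) * exp_inv y)
  (fun y => 6 * y ^+ 2 * exp_inv y) 0 y y0.
rewrite exp_inv_int0 !mul0r !mulr0 subrr mul0r subrr.
have -> : y ^+ 2 - 2 * y ^+ 3 = y * y - 2 * (y * y * y) by ring.
apply.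
- apply: within_itvcy_itvcc => s; apply: cvgB; first exact: exp_inv_int_cont.
  apply: cvgM; last exact: exp_inv_cont.
  apply: cvgB; first by apply: cvgM; exact: id_cont.
  apply: cvgM; first exact: cvg_cst.
  by apply: cvgM; [apply: cvgM; exact: id_cont|exact: id_cont].
- move=> s /andP[s0 _].
  apply: (is_derive_eq (derB (exp_inv_int_der s0) (derM (derB (derM (derI s) (derI s))
    (derZ 2 (derM (derM (derI s) (derI s)) (derI s)))) (exp_inv_der s0)))).
  by rewrite exp_inv_gt0E//; field; rewrite gt_eqF.
- by move=> s _; rewrite mulr_ge0 ?exp_inv_ge0// mulr_ge0 ?sqr_ge0.
Qed.

Lemma tricomi22_le z : 0 < z -> z ^+ 2 * tricomi22 z <= 1.
Proof.
move=> z0; have zi : 0 < z^-1 by rewrite invr_gt0.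
have := exp_inv_int_le (ltW zi); rewrite exp_inv_gt0E// invrK => h.
have /(ler_wpM2l (expR_ge0 z)) := h => {}h.
have : z ^+ 2 * tricomi22 z <= z ^+ 2 * (expR z * ((z^-1) ^+ 2 * expR (- z))).
  by rewrite ler_wpM2l// exprn_ge0// ltW.
rewrite expRN; have e0 := expR_gt0 z.
have -> : z ^+ 2 * (expR z * (z^-1 ^+ 2 * (expR z)^-1)) = 1.
  by field; rewrite !gt_eqF.
by [].
Qed.

Lemma tricomi22_ge z : 0 < z -> 1 - 2 / z <= z ^+ 2 * tricomi22 z.
Proof.
move=> z0; have zi : 0 < z^-1 by rewrite invr_gt0.
have := exp_inv_int_ge (ltW zi); rewrite exp_inv_gt0E// invrK => h.
have /(ler_wpM2l (expR_ge0 z)) := h => {}h.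
have : z ^+ 2 * (expR z * ((z^-1 ^+ 2 - 2 * z^-1 ^+ 3) * expR (- z))) <= z ^+ 2 * tricomi22 z.
  by rewrite ler_wpM2l// exprn_ge0// ltW.
rewrite expRN; have e0 := expR_gt0 z.
have -> : z ^+ 2 * (expR z * ((z^-1 ^+ 2 - 2 * z^-1 ^+ 3) * (expR z)^-1)) = 1 - 2 / z.
  by field; rewrite !gt_eqF.
by [].
Qed.

Lemma exp_inv_int_inv_der z : 0 < z ->
  is_derive z 1 (fun z => exp_inv_int z^-1) (- expR (- z) / z ^+ 2).
Proof.
move=> z0; have z1 : z != 0 by rewrite gt_eqF.
have zi : 0 < z^-1 by rewrite invr_gt0.
apply: (is_derive_eq (der_comp (exp_inv_int_der zi) (derV (f := id) z1 (derI z)))).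
by rewrite exp_inv_gt0E// invrK /=; field.
Qed.

Lemma tricomi22_der z : 0 < z -> is_derive z 1 tricomi22 (tricomi22 z - z ^- 2).
Proof.
move=> z0; apply: (is_derive_eq (derM (der_expR (derI z)) (exp_inv_int_inv_der z0))).
rewrite /tricomi22 expRN; have e0 := expR_gt0 z.
by field; rewrite !gt_eqF.
Qed.

Lemma tricomi22_der2 z : 0 < z ->
  is_derive z 1 (fun z => tricomi22 z - z ^- 2) (tricomi22 z - z ^- 2 + 2 / z ^+ 3).
Proof.
move=> z0; have z1 : z ^+ 2 != 0 by rewrite gt_eqF// exprn_gt0.
have z2 : z * z != 0 by rewrite -expr2.
apply: (is_derive_eq (derB (tricomi22_der z0)
   (derV (f := fun z => z * z) z2 (derM (derI z) (derI z))))).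
by field; rewrite gt_eqF.
Qed.

Lemma derive1_pos w w1 : (forall z, 0 < z -> is_derive z 1 w (w1 z)) ->
  {in `]0, +oo[, w1 =1 w^`()%classic}.
Proof.
by move=> h z; rewrite in_itv/= andbT => z0; have [_ <-] := h z z0; rewrite derive1E.
Qed.

Lemma tricomi22_asymptotic : z ^+ 2 * tricomi22 z @[z --> +oo] --> (1 : R).
Proof.
have lo : 1 - 2 / z @[z --> +oo] --> (1 : R).
  rewrite -[X in _ --> X]subr0; apply: cvgB; first exact: cvg_cst.
  rewrite -[X in _ --> X](mulr0 2); apply: cvgM; first exact: cvg_cst.
  apply/gtr0_cvgV0; last exact: cvg_id.
  by near=> z; near: z; apply: nbhs_pinfty_gt; rewrite num_real.
have hi : (fun=> 1 : R) z @[z --> (+oo : set_system R)] --> (1 : R) by exact: cvg_cst.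
apply: (squeeze_cvgr _ lo hi).
near=> z; have z0 : 0 < z by near: z; apply: nbhs_pinfty_gt; rewrite num_real.
by rewrite tricomi22_ge// tricomi22_le.
Unshelve. all: by end_near. Qed.

Lemma powR2_asymptotic w : z `^ 2 * w z @[z --> +oo] --> (1 : R) <->
  z ^+ 2 * w z @[z --> +oo] --> (1 : R).
Proof.
have e : {near +oo, (fun z => z `^ 2 * w z) =1 (fun z => z ^+ 2 * w z)}.
  by near=> z; rewrite /= -powR_mulrn//; near: z; apply: nbhs_pinfty_ge; rewrite num_real.
split; apply: cvg_trans; apply: near_eq_cvg => //.
by near=> z; rewrite /=; apply/esym; near: z.
Unshelve. all: by end_near. Qed.

Lemma is_tricomi22 : is_tricomi 2 2 tricomi22.
Proof.
split; last exact/powR2_asymptotic/tricomi22_asymptotic.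
have e1 := derive1_pos tricomi22_der.
have d2 z : 0 < z -> is_derive z 1 tricomi22^`()%classic (tricomi22 z - z ^- 2 + 2 / z ^+ 3).
  by move=> z0; apply: (der_ext z0 e1); exact: tricomi22_der2.
move=> z z0; have [dw ew] := tricomi22_der z0; have [dw2 ew2] := d2 z z0.
split => //.
rewrite [_^`(2)%classic]/derive1n /= -/(derive1 _).
rewrite [X in z * X]derive1E ew2 [_^`()%classic z]derive1E ew.
by field; rewrite gt_eqF.
Qed.

(** For alpha = beta = 2 Kummer's equation says that z^2 (w' - w) is constant,
    so e^(-z) w is determined up to an additive constant; the behaviour at
    infinity fixes both constants. *)
Lemma is_tricomi22_unique w z : is_tricomi 2 2 w -> 0 < z -> w z = tricomi22 z.
Proof.
move=> [kw aw] z0.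
have dw s : 0 < s -> is_derive s 1 w (w^`()%classic s).
  by move=> s0; have [h _ _] := kw s s0; rewrite derive1E; exact/derivableP.
have dw2 s : 0 < s -> is_derive s 1 w^`()%classic (w^`(2)%classic s).
  move=> s0; have [_ h _] := kw s s0; rewrite [_^`(2)%classic]/derive1n /= derive1E.
  exact/derivableP.
have cst (f df : R -> R) s t : (forall x : R, 0 < x -> is_derive x 1 f (df x)) ->
    (forall x : R, 0 < x -> df x = 0) -> 0 < s -> 0 < t -> f s = f t.
  move=> hf h0; wlog st : s t / s <= t => [th s0 t0|s0 t0].
    by case: (leP s t) => st; [exact: th|apply/esym; apply: th => //; exact: ltW].
  have cf : {within `[s, t], continuous f}.
    apply: (@derivable_within_continuous _ _ f) => x; rewrite in_itv/= => /andP[sx _].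
    by have [] := hf x (lt_le_trans s0 sx).
  apply/eqP; rewrite eq_le; apply/andP; split.
    apply: (derive_nondecreasing st cf (df := df)) => x /andP[sx _].
      by apply: hf; exact: lt_trans sx.
    by rewrite h0//; exact: lt_trans sx.
  rewrite -lerN2; apply: (@derive_nondecreasing _ (fun x => - f x) (fun x => - df x) _ _ st).
  - by move=> x; apply: cvgN; exact: cf.
  - by move=> x /andP[sx _]; apply: derN; apply: hf; exact: lt_trans sx.
  - by move=> x /andP[sx _]; rewrite h0 ?oppr0//; exact: lt_trans sx.
(* The first integral of Kummer's equation for the parameters 2 and 2. *)
pose q s := s * s * (w^`()%classic s - w s).
have qC s : 0 < s -> q s = q 1.
  move=> s0; apply: (cst q (fun=> 0)) => // x x0.
  apply: (is_derive_eq (derM (derM (derI x) (derI x)) (derB (dw2 x x0) (dw x x0)))).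
  have [_ _ e] := kw x x0.
  transitivity (x * (x * w^`(2)%classic x + (2 - x) * w^`()%classic x - 2 * w x)); first by ring.
  by rewrite e mulr0.
pose v s := expR (- s) * w s + q 1 * exp_inv_int s^-1.
have vC s : 0 < s -> v s = v 1.
  move=> s0; apply: (cst v (fun=> 0)) => // x x0.
  apply: (is_derive_eq (derD (derM (der_expR (derN (derI x))) (dw x x0))
     (derZ (q 1) (exp_inv_int_inv_der x0)))).
  rewrite -(qC x x0) /q; field; rewrite gt_eqF//.
have v0 : v 1 = 0.
  have iv0 : (s^-1 : R) @[s --> +oo] --> (0 : R).
    apply/gtr0_cvgV0; last exact: cvg_id.
    by near=> s; near: s; apply: nbhs_pinfty_gt; rewrite num_real.
  have l1 : exp_inv_int s^-1 @[s --> +oo] --> (0 : R).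
    apply: (squeeze_cvgr _ (cvg_cst 0) iv0); near=> s.
    have s0 : 0 < s by near: s; apply: nbhs_pinfty_gt; rewrite num_real.
    have s1 : 1 <= s by near: s; apply: nbhs_pinfty_ge; rewrite num_real.
    have si : 0 < s^-1 by rewrite invr_gt0.
    rewrite exp_inv_int_ge0 ?(ltW si)//=; apply: (le_trans (exp_inv_int_le (ltW si))).
    rewrite expr2 -mulrA ler_piMr// ?(ltW si)//.
    have i1 : s^-1 <= 1 by rewrite invf_le1.
    by rewrite mulr_ile1 ?exp_inv_ge0 ?(ltW si)//; apply: le_trans i1; apply: exp_inv_le; exact: ltW.
  have l2 : expR (- s) * w s @[s --> +oo] --> (0 : R).
    have h : expR (- s) * s^-1 * s^-1 * (s ^+ 2 * w s) @[s --> +oo] --> (0 * 0 * 0 * 1 : R).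
      apply: cvgM; last exact/powR2_asymptotic.
      by apply: cvgM => //; apply: cvgM => //; exact: cvgr_expR.
    rewrite !mul0r in h; apply: cvg_trans h; apply: near_eq_cvg; near=> s.
    have s0 : 0 < s by near: s; apply: nbhs_pinfty_gt; rewrite num_real.
    by rewrite /=; field; rewrite gt_eqF.
  have l3 : v s @[s --> +oo] --> (0 + q 1 * 0 : R).
    by apply: cvgD => //; apply: cvgM => //; exact: cvg_cst.
  have l4 : v s @[s --> +oo] --> v 1.
    apply: cvg_near_cst; near=> s; apply: vC.
    by near: s; apply: nbhs_pinfty_gt; rewrite num_real.
  by rewrite mulr0 addr0 in l3; exact: (cvg_unique _ l4 l3).
have wE s : 0 < s -> w s = - q 1 * tricomi22 s.
  move=> s0; have := vC s s0; rewrite v0 /v /tricomi22 expRN => /eqP.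
  rewrite addr_eq0 => /eqP h; have e0 := expR_gt0 s.
  by rewrite mulrCA mulNr -h; field; rewrite gt_eqF.
have q1 : - q 1 = 1.
  have l1 : - q 1 * (s ^+ 2 * tricomi22 s) @[s --> +oo] --> - q 1 * 1.
    by apply: cvgM; [exact: cvg_cst|exact: tricomi22_asymptotic].
  have l2 : - q 1 * (s ^+ 2 * tricomi22 s) @[s --> +oo] --> (1 : R).
    move/powR2_asymptotic : aw; apply: cvg_trans; apply: near_eq_cvg; near=> s.
    rewrite /= wE; last by near: s; apply: nbhs_pinfty_gt; rewrite num_real.
    by rewrite mulrCA.
  by rewrite mulr1 in l1; exact: (cvg_unique _ l1 l2).
by rewrite wE// q1 mul1r.
Unshelve. all: by end_near. Qed.

Lemma tricomi_2_2 z : 0 < z -> tricomi 2 2 z = tricomi22 z.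
Proof.
apply: is_tricomi22_unique; have : [set w | is_tricomi 2 2 w] tricomi22 by exact: is_tricomi22.
exact: (@getI _ [set w | is_tricomi 2 2 w]) .
Qed.

End tricomi22.

(** * The limit kernel and its integrals *)

Section limit_kernel.
Context {R : realType}.
Local Notation mu := (@lebesgue_measure R).
Implicit Types (s t u z : R).

(** Near 0 the lower bound y^2 - 2 y^3 is positive. *)
Lemma exp_inv_int_gt0 (y : R) : 0 < y -> 0 < exp_inv_int y.
Proof.
move=> y0; pose x : R := Num.min y 4^-1.
have x0 : 0 < x by rewrite /x lt_min y0 invr_gt0//=.
have xy : x <= y by rewrite /x ge_min lexx.
have x4 : x <= 4^-1 by rewrite /x ge_min lexx orbT.
have hx : 0 < exp_inv_int x.
  apply: lt_le_trans (exp_inv_int_ge (ltW x0)); rewrite exp_inv_gt0E//.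
  rewrite mulr_gt0 ?expR_gt0//.
  have -> : x ^+ 2 - 2 * x ^+ 3 = x ^+ 2 * (1 - 2 * x) by ring.
  by rewrite mulr_gt0 ?exprn_gt0//; lra.
apply: (lt_le_trans hx); apply: (derive_nondecreasing xy (df := exp_inv)).
- apply: (@derivable_within_continuous _ _ exp_inv_int) => s; rewrite in_itv/= => /andP[xs _].
  by have [] := exp_inv_int_der (lt_le_trans x0 xs).
- by move=> s /andP[xs _]; apply: exp_inv_int_der; exact: lt_trans xs.
- by move=> s _; exact: exp_inv_ge0.
Qed.

Lemma tricomi22_gt0 z : 0 < z -> 0 < tricomi22 z.
Proof. by move=> z0; rewrite mulr_gt0 ?expR_gt0// exp_inv_int_gt0// invr_gt0. Qed.

Variable c : R.
Hypothesis c_gt0 : 0 < c.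

(** With c = - a, this is the weight of the present deviation X - m in the
    conditional expectation m + g (X - m) of the limit, when a + b = 0. *)
Definition limit_kernel u : R := c * (1 + u) * tricomi22 (c * (1 + u)).
Definition limit_kernel' u : R :=
  c * (tricomi22 (c * (1 + u)) + c * (1 + u) * tricomi22 (c * (1 + u))
       - (c * (1 + u))^-1).

Let z_gt0 u : -1 < u -> 0 < c * (1 + u).
Proof. by move=> u1; rewrite mulr_gt0//; lra. Qed.

Let z_der u : is_derive u 1 (fun u => c * (1 + u)) c.
Proof. by apply: (is_derive_eq (derZ c (derD (derC 1 u) (derI u)))); ring. Qed.

Let w_der u : -1 < u -> is_derive u 1 (fun u => tricomi22 (c * (1 + u)))
  (c * (tricomi22 (c * (1 + u)) - (c * (1 + u)) ^- 2)).
Proof.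
move=> u1; exact: (@der_comp _ tricomi22 (fun u => c * (1 + u)) u _ _
  (tricomi22_der (z_gt0 u1)) (z_der u)).
Qed.

Lemma limit_kernel_der u : -1 < u ->
  is_derive u 1 limit_kernel (limit_kernel' u).
Proof.
move=> u1; have z0 := z_gt0 u1; apply: (is_derive_eq (derM (z_der u) (w_der u1))).
by move: z0; rewrite pmulr_rgt0// => z0; rewrite /limit_kernel'; field; rewrite !gt_eqF.
Qed.

Lemma limit_kernel_gt0 u : -1 < u -> 0 < limit_kernel u.
Proof. by move=> /z_gt0 z0; rewrite mulr_gt0// tricomi22_gt0. Qed.

Lemma limit_kernel_le u : -1 < u -> limit_kernel u <= (c * (1 + u))^-1.
Proof.
move=> /z_gt0 z0; rewrite -[leRHS]mulr1 -ler_pdivrMl ?invr_gt0// invrK.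
by rewrite /limit_kernel mulrA -expr2 tricomi22_le.
Qed.

Lemma limit_kernel_le_inv u : 0 <= u -> limit_kernel u <= c^-1.
Proof.
move=> u0; apply: (le_trans (limit_kernel_le _)); first lra.
by rewrite lef_pV2 ?posrE ?z_gt0 ?ler_peMr ?(ltW c_gt0)//; lra.
Qed.

(** The Lipschitz constant that controls the Riemann sums of the kernel. *)
Lemma limit_kernel'_bound u : 0 <= u -> `|limit_kernel' u| <= c^-1 + 1.
Proof.
move=> u0; have u1 : -1 < u by lra.
have z0 := z_gt0 u1; have zc : c <= c * (1 + u) by rewrite ler_peMr ?(ltW c_gt0)//; lra.
have g0 := limit_kernel_gt0 u1; have g1 := limit_kernel_le u1.
have w0 := tricomi22_gt0 z0.
have gc := limit_kernel_le_inv u0.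
have hw : c * tricomi22 (c * (1 + u)) <= c^-1.
  by apply: le_trans gc; rewrite /limit_kernel; apply: ler_wpM2r => //; exact: ltW.
have zi : (c * (1 + u))^-1 <= c^-1 by rewrite lef_pV2 ?posrE.
have zi0 : 0 < (c * (1 + u))^-1 by rewrite invr_gt0.
rewrite /limit_kernel' -/(limit_kernel u) -addrA mulrDr.
have h2 : `|c * (limit_kernel u - (c * (1 + u))^-1)| <= 1.
  rewrite normrM (gtr0_norm c_gt0) -ler_pdivlMl// mulr1.
  rewrite ler_norml; apply/andP; split; lra.
apply: (le_trans (ler_normD _ _)); apply: lerD => //.
by rewrite ger0_norm// mulr_ge0 ?ltW.
Qed.

Lemma limit_kernel_cont : {within `[0, +oo[, continuous limit_kernel}.
Proof.
apply: (@derivable_within_continuous _ _ limit_kernel) => s.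
rewrite in_itv/= andbT => s0.
by have [] := @limit_kernel_der s (ltac:(lra)).
Qed.

Let tail1 u : R := c^-1 * ((c * (1 + u))^-1 - tricomi22 (c * (1 + u))).

Let inv_der u : -1 < u -> is_derive u 1 (fun u => (c * (1 + u))^-1) (- c / (c * (1 + u)) ^+ 2).
Proof.
by move=> u1; exact: (derV (f := fun u => c * (1 + u)) (lt0r_neq0 (z_gt0 u1)) (z_der u)).
Qed.

Let tail1_der u : -1 < u -> is_derive u 1 tail1 (- tricomi22 (c * (1 + u))).
Proof.
move=> u1; have z0 := z_gt0 u1.
apply: (is_derive_eq (derZ c^-1 (derB (inv_der u1) (w_der u1)))).
by move: z0; rewrite pmulr_rgt0// => z0; field; rewrite !gt_eqF.
Qed.

Let inv_cvg0 : (c * (1 + u))^-1 @[u --> +oo] --> (0 : R).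
Proof.
apply/gtr0_cvgV0.
  near=> u; apply: z_gt0.
  by near: u; apply: nbhs_pinfty_gt; rewrite num_real.
apply/gt0_cvgMry => //; exact: cvg_addrl.
Unshelve. all: by end_near. Qed.

Lemma limit_kernel_cvg0 : limit_kernel u @[u --> +oo] --> (0 : R).
Proof.
apply: (squeeze_cvgr _ (cvg_cst 0) inv_cvg0); near=> u.
have u1 : -1 < u by near: u; apply: nbhs_pinfty_gt; rewrite num_real.
by rewrite ltW ?limit_kernel_gt0//= limit_kernel_le.
Unshelve. all: by end_near. Qed.

Let tricomi_cvg0 : tricomi22 (c * (1 + u)) @[u --> +oo] --> (0 : R).
Proof.
apply: (squeeze_cvgr _ (cvg_cst 0) limit_kernel_cvg0); near=> u.
have u1 : -1 < u by near: u; apply: nbhs_pinfty_gt; rewrite num_real.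
rewrite ltW ?tricomi22_gt0 ?z_gt0//= /limit_kernel ler_peMl ?ltW ?tricomi22_gt0 ?z_gt0//.
rewrite -ltr_pdivrMl// mulr1 -ltrBlDl.
by near: u; apply: nbhs_pinfty_gt; rewrite num_real.
Unshelve. all: by end_near. Qed.

(** The scalar k is carried along because the values of improper integrals are
    needed multiplied by constants, without a separate integrability proof. *)
Lemma rint_pinfty_derivative (k : R) (f F : R -> R) u : 0 <= k ->
  {within `[u, +oo[, continuous f} -> (forall s, u <= s -> 0 <= f s) ->
  (forall s, u <= s -> is_derive s 1 F (f s)) -> F s @[s --> +oo] --> (0 : R) ->
  \int[mu]_(s in `[u, +oo[) (k * f s) = k * - F u.
Proof.
move=> k0 cf f0 dF F0.
have dkF s : u <= s -> is_derive s 1 (fun s => k * F s) (k * f s).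
  by move=> us; exact: derZ (dF s us).
rewrite (@Rintegral_ge0_continuous_FTC2y _ _ (fun s => k * F s) u 0).
- by rewrite sub0r mulrN.
- by move=> s us; rewrite mulr_ge0// f0.
- by move=> s; apply: cvgM; [exact: cvg_cst|exact: cf].
- by rewrite -[X in _ --> X](mulr0 k); apply: cvgM; [exact: cvg_cst|].
- by move=> s us; have [] := dkF s (ltW us).
- by apply: cvg_at_right_filter; exact: der_continuous (dkF u (lexx u)).
- move=> s; rewrite in_itv/= andbT => us.
  by have [_ <-] := dkF s (ltW us); rewrite derive1E.
Qed.

(** By Kummer's equation in first-order form, w' = w - z^(-2), so that
    1 / z - w is a primitive of - w. *)
Lemma tricomi22_tail k u : 0 <= k -> 0 <= u ->
  \int[mu]_(s in `[u, +oo[) (k * tricomi22 (c * (1 + s))) =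
  k * (c^-1 * ((c * (1 + u))^-1 - tricomi22 (c * (1 + u)))).
Proof.
move=> k0 u0; rewrite -/(tail1 u) -[tail1 u]opprK.
apply: (@rint_pinfty_derivative k (fun s => tricomi22 (c * (1 + s))) (fun s => - tail1 s) u k0).
- apply: (@derivable_within_continuous _ _ (fun s => tricomi22 (c * (1 + s)))) => s.
  rewrite in_itv/= andbT => us; have s1 : -1 < s by lra.
  by have [] := w_der s1.
- by move=> s us; rewrite ltW// tricomi22_gt0// z_gt0//; lra.
- move=> s us; have s1 : -1 < s by lra.
  by apply: (is_derive_eq (derN (tail1_der s1))); rewrite opprK.
- rewrite -[X in _ --> X]oppr0; apply: cvgN; rewrite -[X in _ --> X](mulr0 c^-1).
  apply: cvgM; first exact: cvg_cst.
  by rewrite -[X in _ --> X](subrr 0); apply: cvgB.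
Qed.

Lemma tricomi22_tail_ge0 u : 0 <= u ->
  0 <= c^-1 * ((c * (1 + u))^-1 - tricomi22 (c * (1 + u))).
Proof.
move=> u0; rewrite -[leRHS]mul1r -tricomi22_tail//; apply: Rintegral_ge0 => s /=.
by rewrite in_itv/= andbT => us; rewrite mul1r ltW// tricomi22_gt0// z_gt0//; lra.
Qed.

(** The derivative of - e^(-c v) g(v) is e^(-c v) (c g - g'), in which
    c g - g' = 1 / (1 + v) - g / (1 + v) is c^2 times the tail above. *)
Lemma tricomi22_tail2 k u : 0 <= k -> 0 <= u ->
  \int[mu]_(v in `[u, +oo[) (k * (expR (- c * v) *
     (c ^+ 2 * (c^-1 * ((c * (1 + v))^-1 - tricomi22 (c * (1 + v))))))) =
  k * (expR (- c * u) * limit_kernel u).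
Proof.
move=> k0 u0.
have dE s : is_derive s 1 (fun s => expR (- c * s)) (- c * expR (- c * s)).
  by apply: (is_derive_eq (der_expR (derZ (- c) (derI s)))); ring.
rewrite -[expR _ * limit_kernel u]opprK.
apply: (@rint_pinfty_derivative k (fun s => expR (- c * s) * (c ^+ 2 * tail1 s))
  (fun s => - (expR (- c * s) * limit_kernel s)) u k0).
- apply: (@derivable_within_continuous _ _ (fun s => expR (- c * s) * (c ^+ 2 * tail1 s))) => s.
  rewrite in_itv/= andbT => us; have s1 : -1 < s by lra.
  by have [] := derM (dE s) (derZ (c ^+ 2) (tail1_der s1)).
- move=> s us; rewrite mulr_ge0 ?expR_ge0// mulr_ge0 ?sqr_ge0// tricomi22_tail_ge0//; lra.
- move=> s us; have s1 : -1 < s by lra.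
  have z0 := z_gt0 s1.
  apply: (is_derive_eq (derN (derM (dE s) (limit_kernel_der s1)))).
  rewrite /tail1 /limit_kernel /limit_kernel'.
  by move: z0; rewrite pmulr_rgt0// => z0; field; rewrite !gt_eqF.
- rewrite -[X in _ --> X]oppr0; apply: cvgN; rewrite -[X in _ --> X](mulr0 0).
  apply: cvgM; last exact: limit_kernel_cvg0.
  have h : expR (- (c * s)) @[s --> +oo] --> (0 : R).
    apply: (@cvg_comp _ _ _ (fun s => c * s) (fun s => expR (- s)) _ (pinfty_nbhs R)); last exact: cvgr_expR.
    by apply/gt0_cvgMry => //; exact: cvg_id.
  rewrite (_ : (fun s => expR (- c * s)) = (fun s => expR (- (c * s)))) //.
  by apply/funext => s; rewrite mulNr.
Qed.

Definition kernel_energy t : R := \int[mu]_(s in `[0, t]) (limit_kernel s ^+ 2).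

Let sq_cont : {within `[0, +oo[, continuous (fun s => limit_kernel s ^+ 2)}.
Proof.
have h : {within `[0, +oo[, continuous (fun s => limit_kernel s * limit_kernel s)}.
  by move=> s; apply: cvgM; exact: limit_kernel_cont.
by rewrite (_ : (fun s => limit_kernel s ^+ 2) = (fun s => limit_kernel s * limit_kernel s)).
Qed.

Lemma kernel_energy_der t : 0 < t -> is_derive t 1 kernel_energy (limit_kernel t ^+ 2).
Proof. by move=> t0; apply: (rint_der t0 sq_cont). Qed.

Lemma kernel_energy_cont : {within `[0, +oo[, continuous kernel_energy}.
Proof. exact: (rint_within sq_cont). Qed.

Lemma kernel_energy0 : kernel_energy 0 = 0.
Proof. exact: rint_set1. Qed.

Lemma kernel_energy_homo s t : 0 <= s -> s <= t -> kernel_energy s <= kernel_energy t.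
Proof.
move=> s0 st; apply: (derive_nondecreasing st (df := fun t => limit_kernel t ^+ 2)).
- exact: within_itvcy_itvcc (within_itvcy_itvcy s0 kernel_energy_cont).
- by move=> r /andP[sr _]; apply: kernel_energy_der; lra.
- by move=> r _; exact: sqr_ge0.
Qed.

Lemma kernel_energy_gt0 t : 0 < t -> 0 < kernel_energy t.
Proof.
move=> t0.
have dx x : x \in `]0, t[ -> is_derive x 1 kernel_energy (limit_kernel x ^+ 2).
  by rewrite in_itv/= => /andP[x0 _]; exact: kernel_energy_der.
have [s] := MVT t0 dx (within_itvcy_itvcc kernel_energy_cont).
rewrite in_itv/= => /andP[s0 _]; rewrite kernel_energy0 !subr0 => ->.
by rewrite mulr_gt0// exprn_gt0// limit_kernel_gt0//; lra.
Qed.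

(** g(s)^2 <= 1 / (c (1 + s))^2 is integrable. *)
Lemma kernel_energy_le t : 0 <= t -> kernel_energy t <= c ^- 2.
Proof.
move=> t0.
have := @derive_nondecreasing _ (fun t => - (c ^- 2 * (1 + t)^-1) - kernel_energy t)
  (fun t => (c * (1 + t)) ^- 2 - limit_kernel t ^+ 2) 0 t t0.
rewrite kernel_energy0 addr0 invr1 subr0 mulr1 => h.
have h2 : 0 <= c ^- 2 * (1 + t)^-1 by rewrite mulr_ge0 ?invr_ge0 ?sqr_ge0//; lra.
suff : - c ^- 2 <= - (c ^- 2 * (1 + t)^-1) - kernel_energy t by lra.
apply: h.
- apply: within_itvcy_itvcc => s; apply: cvgB; last exact: kernel_energy_cont.
  apply: (@derivable_within_continuous _ _ (fun s => - (c ^- 2 * (1 + s)^-1))) => r.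
  rewrite in_itv/= andbT => r0; have r1 : 1 + r != 0 by rewrite gt_eqF//; lra.
  by have [] := derN (derZ (c ^- 2) (derV (f := fun r => 1 + r) r1 (derD (derC 1 r) (derI r)))).
- move=> r /andP[r0 _]; have r1 : 0 < 1 + r by lra.
  apply: (is_derive_eq (derB (derN (derZ (c ^- 2) (derV (f := fun r => 1 + r) (lt0r_neq0 r1)
     (derD (derC 1 r) (derI r))))) (kernel_energy_der r0))).
  by field; rewrite !gt_eqF.
- move=> r /andP[r0 _]; have r1 : -1 < r by lra.
  rewrite subr_ge0 -exprVn lerXn2r ?nnegrE ?invr_ge0 ?limit_kernel_le ?(ltW (z_gt0 _)) ?(ltW (limit_kernel_gt0 _))//.
Qed.

Lemma kernel_energy_cvg : kernel_energy t @[t --> +oo] -->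
  \int[mu]_(s in `[0, +oo[) (limit_kernel s ^+ 2).
Proof.
have [l hl] : exists l : R, kernel_energy t @[t --> +oo] --> l.
  pose f t := kernel_energy (Num.max 0 t).
  have nd : nondecreasing f.
    move=> s t st; apply: kernel_energy_homo; first by rewrite le_max lexx.
    by rewrite ge_max !le_max lexx st !orbT.
  have : f t @[t --> +oo] --> sup (range f).
    apply: nondecreasing_cvgr => //.
    exists (c ^- 2) => _ [t _ <-]; apply: kernel_energy_le; by rewrite le_max lexx.
  move=> h; exists (sup (range f)); apply: cvg_trans h; apply: near_eq_cvg; near=> t.
  rewrite /f; congr kernel_energy; apply/max_idPr.
  by near: t; apply: nbhs_pinfty_ge; rewrite num_real.
rewrite (@Rintegral_ge0_continuous_FTC2y _ _ kernel_energy 0 l) ?kernel_energy0 ?subr0//.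
- by move=> x _; exact: sqr_ge0.
- by move=> x x0; have [] := kernel_energy_der x0.
- by have /continuous_within_itvcyP[_] := kernel_energy_cont; rewrite kernel_energy0.
- by move=> x; rewrite in_itv/= andbT => x0; have [_ <-] := kernel_energy_der x0; rewrite derive1E.
Unshelve. all: by end_near. Qed.

Lemma kernel_energy_total_gt0 : 0 < \int[mu]_(s in `[0, +oo[) (limit_kernel s ^+ 2).
Proof.
apply: (lt_le_trans (kernel_energy_gt0 ltr01)).
rewrite -(cvg_lim (@Rhausdorff R) kernel_energy_cvg).
apply: limr_ge; first exact: cvgP kernel_energy_cvg.
near=> t; exact: kernel_energy_homo.
Unshelve. all: by end_near. Qed.

End limit_kernel.

(** * Normal distributions *)

Section normal_laws.
Context {R : realType}.
Local Notation mu := (@lebesgue_measure R).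
Implicit Types (m s w x y : R).

Lemma normal_pdf_formula m s y : 0 < s ->
  normal_pdf m s y = normal_peak s * expR (- (y - m) ^+ 2 / (s ^+ 2 *+ 2)).
Proof. by move=> s0; rewrite normal_pdfE ?gt_eqF. Qed.

Lemma normal_peakE s : 0 < s -> normal_peak s = (s * Num.sqrt (pi *+ 2))^-1.
Proof.
move=> s0; rewrite /normal_peak -mulrnAr; congr _^-1.
rewrite sqrtrM ?sqr_ge0//; congr (_ * _).
by rewrite sqrtr_sqr gtr0_norm.
Qed.

(** On the half-line the centred density is at most exp (- x^2 / (2 s^2)) times the
    density centred at the edge.  The sign e selects the half-line, so that
    both tails are treated at once. *)
Lemma normal_prob_tail (e : R) s x : e ^+ 2 = 1 -> 0 < s -> 0 <= x ->
  (normal_prob 0 s [set y : R | (x <= e * y)%R] <= (expR (- x ^+ 2 / (s ^+ 2 *+ 2)))%:E)%E.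
Proof.
move=> e1 s0 x0; rewrite /normal_prob.
have mD : measurable [set y : R | x <= e * y].
  rewrite (_ : [set _ | _] = ( *%R e) @^-1` `[x, +oo[); last first.
    by apply/seteqP; split => y /=; rewrite in_itv/= andbT.
  by rewrite -[X in measurable X]setTI; apply: measurable_funM.
apply: (@le_trans _ _ (\int[mu]_(y in [set y | (x <= e * y)%R])
   ((expR (- x ^+ 2 / (s ^+ 2 *+ 2)))%:E * (normal_pdf (e * x) s y)%:E))%E).
  apply: ge0_le_integral => //.
  - by move=> y _; rewrite lee_fin normal_pdf_ge0.
  - apply/measurable_EFinP; apply: measurable_funTS; exact: measurable_normal_pdf.
  - apply/measurable_EFinP; apply: measurable_funTS; apply: measurable_funM => //.
    exact: measurable_normal_pdf.
  - move=> y /= xy; rewrite -EFinM lee_fin !normal_pdf_formula// mulrCA.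
    rewrite ler_wpM2l ?normal_peak_ge0// -expRD ler_expR -mulrDl.
    rewrite ler_wpM2r ?invr_ge0 ?mulrn_wge0 ?sqr_ge0//.
    have -> : - x ^+ 2 - (y - e * x) ^+ 2 = - x ^+ 2 - y ^+ 2 + 2 * (e * y) * x - e ^+ 2 * x ^+ 2.
      by ring.
    have : 0 <= (e * y - x) * x by rewrite mulr_ge0// subr_ge0.
    by rewrite e1 subr0; lra.
rewrite ge0_integralZl ?lee_fin ?expR_ge0//.
- rewrite -[leRHS]mule1; apply: lee_wpmul2l; first by rewrite lee_fin expR_ge0.
  exact: (probability_le1 (normal_prob (e * x) s)).
- apply/measurable_EFinP; apply: measurable_funTS; exact: measurable_normal_pdf.
- by move=> y _; rewrite lee_fin normal_pdf_ge0.
Qed.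

(** Keep only the interval of length s next to the edge, on which the density
    is at least its value at distance |x| + s.  The bound has the right
    exponent x^2 / (2 s^2) to leading order. *)
Lemma normal_prob_ge (e : R) s x : e ^+ 2 = 1 -> 0 < s -> 0 <= x ->
  ((s * normal_peak s * expR (- (x / s + 1) ^+ 2 / 2))%:E <=
    normal_prob 0 s [set y : R | (x <= e * y)%R])%E.
Proof.
move=> e1 s0 x0.
have mD : measurable [set y : R | x <= e * y].
  rewrite (_ : [set _ | _] = ( *%R e) @^-1` `[x, +oo[); last first.
    by apply/seteqP; split => y /=; rewrite in_itv/= andbT.
  by rewrite -[X in measurable X]setTI; apply: measurable_funM.
(* The interval next to the edge is [x, x + s] if e = 1 and [- x - s, - x] if e = -1. *)
pose lo : R := e * x + (s * (e - 1)) / 2.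
have ecase : e = 1 \/ e = -1.
  by move/eqP: e1; rewrite -subr_eq0 subr_sqr_1 mulf_eq0 subr_eq0 addr_eq0 => /orP[/eqP|/eqP]; [left|right].
have sub : `[lo, (lo + s)%R] `<=` [set y : R | x <= e * y].
  by move=> y /=; rewrite in_itv/= /lo; case: ecase => ->; lra.
apply: (@le_trans _ _ (\int[mu]_(y in `[lo, (lo + s)%R]) (normal_pdf 0 s y)%:E)%E); last first.
  apply: ge0_subset_integral => //.
    by apply/measurable_EFinP; apply: measurable_funTS; exact: measurable_normal_pdf.
  by move=> y _; rewrite lee_fin normal_pdf_ge0.
apply: (@le_trans _ _ (\int[mu]_(y in `[lo, (lo + s)%R])
    (normal_peak s * expR (- (x / s + 1) ^+ 2 / 2))%:E)%E).
  rewrite integral_cst//= lebesgue_measure_itv/= lte_fin ltrDl s0 -EFinD addrAC subrr add0r.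
  by rewrite -EFinM lee_fin [leRHS]mulrC mulrA.
apply: ge0_le_integral => //.
- by move=> y _; rewrite lee_fin mulr_ge0 ?normal_peak_ge0 ?expR_ge0.
- by apply/measurable_EFinP; apply: measurable_funTS; exact: measurable_normal_pdf.
- move=> y /=; rewrite in_itv/= => hy; rewrite lee_fin normal_pdf_formula// subr0.
  rewrite ler_wpM2l ?normal_peak_ge0// ler_expR.
  have -> : - (x / s + 1) ^+ 2 / 2 = - (x + s) ^+ 2 / (s ^+ 2 *+ 2).
    by rewrite mulr2n; field; rewrite gt_eqF.
  rewrite ler_wpM2r ?invr_ge0 ?mulrn_wge0 ?sqr_ge0// lerN2 -subr_ge0 subr_sqr.
  by rewrite mulr_ge0//; move: hy; rewrite /lo; case: ecase => ->; lra.
Qed.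

Lemma measurable_affine (m w : R) : measurable_fun setT (fun y : R => m + w * y).
Proof. by apply: measurable_funD => //; apply: measurable_funM. Qed.

Lemma lebesgue_measure_affine m w (A : set R) : 0 < w -> measurable A ->
  mu A = (w%:E * mu ((fun y : R => (m + w * y)%R) @^-1` A))%E.
Proof.
move=> w0 mA.
pose phi : measurableTypeR R -> measurableTypeR R := fun y => m + w * y.
have mphi : measurable_fun setT phi by exact: measurable_affine.
suff /(_ mphi) : mu A = mscale (NngNum (ltW w0)) (pushforward mu phi) A by [].
move=> {}mphi; apply: lebesgue_measure_unique => //= _ [[a b]] _ <-.
rewrite /mscale /pushforward /=.
rewrite /pushforward (_ : phi @^-1` `]a, b] = [set` `](a - m) / w, (b - m) / w]]); last first.
  apply/seteqP; split => y /=; rewrite !in_itv/= /phi.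
    by rewrite ltr_pdivrMr// ler_pdivlMr// (mulrC y); lra.
  by rewrite ltr_pdivrMr// ler_pdivlMr// (mulrC y); lra.
rewrite !lebesgue_measure_itv/= !lte_fin ltr_pM2r ?invr_gt0// ltrD2r.
case: ifPn => ab; last by rewrite mule0.
by rewrite -!EFinD -EFinM; congr EFin; field; rewrite gt_eqF.
Qed.

Lemma normal_prob_affine m w s (A : set R) : 0 < w -> 0 < s -> measurable A ->
  normal_prob 0 s ((fun y : R => m + w * y) @^-1` A) = normal_prob m (w * s) A.
Proof.
move=> w0 s0 mA; have ws0 : 0 < w * s by rewrite mulr_gt0.
pose phi : measurableTypeR R -> measurableTypeR R := fun y => m + w * y.
have mphi : measurable_fun setT phi by exact: measurable_affine.
rewrite /normal_prob.
have key : (\int[mu]_(y in A) (normal_pdf m (w * s) y)%:E =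
    \int[mscale (NngNum (ltW w0)) (pushforward mu phi)]_(y in A) (normal_pdf m (w * s) y)%:E)%E.
  by move=> {}mphi; apply: eq_measure_integral => B mB _; exact: lebesgue_measure_affine.
rewrite (key mphi) {key}.
have mpdf : measurable_fun A (fun y => (normal_pdf m (w * s) y)%:E).
  by apply/measurable_EFinP; apply: measurable_funTS; exact: measurable_normal_pdf.
rewrite ge0_integral_mscale//=; last by move=> y _; rewrite lee_fin normal_pdf_ge0.
rewrite ge0_integral_pushforward//=; last by move=> y _; rewrite lee_fin normal_pdf_ge0.
rewrite -ge0_integralZl ?lee_fin ?(ltW w0)//.
- apply: eq_integral => y _; rewrite -EFinM; congr EFin.
  rewrite !normal_pdf_formula// /phi.
  have -> : normal_peak s = w * normal_peak (w * s).
    by rewrite !normal_peakE// -(mulrA w) (invfM w) mulrA divff ?mul1r ?gt_eqF.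
  rewrite -mulrA; congr (_ * (_ * expR _)).
  have h (r : R) : - (r - 0) ^+ 2 / (s ^+ 2 *+ 2) = - (m + w * r - m) ^+ 2 / ((w * s) ^+ 2 *+ 2).
    by field; rewrite (gt_eqF w0) (gt_eqF s0).
  exact: h.
- by rewrite -[X in measurable X]setTI; exact: mphi.
- apply/measurable_EFinP; apply: measurable_funTS; apply: measurableT_comp => //.
  exact: measurable_normal_pdf.
- by move=> y _; rewrite lee_fin normal_pdf_ge0.
Qed.

End normal_laws.

Section normal_integrals.
Context {R : realType}.
Local Notation mu := (@lebesgue_measure R).
Implicit Types (m s w x y : R).

(** The normal law is given by its density through a Radon-Nikodym derivative. *)
Lemma integral_normal_prob m s (f : R -> \bar R) : measurable_fun setT f ->
  (forall y, (0 <= f y)%E) ->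
  (\int[normal_prob m s]_y f y = \int[mu]_y (f y * (normal_pdf m s y)%:E))%E.
Proof.
move=> mf f0.
rewrite -(Radon_Nikodym_SigmaFinite.change_of_variables (normal_prob_dominates m s))//.
have mpdf : measurable_fun setT (fun y => (normal_pdf m s y)%:E).
  by apply/measurable_EFinP; exact: measurable_normal_pdf.
have iRN := Radon_Nikodym_SigmaFinite.f_integrable (normal_prob_dominates m s).
apply: ae_eq_integral => //.
- by apply: emeasurable_funM => //; exact: measurable_int iRN.
- exact: emeasurable_funM.
- apply: ae_eqe_mul2l; apply: integral_ae_eq => //= E _ mE.
  by rewrite -(Radon_Nikodym_SigmaFinite.f_integral (normal_prob_dominates m s)).
Qed.

(** Completing the square: the joint density of X and X + Z is also the density
    of X + Z times the conditional density of X. *)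
Lemma normal_pdf_prod m s1 s2 x z : 0 < s1 -> 0 < s2 ->
  let S := Num.sqrt (s1 ^+ 2 + s2 ^+ 2) in
  normal_pdf m s1 x * normal_pdf x s2 z =
  normal_pdf m S z * normal_pdf (m + (z - m) * (s1 / S) ^+ 2) (s1 * s2 / S) x.
Proof.
move=> s10 s20 S.
have S20 : 0 < s1 ^+ 2 + s2 ^+ 2 by rewrite addr_gt0// exprn_gt0.
have S0 : 0 < S by rewrite sqrtr_gt0.
have SE : S ^+ 2 = s1 ^+ 2 + s2 ^+ 2 by rewrite sqr_sqrtr// ltW.
have t0 : 0 < s1 * s2 / S by rewrite divr_gt0// mulr_gt0.
rewrite !normal_pdf_formula// !normal_peakE//.
set q := Num.sqrt (pi *+ 2); have q0 : 0 < q by rewrite sqrtr_gt0 mulrn_wgt0// pi_gt0.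
rewrite mulrACA [RHS]mulrACA -!expRD; congr (_ * expR _).
  by field; rewrite (gt_eqF s10) (gt_eqF s20) (gt_eqF S0) (gt_eqF q0).
rewrite !exprMn !exprVn SE.
have hS : s1 ^+ 2 + s2 ^+ 2 != 0 by rewrite gt_eqF.
by field; rewrite hS (gt_eqF s10) (gt_eqF s20).
Qed.

Lemma measurable_normal_pdf2 s : 0 < s ->
  measurable_fun setT (fun p : R * R => normal_pdf p.1 s p.2).
Proof.
move=> s0; rewrite (_ : (fun p : R * R => _) =
   (fun p : R * R => normal_peak s * expR (- (p.2 - p.1) ^+ 2 / (s ^+ 2 *+ 2)))); last first.
  by apply/funext => p; rewrite normal_pdf_formula.
apply: measurable_funM => //; apply: measurableT_comp => //.
apply: measurable_funM => //; apply: measurableT_comp => //.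
by apply: measurable_funX; apply: measurable_funB.
Qed.

Lemma normal_convolution m s1 s2 (A : set R) : 0 < s1 -> 0 < s2 ->
  measurable A ->
  ((normal_prob m s1 \x normal_prob 0 s2) [set p | A (p.1 + p.2)%R])%E =
  normal_prob m (Num.sqrt (s1 ^+ 2 + s2 ^+ 2)) A.
Proof.
move=> s10 s20 mA; set S := Num.sqrt _.
have S0 : 0 < S by rewrite sqrtr_gt0 addr_gt0// exprn_gt0.
have mD : measurable [set p : R * R | A (p.1 + p.2)].
  rewrite -[X in measurable X]setTI.
  by apply: (measurable_funD (f := fst) (g := snd)) => //.
rewrite /product_measure1.
have secE x : normal_prob 0 s2 (xsection [set p : R * R | A (p.1 + p.2)] x) = normal_prob x s2 A.
  rewrite -[s2 in RHS]mul1r -normal_prob_affine//; congr normal_prob.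
  by apply/seteqP; split => y; rewrite /xsection/= inE mul1r.
have msec := measurable_fun_xsection (normal_prob 0 s2) mD.
rewrite integral_normal_prob//.
pose F (p : R * R) := ((\1_A p.2)%:E * (normal_pdf m s1 p.1 * normal_pdf p.1 s2 p.2)%:E)%E.
have mF : measurable_fun setT F.
  apply: emeasurable_funM; apply/measurable_EFinP.
    by apply: measurableT_comp.
  apply: measurable_funM; last exact: measurable_normal_pdf2.
  by apply: measurableT_comp => //; exact: measurable_normal_pdf.
have F0 p : (0 <= F p)%E by rewrite mule_ge0// lee_fin ?mulr_ge0 ?normal_pdf_ge0.
transitivity (\int[mu]_x \int[mu]_z F (x, z))%E.
  apply: eq_integral => x _; rewrite /= secE /normal_prob integral_mkcond.
  rewrite muleC -ge0_integralZl ?lee_fin ?normal_pdf_ge0//.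
  - apply: eq_integral => z _; rewrite /F/= patchE indicE.
    by case: (z \in A); rewrite ?mul1e ?mul0e ?mule0// EFinM.
  - apply: (measurable_restrictT _ mA).1; apply/measurable_EFinP; apply: measurable_funTS.
    exact: measurable_normal_pdf.
  - by move=> z _; rewrite erestrict_ge0// => r _; rewrite lee_fin normal_pdf_ge0.
rewrite fubini_tonelli// /normal_prob [RHS]integral_mkcond.
apply: eq_integral => z _; rewrite /F patchE.
under eq_integral do rewrite normal_pdf_prod// -/S EFinM muleA.
rewrite /= ge0_integralZl//.
- rewrite integral_normal_pdf mule1 indicE.
  by case: (z \in A); rewrite ?mul1e ?mul0e.
- by apply/measurable_EFinP; exact: measurable_normal_pdf.
- by move=> x _; rewrite lee_fin normal_pdf_ge0.
- by rewrite mule_ge0// lee_fin ?normal_pdf_ge0.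
Qed.

(** Dominated convergence of densities; for s / 2 <= r <= 2 s the density of
    standard deviation r is at most 4 times that of standard deviation 2 s. *)
Lemma normal_prob_cvg m s (s_ : nat -> R) (A : set R) : 0 < s -> measurable A ->
  s_ n @[n --> \oo] --> s ->
  (normal_prob m (s_ n) A @[n --> \oo] --> normal_prob m s A)%E.
Proof.
move=> s0 mA ss.
have [k _ hk] : \forall n \near \oo, s / 2 <= s_ n <= 2 * s.
  have /cvgrPdist_le/(_ (s / 2)) := ss; rewrite divr_gt0// => /(_ isT).
  by apply: filterS => n; rewrite ler_distlC => /andP[]; lra.
rewrite -(cvg_shiftn k).
have ss' : s_ (n + k)%N @[n --> \oo] --> s by rewrite (cvg_shiftn k).
have hk' n : s / 2 <= s_ (n + k)%N <= 2 * s by apply: hk; rewrite /= leq_addl.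
have sk0 n : 0 < s_ (n + k)%N by have := hk' n; lra.
have dom := @dominated_convergence _ _ _ mu A mA
   (fun n y => (normal_pdf m (s_ (n + k)%N) y)%:E) (fun y => (normal_pdf m s y)%:E)
   (fun y => (4 * normal_pdf m (2 * s) y)%:E).
have [] := dom.
- by move=> n; apply/measurable_EFinP; apply: measurable_funTS; exact: measurable_normal_pdf.
- by apply/measurable_EFinP; apply: measurable_funTS; exact: measurable_normal_pdf.
- apply: aeW => y _; apply: cvg_EFin; first exact: nearW.
  rewrite (_ : fine \o _ = (fun n => (s_ (n + k)%N * Num.sqrt (pi *+ 2))^-1 *
     expR (- (y - m) ^+ 2 / (s_ (n + k)%N * s_ (n + k)%N *+ 2)))); last first.
    by apply/funext => n /=; rewrite normal_pdf_formula// normal_peakE.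
  rewrite normal_pdf_formula// normal_peakE//; apply: cvgM.
    apply: cvgV; first by rewrite mulf_neq0 ?gt_eqF// sqrtr_gt0 mulrn_wgt0// pi_gt0.
    by apply: cvgM => //; exact: cvg_cst.
  apply: continuous_cvg; first exact: continuous_expR.
  apply: cvgM; first exact: cvg_cst.
  apply: cvgV; first by rewrite mulrn_eq0/= sqrf_eq0 gt_eqF.
  by rewrite expr2; apply: cvgMn; apply: cvgM.
- rewrite (_ : (fun y => _) = (fun y => 4%:E * (normal_pdf m (2 * s) y)%:E)%E); last first.
    by apply/funext => y; rewrite EFinM.
  apply: integrableZl => //; apply: (integrableS measurableT) => //.
  exact: integrable_normal_pdf.
- apply: aeW => y n _; rewrite gee0_abs ?lee_fin ?normal_pdf_ge0//.
  have s20 : 0 < 2 * s by lra.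
  rewrite !normal_pdf_formula// !normal_peakE// mulrA.
  have q0 : 0 < Num.sqrt (pi *+ 2) :> R by rewrite sqrtr_gt0 mulrn_wgt0// pi_gt0.
  have := hk' n; set r := s_ _ => /andP[r1 r2]; have r0 : 0 < r by exact: sk0.
  apply: ler_pM; rewrite ?invr_ge0 ?expR_ge0 ?mulr_ge0 ?(ltW r0) ?(ltW q0)//.
    have -> : 4 * (2 * s * Num.sqrt (pi *+ 2))^-1 = (s / 2 * Num.sqrt (pi *+ 2))^-1.
      by field; rewrite (gt_eqF s0) (gt_eqF q0).
    by rewrite lef_pV2 ?posrE ?mulr_gt0 ?divr_gt0// ler_wpM2r// ltW.
  rewrite ler_expR !mulNr lerN2 ler_wpM2l ?sqr_ge0// lef_pV2 ?posrE ?mulrn_wgt0 ?exprn_gt0//.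
  by rewrite ler_pMn2r// lerXn2r ?nnegrE ?(ltW r0) ?(ltW s20).
- by move=> _ _; exact.
Qed.

(** Integration by parts: (- s^2 y phi)' = y^2 phi - s^2 phi for the density
    phi. *)
Lemma normal_second_moment s : 0 < s ->
  (\int[mu]_y (y ^+ 2 * normal_pdf 0 s y)%:E = (s ^+ 2)%:E)%E.
Proof.
move=> s0.
have cpdf : continuous (normal_pdf 0 s) by apply: continuous_normal_pdf; rewrite gt_eqF.
have evenpdf x : normal_pdf 0 s (- x) = normal_pdf 0 s x.
  by rewrite !normal_pdf_formula// !subr0 sqrrN.
have pdf0 x : 0 <= normal_pdf 0 s x by exact: normal_pdf_ge0.
have set0y : [set x : R | 0 <= x] = `[0, +oo[%classic.
  by apply/seteqP; split => x /=; rewrite in_itv/= andbT.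
have csq : continuous (fun y => y ^+ 2 * normal_pdf 0 s y).
  by move=> y; apply: cvgM; [exact: exprn_continuous|exact: cpdf].
pose Phi y := \int[mu]_(x in `[0, y]) normal_pdf 0 s x.
have cpdf0 : {within `[0, +oo[, continuous (normal_pdf 0 s)} by exact: continuous_subspaceT.
have dPhi y : 0 < y -> is_derive y 1 Phi (normal_pdf 0 s y) by move=> y0; exact: rint_der.
have cPhi : {within `[0, +oo[, continuous Phi} by exact: rint_within.
have half : (\int[mu]_(x in `[0%R, +oo[) (normal_pdf 0 s x)%:E = (2^-1)%R%:E)%E.
  have := @integral_normal_pdf R 0 s.
  rewrite ge0_symfun_integralT//; last by move=> x; rewrite /= evenpdf.
  rewrite set0y; set I := (\int[mu]_(x in _) _)%E => h.
  have I0 : (0 <= I)%E by apply: integral_ge0 => x _; rewrite lee_fin.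
  have : I \is a fin_num.
    rewrite ge0_fin_numE// ltNge leye_eq; apply/negP => /eqP Ioo.
    by move: h; rewrite Ioo mulry gtr0_sg// mul1e.
  move=> /fineK Ie; move: h; rewrite -Ie -EFinM => -[h].
  by congr EFin; lra.
have Phil : Phi y @[y --> +oo] --> (2^-1 : R).
  have [l hl] : exists l : R, Phi y @[y --> +oo] --> l.
    pose f y := Phi (Num.max 0 y).
    have Phi_nd (p q : R) : 0 <= p -> p <= q -> Phi p <= Phi q.
      move=> p0 pq; apply: (derive_nondecreasing pq (df := normal_pdf 0 s)) => //.
        exact: within_itvcy_itvcc (within_itvcy_itvcy p0 cPhi).
      by move=> r /andP[pr _]; apply: dPhi; lra.
    have Phi_le p : 0 <= p -> Phi p <= 1.
      move=> p0; rewrite /Phi /Rintegral -lee_fin fineK.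
        rewrite -(integral_normal_pdf 0 s); apply: ge0_subset_integral => //.
          by apply/measurable_EFinP; exact: measurable_normal_pdf.
        by move=> x _; rewrite lee_fin.
      by apply: integrable_fin_num => //; apply: (integrableS measurableT) => //; exact: integrable_normal_pdf.
    have nd : nondecreasing f.
      move=> p q pq; apply: Phi_nd; first by rewrite le_max lexx.
      by rewrite ge_max !le_max lexx pq !orbT.
    have : f t @[t --> +oo] --> sup (range f).
      apply: nondecreasing_cvgr => //.
      by exists 1 => _ [t _ <-]; apply: Phi_le; rewrite le_max lexx.
    move=> h; exists (sup (range f)); apply: cvg_trans h; apply: near_eq_cvg; near=> t.
    rewrite /f; congr Phi; apply/max_idPr.
    by near: t; apply: nbhs_pinfty_ge; rewrite num_real.
  suff -> : 2^-1 = l by [].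
  have := half; rewrite (@ge0_continuous_FTC2y _ _ Phi 0 l)//.
  - by rewrite /Phi rint_set1 -EFinB subr0 => -[].
  - by move=> y y0; have [] := dPhi y y0.
  - by have /continuous_within_itvcyP[_] := cPhi.
  - by move=> y; rewrite in_itv/= andbT => y0; have [_ <-] := dPhi y y0; rewrite derive1E.
have ypdf0 : y * normal_pdf 0 s y @[y --> +oo] --> (0 : R).
  pose K : R := normal_peak s * (2 * s ^+ 2).
  have lim0 : K * y^-1 @[y --> +oo] --> (0 : R).
    rewrite -[X in _ --> X](mulr0 K); apply: cvgM; first exact: cvg_cst.
    apply/gtr0_cvgV0; last exact: cvg_id.
    by near=> y; near: y; apply: nbhs_pinfty_gt; rewrite num_real.
  apply: (squeeze_cvgr _ (cvg_cst 0) lim0); near=> y.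
  have y0 : 0 < y by near: y; apply: nbhs_pinfty_gt; rewrite num_real.
  rewrite mulr_ge0 ?(ltW y0)//= normal_pdf_formula// subr0 /K mulrCA -mulrA.
  rewrite ler_wpM2l ?normal_peak_ge0// mulNr expRN.
  have h0 : 0 < y ^+ 2 / (s ^+ 2 *+ 2) by rewrite divr_gt0 ?mulrn_wgt0 ?exprn_gt0.
  have -> : 2 * s ^+ 2 / y = y / (y ^+ 2 / (s ^+ 2 *+ 2)).
    by field; rewrite (gt_eqF s0) (gt_eqF y0).
  rewrite ler_wpM2l ?(ltW y0)// lef_pV2 ?posrE ?expR_gt0//.
  by apply: le_trans (expR_ge1Dx _); rewrite lerDr.
rewrite ge0_symfun_integralT//; last 2 first.
- by move=> x; rewrite mulr_ge0 ?sqr_ge0.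
- by move=> x; rewrite /= sqrrN evenpdf.
pose F y := s ^+ 2 * (Phi y - y * normal_pdf 0 s y).
have dF y : 0 < y -> is_derive y 1 F (y ^+ 2 * normal_pdf 0 s y).
  move=> y0.
  have dp : is_derive y 1 (normal_pdf 0 s) (- (y / s ^+ 2) * normal_pdf 0 s y).
    have h : is_derive y 1 (fun y => normal_peak s * expR (- (y * y) / (s ^+ 2 *+ 2))) (- (y / s ^+ 2) * normal_pdf 0 s y).
      apply: (is_derive_eq (derZ _ (der_expR (derM (derN (derM (derI y) (derI y))) (derC (s ^+ 2 *+ 2)^-1 y))))).
      rewrite normal_pdf_formula// subr0 expr2; field; rewrite gt_eqF//.
    apply: der_ext y0 _ h => x _; rewrite normal_pdf_formula// subr0//.
  apply: (is_derive_eq (derZ (s ^+ 2) (derB (dPhi y y0) (derM (derI y) dp)))).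
  by field; rewrite gt_eqF.
have F0 : F 0 = 0 by rewrite /F /Phi rint_set1 mul0r subrr mulr0.
rewrite set0y (@ge0_continuous_FTC2y _ _ F 0 (s ^+ 2 * (2^-1 - 0))).
- by rewrite F0 -EFinB subr0 -EFinM; congr EFin; field.
- by move=> x _; rewrite mulr_ge0 ?sqr_ge0.
- exact: continuous_subspaceT.
- by apply: cvgM; [exact: cvg_cst|apply: cvgB].
- by move=> y y0; have [] := dF y y0.
- have cid : {within `[0, +oo[, continuous (fun z : R => z)}.
    by apply: continuous_subspaceT => z; exact: cvg_id.
  have : {within `[0, +oo[, continuous F}.
    move=> y; apply: cvgM; first exact: cvg_cst.
    apply: cvgB; first exact: cPhi.
    apply: cvgM; last exact: cpdf0.
    exact: cid.
  by move=> /continuous_within_itvcyP[_].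
- by move=> y; rewrite in_itv/= andbT => y0; have [_ <-] := dF y y0; rewrite derive1E.
Unshelve. all: by end_near. Qed.

End normal_integrals.

(** * Gaussian random variables *)

Section gaussian_laws.
Context {d : measure_display} {T : measurableType d} {R : realType}.
Variable P : probability T R.
Local Notation mu := (@lebesgue_measure R).
Implicit Types (m s x : R) (Y Z : T -> R).

(** Open half-lines form a pi-system that generates the Borel sets. *)
Lemma prob_eq_rays (P1 P2 : probability (measurableTypeR R) R) :
  (forall x, P1 `]x, +oo[%classic = P2 `]x, +oo[%classic) ->
  forall A, measurable A -> P1 A = P2 A.
Proof.
move=> h A mA.
apply: (@measure_unique _ R (measurableTypeR R) (@RGenOInfty.G R)
   (fun n => `](- n%:R)%R, +oo[%classic)) => //.
- exact: RGenOInfty.measurableE.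
- move=> _ _ [x ->] [y ->]; exists (Num.max x y).
  by apply/seteqP; split => z /=; rewrite !in_itv/= !andbT gt_max => /andP.
- by move=> n; exists (- n%:R).
- apply/seteqP; split => // x _; have [n hn] : exists n : nat, - x < n%:R.
    exists (Num.bound `|x : R|); apply: le_lt_trans (archi_boundP (normr_ge0 _)).
    by rewrite -normrN ler_norm.
  by exists n => //=; rewrite in_itv/= andbT ltrNl.
- by move=> _ [x ->]; exact: h.
- by move=> n; apply: le_lt_trans (probability_le1 _ _) (ltry _).
Qed.

Lemma ae_subset_le (A B : set T) : measurable A -> measurable B ->
  (\forall w \ae P, A w -> B w) -> (P A <= P B)%E.
Proof.
move=> mA mB [N [mN N0 NAB]].
apply: (@le_trans _ _ (P (B `|` N))); last first.
  apply: (le_trans (measureU2 _ mB mN)).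
  by rewrite [X in (_ + X)%E](_ : _ = 0%E) ?adde0.
apply: le_measure; rewrite ?inE//; first exact: measurableU.
move=> w Aw; have [Bw|nBw] := pselect (B w); [by left|right].
by apply: NAB => /(_ Aw).
Qed.

Lemma measurable_preimage Y (A : set R) : measurable_fun setT Y -> measurable A ->
  measurable (Y @^-1` A).
Proof. by move=> mY mA; rewrite -[X in measurable X]setTI; exact: mY. Qed.

(** If the limit lies in an open set, then so do eventually the approximants;
    the events that this holds from time n on increase with n. *)
Lemma gaussian_law_limit_open Y (Y_ : nat -> T -> R) m s (s_ : nat -> R) (O : set R) :
  0 < s -> measurable_fun setT Y -> (forall n, measurable_fun setT (Y_ n)) ->
  (forall n, gaussian_law P (Y_ n) m (s_ n)) -> s_ n @[n --> \oo] --> s ->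
  (\forall w \ae P, Y_ n w @[n --> \oo] --> Y w) -> open O ->
  (P (Y @^-1` O) <= normal_prob m s O)%E.
Proof.
move=> s0 mY mY_ lY ss YY oO; have mO : measurable O by exact: open_measurable.
pose E n := \bigcap_(k in [set k | (n <= k)%N]) (Y_ k @^-1` O).
have mE n : measurable (E n).
  by apply: bigcap_measurable => [|k _]; [exists n => /=|exact: measurable_preimage].
have mUE : measurable (\bigcup_n E n) by exact: bigcupT_measurable.
apply: (@le_trans _ _ (P (\bigcup_n E n))).
  apply: ae_subset_le => //; first exact: measurable_preimage.
  apply: filterS YY => w Yw Ow.
  have [n _ hn] : \forall k \near \oo, O (Y_ k w).
    by apply: Yw; apply: open_nbhs_nbhs; split.
  by exists n => // k /= nk; apply: hn.
have cE : (P (E n) @[n --> \oo] --> P (\bigcup_n E n))%E.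
  apply: nondecreasing_cvg_mu => // n k nk; apply/subsetPset => w En j /= kj.
  by apply: En => /=; exact: leq_trans kj.
have cN := normal_prob_cvg (m := m) s0 mO ss.
rewrite -(cvg_lim _ cE)// -(cvg_lim _ cN)//.
apply: lee_lim; [exact: cvgP cE|exact: cvgP cN|].
near=> n; rewrite -lY//; apply: le_measure; rewrite ?inE//.
  exact: measurable_preimage.
by move=> w; apply => /=.
Unshelve. all: by end_near. Qed.

(** Open sets give one inequality for half-lines; the other follows by taking
    complements, because the normal law charges a short interval little. *)
Lemma gaussian_law_limit Y (Y_ : nat -> T -> R) m s (s_ : nat -> R) :
  0 < s -> measurable_fun setT Y -> (forall n, measurable_fun setT (Y_ n)) ->
  (forall n, gaussian_law P (Y_ n) m (s_ n)) -> s_ n @[n --> \oo] --> s ->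
  (\forall w \ae P, Y_ n w @[n --> \oo] --> Y w) ->
  gaussian_law P Y m s.
Proof.
move=> s0 mY mY_ lY ss YY.
have op := gaussian_law_limit_open s0 mY mY_ lY ss YY.
pose X : {RV P >-> measurableTypeR R} := HB.pack (Y : T -> measurableTypeR R)
  (isMeasurableFun.Build _ _ T (measurableTypeR R) Y mY).
have key x : P (Y @^-1` `]x, +oo[) = normal_prob m s `]x, +oo[%classic.
  apply/eqP; rewrite eq_le; apply/andP; split; first by apply: op; exact: interval_open.
  have N1 : normal_prob m s `]x, +oo[%classic = (1 - normal_prob m s `]-oo, x]%classic)%E.
    by rewrite -probability_setC//; congr (normal_prob m s); rewrite setCitvl.
  have P1 : P (Y @^-1` `]x, +oo[) = (1 - P (Y @^-1` `]-oo, x]))%E.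
    rewrite -probability_setC; last exact: measurable_preimage.
    by rewrite preimage_setC setCitvl.
  rewrite N1 P1; apply: leeB => //.
  apply/lee_addgt0Pr => e e0.
  (* An interval of this length has probability at most e. *)
  pose h := e / normal_peak s.
  have pk0 : 0 < normal_peak s by apply: normal_peak_gt0; rewrite gt_eqF.
  have h0 : 0 < h by rewrite divr_gt0.
  apply: (@le_trans _ _ (P (Y @^-1` `]-oo, (x + h)%R[))).
    apply: le_measure; rewrite ?inE; [exact: measurable_preimage..|].
    by move=> w /=; rewrite !in_itv/= => /le_lt_trans; apply; rewrite ltrDl.
  apply: (le_trans (op _ _)); first exact: interval_open.
  have -> : `]-oo, (x + h)%R[%classic = `]-oo, x] `|` `]x, (x + h)%R[ :> set R.
    by rewrite -itv_bndbnd_setU// bnd_simp// ltrDl.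
  apply: (le_trans (measureU2 _ _ _)) => //; apply: leeD => //.
  apply: (@le_trans _ _ (\int[mu]_(y in `]x, (x + h)%R[) (normal_peak s)%:E)%E).
    apply: ge0_le_integral => //.
    - by move=> y _; rewrite lee_fin normal_pdf_ge0.
    - by apply/measurable_EFinP; apply: measurable_funTS; exact: measurable_normal_pdf.
    - by move=> y _; rewrite lee_fin; apply: normal_pdf_ub; rewrite gt_eqF.
  rewrite integral_cst//= lebesgue_measure_itv/= lte_fin ltrDl h0 -EFinB addrAC subrr add0r.
  by rewrite -EFinM lee_fin /h mulrCA divff ?mulr1// gt_eqF.
move=> A mA; have h := @prob_eq_rays (distribution P X) (normal_prob m s) key A mA.
exact: h.
Qed.

(** Conditioning on E does not change the joint law of X and Z on boxes, hence
    on all Borel sets of the plane, in particular on the set of points whose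
    sum of coordinates is in A. *)
Lemma box_independent_add (X Z : T -> R) (E : set T) (A : set R) :
  measurable_fun setT X -> measurable_fun setT Z -> measurable E ->
  (forall A C : set R, measurable A -> measurable C ->
     P (X @^-1` A `&` Z @^-1` C `&` E) = (P (X @^-1` A) * P (Z @^-1` C) * P E)%E) ->
  (forall A C : set R, measurable A -> measurable C ->
     P (X @^-1` A `&` Z @^-1` C) = (P (X @^-1` A) * P (Z @^-1` C))%E) ->
  measurable A ->
  P ((fun w => X w + Z w) @^-1` A `&` E) =
  (P ((fun w => (X w + Z w)%R) @^-1` A) * P E)%E.
Proof.
move=> mX mZ mE hE hT mA.
pose XR : {RV P >-> R} := HB.pack X (isMeasurableFun.Build _ _ _ _ X mX).
pose ZR : {RV P >-> R} := HB.pack Z (isMeasurableFun.Build _ _ _ _ Z mZ).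
pose XZ : T -> R * R := fun w => (X w, Z w).
have mXZ : measurable_fun setT XZ by exact: measurable_fun_pair.
have [c cE0 cE] : exists2 c : R, 0 <= c & P E = c%:E.
  by exists (fine (P E)); [rewrite fine_ge0|rewrite fineK// fin_num_measure].
pose m1 := distribution P XR.
pose m2 := mscale (NngNum cE0) (distribution P ZR).
pose D := [set p : R * R | A (p.1 + p.2)].
have mD : measurable D.
  rewrite -[X in measurable X]setTI.
  by apply: (measurable_funD (f := fst) (g := snd)) => //.
have e1 : (m1 \x m2)%E D = P (XZ @^-1` D `&` E).
  have := @product_measure_unique _ _ _ _ R m1 m2 (pushforward (mrestr P mE) XZ).
  move=> /(_ mXZ) h; rewrite (h _ D mD)// => C1 C2 mC1 mC2.
  transitivity (P (X @^-1` C1 `&` Z @^-1` C2 `&` E)); first by [].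
  by rewrite hE// cE -muleA [X in (_ * X)%E]muleC.
have e2 : (m1 \x m2)%E D = (P E * P (XZ @^-1` D))%E.
  have := @product_measure_unique _ _ _ _ R m1 m2 (mscale (NngNum cE0) (pushforward P XZ)).
  move=> /(_ mXZ) h; rewrite (h _ D mD)//.
    by rewrite /mscale /= /pushforward cE.
  move=> C1 C2 mC1 mC2.
  transitivity (c%:E * P (X @^-1` C1 `&` Z @^-1` C2))%E; first by [].
  by rewrite hT// muleCA.
by rewrite muleC -e2 e1.
Qed.

(** The product rule on boxes identifies the joint law with a product measure,
    and the sum of coordinates has the convolution as its law. *)
Lemma gaussian_law_add (X Z : T -> R) m s1 s2 :
  measurable_fun setT X -> measurable_fun setT Z -> 0 < s1 -> 0 < s2 ->
  gaussian_law P X m s1 -> gaussian_law P Z 0 s2 ->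
  (forall A C : set R, measurable A -> measurable C ->
     P (X @^-1` A `&` Z @^-1` C) = (P (X @^-1` A) * P (Z @^-1` C))%E) ->
  gaussian_law P (fun w => X w + Z w) m (Num.sqrt (s1 ^+ 2 + s2 ^+ 2)).
Proof.
move=> mX mZ s10 s20 lX lZ hT A mA.
pose XZ : T -> measurableTypeR R * measurableTypeR R := fun w => (X w, Z w).
have mXZ : measurable_fun setT XZ by exact: measurable_fun_pair.
pose D := [set p : R * R | A (p.1 + p.2)].
have mD : measurable D.
  rewrite -[X in measurable X]setTI.
  by apply: (measurable_funD (f := fst) (g := snd)) => //.
rewrite -normal_convolution//.
have := @product_measure_unique _ _ _ _ R (normal_prob m s1) (normal_prob 0 s2) (pushforward P XZ).
move=> /(_ mXZ) h; rewrite (h _ D mD)// => C1 C2 mC1 mC2.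
transitivity (P (X @^-1` C1 `&` Z @^-1` C2)); first by [].
by rewrite (hT C1 C2 mC1 mC2) (lX C1 mC1) (lZ C2 mC2).
Qed.

Section sums.
Variables (Z : nat -> T -> R) (s_ : nat -> R) (m : R).
Hypothesis mZ : forall i, measurable_fun setT (Z i).
Hypothesis indepZ : forall n (A : nat -> set R), (forall i, measurable (A i)) ->
  P (\bigcap_(i < n) (Z i @^-1` A i)) = (\prod_(i < n) P (Z i @^-1` A i))%E.
Hypothesis s_gt0 : forall i, 0 < s_ i.
Hypothesis lZ : forall i, gaussian_law P (Z i) 0 (s_ i).

Let E n (A : nat -> set R) := \bigcap_(i < n) (Z i @^-1` A i).
Let S k w := m + \sum_(i < k.+1) Z i w.

Let mE n A : (forall i, measurable (A i)) -> measurable (E n A).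
Proof.
move=> mA; rewrite /E bigcap_mkord; apply: bigsetI_measurable => i _.
exact: measurable_preimage.
Qed.

Let mS k : measurable_fun setT (S k).
Proof. by apply: measurable_funD => //; apply: measurable_sum. Qed.

Let upd (A : nat -> set R) k C i := if i == k then C else A i.

Let E_upd n A k C : (k < n)%N -> A k = setT -> E n (upd A k C) = Z k @^-1` C `&` E n A.
Proof.
move=> kn Ak; apply/seteqP; split => w.
  move=> h; split; first by have := h k kn; rewrite /upd eqxx.
  move=> i /= ni; have := h i ni; rewrite /upd.
  by case: eqP => [-> _|//]; rewrite Ak.
by move=> [hC hE] i /= ni; rewrite /upd; case: eqP => [->//|_]; exact: hE.
Qed.

Let P_upd n A k C : (forall i, measurable (A i)) -> measurable C ->
  (k < n)%N -> A k = setT ->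
  P (E n (upd A k C)) = (P (Z k @^-1` C) * P (E n A))%E.
Proof.
move=> mA mC kn Ak.
have mA' i : measurable (upd A k C i) by rewrite /upd; case: ifP.
rewrite /E !indepZ// (bigD1 (Ordinal kn))//= [in RHS](bigD1 (Ordinal kn))//=.
rewrite Ak preimage_setT probability_setT mul1e {1}/upd eqxx; congr (_ * _)%E.
apply: eq_bigr => i; rewrite -val_eqE /= /upd => /negbTE -> //.
Qed.

(** The induction carries the law of the partial sum together with its
    independence from events that only involve later variables, which is what
    the next addition needs. *)
Let step k : (forall n A_ A, (forall i, (i <= k)%N -> A_ i = setT) ->
    (forall i, measurable (A_ i)) -> measurable A -> (k < n)%N ->
    P (S k @^-1` A `&` E n A_) = (P (S k @^-1` A) * P (E n A_))%E) /\
  gaussian_law P (S k) m (Num.sqrt (\sum_(i < k.+1) s_ i ^+ 2)).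
Proof.
have ST n : E n (fun=> setT) = setT by apply/seteqP; split.
elim: k => [|k [IH1 IH2]].
  have S0E A : S 0 @^-1` A = Z 0%N @^-1` ((fun y : R => m + 1 * y) @^-1` A).
    by apply/seteqP; split => w; rewrite /S/= big_ord1 mul1r.
  have mA' (A : set R) : measurable A -> measurable ((fun y : R => m + 1 * y) @^-1` A).
    by move=> mA; rewrite -[X in measurable X]setTI; exact: measurable_affine.
  split.
    move=> n A_ A A0 mA_ mA n0; rewrite S0E -E_upd ?P_upd//; try exact: mA'.
      exact: A0.
    exact: A0.
  move=> A mA; rewrite S0E (lZ 0%N (mA' A mA)) (normal_prob_affine _ ltr01 (s_gt0 0%N) mA).
  by rewrite mul1r big_ord1 sqrtr_sqr (gtr0_norm (s_gt0 0%N)).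
have SS w : S k.+1 w = S k w + Z k.+1 w by rewrite /S big_ord_recr/= addrA.
have SE A : S k.+1 @^-1` A = (fun w => S k w + Z k.+1 w) @^-1` A.
  by apply/seteqP; split => w /=; rewrite SS.
have hT A C : measurable A -> measurable C ->
    P (S k @^-1` A `&` Z k.+1 @^-1` C) = (P (S k @^-1` A) * P (Z k.+1 @^-1` C))%E.
  move=> mA mC.
  have := IH1 k.+2 (upd (fun=> setT) k.+1 C) A.
  rewrite P_upd// E_upd// ST setIT probability_setT mule1; apply => //.
    by move=> i ik; rewrite /upd ltn_eqF// ltnS.
  by move=> i; rewrite /upd; case: ifP.
split.
  move=> n A_ A A0 mA_ mA kn; rewrite !SE; apply: box_independent_add => //.
    exact: mE.
  move=> A' C mA' mC; rewrite -setIA -E_upd//; last exact: A0.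
  rewrite IH1//; [rewrite P_upd// ?muleA//; exact: A0| | |].
  - by move=> i ik; rewrite /upd ltn_eqF ?ltnS// A0// (leq_trans ik).
  - by move=> i; rewrite /upd; case: ifP.
  - exact: ltn_trans kn.
move=> A mA; rewrite SE.
have hs : 0 < \sum_(i < k.+1) s_ i ^+ 2.
  rewrite big_ord_recl ltr_wpDr ?exprn_gt0//.
  by apply: sumr_ge0 => i _; exact: sqr_ge0.
have hs' : 0 < Num.sqrt (\sum_(i < k.+1) s_ i ^+ 2) by rewrite sqrtr_gt0.
have h := gaussian_law_add (mS k) (mZ k.+1) hs' (s_gt0 k.+1) IH2 (lZ k.+1) hT.
rewrite (h A mA) sqr_sqrtr; last exact: ltW.
by rewrite [in RHS]big_ord_recr.
Qed.

Lemma gaussian_law_sum k :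
  gaussian_law P (fun w => m + \sum_(i < k.+1) Z i w) m (Num.sqrt (\sum_(i < k.+1) s_ i ^+ 2)).
Proof. by have [] := step k. Qed.

End sums.

Lemma gaussian_law_integral Y m s (f : R -> R) : measurable_fun setT Y ->
  0 < s -> gaussian_law P Y m s -> measurable_fun setT f -> (forall y, 0 <= f y) ->
  (\int[P]_w (f (Y w - m))%:E = \int[mu]_y (f y * normal_pdf 0 s y)%:E)%E.
Proof.
move=> mY s0 lY mf f0.
have mYm : measurable_fun setT (fun w => Y w - m) by exact: measurable_funB.
pose X : {RV P >-> measurableTypeR R} := HB.pack ((fun w => Y w - m) : T -> measurableTypeR R)
  (isMeasurableFun.Build _ _ T (measurableTypeR R) _ mYm).
have mfE : measurable_fun setT (EFin \o f) by exact/measurable_EFinP.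
have fE0 y : (0 <= (EFin \o f) y)%E by rewrite lee_fin.
transitivity (\int[distribution P X]_y (f y)%:E)%E.
  by rewrite (ge0_integral_distribution X mfE fE0).
rewrite (@eq_measure_integral _ _ _ _ (normal_prob 0 s)).
  by rewrite (integral_normal_prob 0 s mfE fE0).
move=> A mA _; rewrite /= /distribution /pushforward /=.
have mA' : measurable ((fun y : R => y - m) @^-1` A).
  by rewrite -[X in measurable X]setTI; apply: measurable_funB.
have -> : (fun w => Y w - m) @^-1` A = Y @^-1` ((fun y : R => y - m) @^-1` A) by [].
rewrite (lY _ mA') -[s in LHS]mul1r -(normal_prob_affine m ltr01 s0 mA').
congr (normal_prob 0 s).
by apply/seteqP; split => y /=; rewrite mul1r addrAC subrr add0r.
Qed.

(** The positive and negative parts of X - m have the same integral, because the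
    centred density is even; the mean and then the variance follow. *)
Lemma gaussian_law_moments (X : {RV P >-> R}) m s : 0 < s -> gaussian_law P X m s ->
  ('E_P[X] = m%:E)%E /\ ('V_P[X] = (s ^+ 2)%:E)%E.
Proof.
move=> s0 lX.
have mX : measurable_fun setT X by [].
have icst (r : R) : (\int[P]__ r%:E = r%:E)%E.
  by have := expectation_cst P r; rewrite unlock.
have sq : (\int[P]_w ((X w - m) ^+ 2)%:E = (s ^+ 2)%:E)%E.
  rewrite (@gaussian_law_integral X m s (fun y => y ^+ 2))//; last by move=> y; exact: sqr_ge0.
  exact: normal_second_moment.
have mXm : measurable_fun setT (fun w => (X w - m)%:E) by apply/measurable_EFinP; exact: measurable_funB.
have abs_fin : (\int[P]_w `|(X w - m)%:E| < +oo)%E.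
  apply: (@le_lt_trans _ _ (\int[P]_w (1%:E + ((X w - m) ^+ 2)%:E))%E).
    apply: ge0_le_integral => //.
    - exact: measurableT_comp.
    - by apply/measurable_EFinP; apply: measurable_funD => //; apply: measurable_funX; exact: measurable_funB.
    - move=> w _; rewrite -EFinD lee_fin -(real_normK (num_real (X w - m))); set r := `|_|.
      have : 0 <= (r - 1) ^+ 2 by exact: sqr_ge0.
      have : 0 <= r by exact: normr_ge0.
      rewrite sqrrB1; lra.
  rewrite ge0_integralD//; last 2 first.
  - by move=> w _; rewrite lee_fin sqr_ge0.
  - by apply/measurable_EFinP; apply: measurable_funX; exact: measurable_funB.
  by rewrite sq icst -EFinD ltry.
have iXm : P.-integrable setT (fun w => (X w - m)%:E) by apply/integrableP.
have zero : (\int[P]_w (X w - m)%:E = 0)%E.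
  rewrite integralE.
  have hp : (\int[P]_w (fun w => (X w - m)%:E)^\+ w = \int[mu]_y (Num.max y 0 * normal_pdf 0 s y)%:E)%E.
    rewrite -(@gaussian_law_integral X m s (fun y => Num.max y 0))//.
    - by apply: eq_integral => w _; rewrite funeposE -EFin_max.
    - by apply: measurable_maxr.
    - by move=> y; rewrite le_max lexx orbT.
  have hn : (\int[P]_w (fun w => (X w - m)%:E)^\- w = \int[mu]_y (Num.max (- y) 0 * normal_pdf 0 s y)%:E)%E.
    rewrite -(@gaussian_law_integral X m s (fun y => Num.max (- y) 0))//.
    - by apply: eq_integral => w _; rewrite funenegE -EFinN -EFin_max.
    - by apply: measurable_maxr => //; exact: measurable_funN.
    - by move=> y; rewrite le_max lexx orbT.
  have sym : (\int[mu]_y (Num.max y 0 * normal_pdf 0 s y)%:E = \int[mu]_y (Num.max (- y) 0 * normal_pdf 0 s y)%:E)%E.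
    have evenpdf x : normal_pdf 0 s (- x) = normal_pdf 0 s x.
      by rewrite !normal_pdf_formula// !subr0 sqrrN.
    have mN : measurable_fun setT (-%R : measurableTypeR R -> measurableTypeR R) by exact: oppr_measurable.
    pose f (y : R) := (Num.max y 0 * normal_pdf 0 s y)%:E.
    have mf : measurable_fun setT f.
      apply/measurable_EFinP; apply: measurable_funM; last exact: measurable_normal_pdf.
      by apply: measurable_maxr.
    have f0 y : (0 <= f y)%E by rewrite lee_fin mulr_ge0 ?normal_pdf_ge0// le_max lexx orbT.
    have key : (\int[mu]_y f y = \int[pushforward mu (-%R : measurableTypeR R -> measurableTypeR R)]_y f y)%E.
      by apply: eq_measure_integral => A mA _; have := lebesgue_measureN mA.
    transitivity (\int[mu]_y f y)%E; first by [].
    have e := @ge0_integral_pushforward _ _ _ _ R _ mN mu setT f measurableT mf (fun y _ => f0 y).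
    by rewrite key e preimage_setT; apply: eq_integral => y _; rewrite /f /= evenpdf.
  rewrite hp sym -hn subee//.
  exact: (integrable_fin_num measurableT (integrable_funeneg measurableT iXm)).
have mean : ('E_P[X] = m%:E)%E.
  rewrite expectation_def.
  have -> : (\int[P]_w (X w)%:E = \int[P]_w ((X w - m)%:E + m%:E))%E.
    by apply: eq_integral => w _; rewrite -EFinD subrK.
  rewrite integralD//; last by apply: finite_measure_integrable_cst.
  by rewrite zero add0e icst.
split => //; rewrite /variance unlock mean /= unlock -sq.
by apply: eq_integral => w _; congr EFin; rewrite !fctE/= expr2.
Qed.

End gaussian_laws.

(** * Borel-Cantelli lemmas *)

Section borel_cantelli_lemmas.
Context {d : measure_display} {T : measurableType d} {R : realType}.
Variable P : probability T R.
Implicit Types (F E : nat -> set T).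

Lemma borel_cantelli1 F (u : nat -> R) (M : R) : (forall k, measurable (F k)) ->
  (forall k, (P (F k) <= (u k)%:E)%E) -> (forall k, 0 <= u k) ->
  (forall n, \sum_(k < n) u k <= M) ->
  \forall w \ae P, \forall k \near \oo, ~ F k w.
Proof.
move=> mF Fu u0 uM.
have : (\sum_(n <oo) P (F n) < +oo)%E.
  apply: (@le_lt_trans _ _ M%:E); last exact: ltry.
  apply: lime_le; first exact: is_cvg_nneseries.
  near=> n; rewrite big_mkord; apply: (@le_trans _ _ (\sum_(k < n) (u k)%:E)%E).
    by apply: lee_sum.
  by rewrite sumEFin lee_fin.
move=> /(lim_sup_set_cvg0 mF) h0.
exists (lim_sup_set F); split => //.
  by apply: bigcap_measurable => // k _; exact: bigcup_measurable.
move=> w /= nw n _; apply: contrapT => h; apply: nw.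
by exists n => // k /= nk Fk; apply: h; exists k.
Unshelve. all: by end_near. Qed.

(** Comparison with the integral of x^(-p). *)
Lemma p_series_bound (p : R) n : 1 < p ->
  \sum_(k < n) (k.+1%:R) `^ (- p) <= 1 + (p - 1)^-1.
Proof.
move=> p1; have p0 : 0 < p - 1 by rewrite subr_gt0.
suff h : forall n, \sum_(k < n.+1) (k.+1%:R) `^ (- p) <=
    1 + (p - 1)^-1 - (p - 1)^-1 * (n.+1%:R) `^ (1 - p) :> R.
  case: n => [|n]; first by rewrite big_ord0 addr_ge0// invr_ge0 ltW.
  apply: (le_trans (h n)); rewrite gerBl mulr_ge0 ?powR_ge0// invr_ge0 ltW//.
elim=> [|{}n IH]; first by rewrite big_ord1 !powR1 mulr1 addrK.
rewrite big_ord_recr /=.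
suff : (n.+2%:R) `^ (- p) <= (p - 1)^-1 * (n.+1%:R) `^ (1 - p) - (p - 1)^-1 * (n.+2%:R) `^ (1 - p) :> R.
  by move: IH; lra.
pose f (x : R) := - ((p - 1)^-1 * x `^ (1 - p)) - n.+2%:R `^ (- p) * x.
have fd (x : R) : 0 < x -> is_derive x 1 f (x `^ (- p) - n.+2%:R `^ (- p)).
  move=> x0; apply: (is_derive_eq (derB (derN (derZ (p - 1)^-1 (der_powR (1 - p) x0 (derI x)))) (derZ _ (derI x)))).
  have -> : 1 - p - 1 = - p by ring.
  by field; rewrite gt_eqF.
have n12 : (n.+1%:R : R) <= n.+2%:R by rewrite ler_nat.
have n1 : (0 : R) < n.+1%:R by rewrite ltr0n.
have := @derive_nondecreasing _ f (fun x => x `^ (- p) - n.+2%:R `^ (- p)) _ _ n12.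
have cf : {within `[n.+1%:R, n.+2%:R], continuous f}.
  apply: (@derivable_within_continuous _ _ f) => x; rewrite in_itv/= => /andP[hx _].
  by have [] := fd x (lt_le_trans n1 hx).
move=> /(_ cf) h.
have : f n.+1%:R <= f n.+2%:R.
  apply: h => x /andP[x1 x2]; first by apply: fd; exact: lt_trans x1.
  have x0 : 0 < x by exact: lt_trans x1.
  rewrite subr_ge0 !powRN lef_pV2 ?posrE ?powR_gt0 ?ltr0n//.
  by apply: ge0_ler_powR; rewrite ?nnegrE ?ler0n ?(ltW x0) ?(ltW x2)//; lra.
rewrite /f -(natr1 n.+1); move: (_ `^ (- p)) => X; lra.
Qed.

(** Complementing the events one at a time, since
    P(A and not E) = P(A) - P(A and E). *)
Lemma independent_complements E :
  (forall k, measurable (E k)) ->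
  (forall N (c : nat -> bool), P (\bigcap_(k < N) (if c k then E k else setT)) =
     (\prod_(k < N) (if c k then P (E k) else 1))%E) ->
  forall N m, P (\bigcap_(k < N) (if (m <= k)%N then ~` E k else setT)) =
     (\prod_(k < N) (if (m <= k)%N then 1 - P (E k) else 1))%E.
Proof.
move=> mE hE N m.
pose ev (b : option bool) k := match b with
  | None => setT | Some true => E k | Some false => ~` E k end.
have mev b k : measurable (ev b k) by case: b => [[]|] //=; exact: measurableC.
have pE k : P (~` E k) = (1 - P (E k))%E by exact: probability_setC.
suff h : forall j (c : nat -> option bool), (forall k, (j <= k)%N -> c k <> Some false) ->
    P (\bigcap_(k < N) ev (c k) k) = (\prod_(k < N) P (ev (c k) k))%E.
  pose c k := if (N <= k)%N then None else if (m <= k)%N then Some false else None.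
  have hc k : (N <= k)%N -> c k <> Some false by rewrite /c => ->.
  have := h N c hc.
  have -> : \bigcap_(k < N) ev (c k) k = \bigcap_(k < N) (if (m <= k)%N then ~` E k else setT).
    by apply: eq_bigcapr => k /= kN; rewrite /c leqNgt kN /=; case: ifP.
  move=> ->; apply: eq_bigr => k _; rewrite /c leqNgt ltn_ord /=.
  by case: ifP => _ /=; rewrite ?pE ?probability_setT.
elim=> [|j IH] c hc.
  have := hE N (fun k => c k == Some true).
  have -> : \bigcap_(k < N) (if c k == Some true then E k else setT) = \bigcap_(k < N) ev (c k) k.
    apply: eq_bigcapr => k _; have := hc k (leq0n k).
    by case: (c k) => [[]|] //=.
  move=> ->; apply: eq_bigr => k _; have := hc k (leq0n k).
  by case: (c k) => [[]|] //= _; rewrite probability_setT.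
have [cj|cj] := boolP (c j == Some false); last first.
  by apply: IH => k; rewrite leq_eqVlt => /orP[/eqP <-|]; [exact/eqP|exact: hc].
have [jN|Nj] := ltnP j N; last first.
  pose c' k := if (N <= k)%N then None else c k.
  have -> : \bigcap_(k < N) ev (c k) k = \bigcap_(k < N) ev (c' k) k.
    by apply: eq_bigcapr => k /= kN; rewrite /c' leqNgt kN.
  rewrite IH => [|k jk]; last by rewrite /c' (leq_trans Nj jk).
  by apply: eq_bigr => k _; rewrite /c' leqNgt ltn_ord.
pose c0 k := if k == j then None else c k.
pose c1 k := if k == j then Some true else c k.
have h0 k : (j <= k)%N -> c0 k <> Some false.
  by rewrite /c0; case: eqVneq => // kj jk; apply: hc; rewrite ltn_neqAle eq_sym kj.
have h1 k : (j <= k)%N -> c1 k <> Some false.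
  by rewrite /c1; case: eqVneq => // kj jk; apply: hc; rewrite ltn_neqAle eq_sym kj.
pose G := \bigcap_(k < N) ev (c0 k) k.
have mG : measurable G by rewrite /G bigcap_mkord; apply: bigsetI_measurable.
have e1 : \bigcap_(k < N) ev (c1 k) k = G `&` E j.
  apply/seteqP; split => w.
    move=> h; split; last by have := h j jN; rewrite /c1 eqxx.
    by move=> k kN; have := h k kN; rewrite /c1 /c0; case: eqP.
  by move=> [hG hj] k kN; have := hG k kN; rewrite /c1 /c0; case: eqP => // ->.
have e2 : \bigcap_(k < N) ev (c k) k = G `\` E j.
  apply/seteqP; split => w.
    move=> h; split; last by have := h j jN; rewrite (eqP cj).
    by move=> k kN; have := h k kN; rewrite /c0; case: eqP.
  move=> [hG hj] k kN; have := hG k kN; rewrite /c0; case: eqP => // -> _.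
  by rewrite (eqP cj).
rewrite e2 measureD//; last by apply: le_lt_trans (probability_le1 _ mG) (ltry _).
have p1 := IH c1 h1; have p0 : P G = _ := IH c0 h0; rewrite e1 in p1.
transitivity (P G - P (G `&` E j))%E; first by [].
rewrite p1 p0.
rewrite (bigD1 (Ordinal jN))//= [X in (_ - X)%E](bigD1 (Ordinal jN))//= [RHS](bigD1 (Ordinal jN))//=.
rewrite /c0 /c1 !eqxx /= (eqP cj) /= probability_setT pE.
have -> : (\prod_(i < N | i != Ordinal jN) P (ev (if (i : nat) == j then None else c i) i) =
    \prod_(i < N | i != Ordinal jN) P (ev (c i) i))%E.
  by apply: eq_bigr => i; rewrite -val_eqE /= => /negbTE ->.
have -> : (\prod_(i < N | i != Ordinal jN) P (ev (if (i : nat) == j then Some true else c i) i) =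
    \prod_(i < N | i != Ordinal jN) P (ev (c i) i))%E.
  by apply: eq_bigr => i; rewrite -val_eqE /= => /negbTE ->.
set Q := (\prod_(i < N | _) _)%E.
have fQ : Q \is a fin_num by apply: prode_fin_num => i _; exact: fin_num_measure.
have fj : P (E j) \is a fin_num by exact: fin_num_measure.
move: (P (E j)) (Q) fj fQ => [x| |] [q| |]// _ _.
transitivity (1 * q - x * q)%:E; first by [].
transitivity ((1 - x) * q)%:E; last by [].
by congr EFin; ring.
Qed.

(** P(no event between n and N) is the product of 1 - P(E k) <= exp (- P(E k)),
    and the harmonic series diverges. *)
Lemma borel_cantelli2 E (C : R) : 0 < C ->
  (forall k, measurable (E k)) ->
  (forall N (c : nat -> bool), P (\bigcap_(k < N) (if c k then E k else setT)) =
     (\prod_(k < N) (if c k then P (E k) else 1))%E) ->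
  (forall k, ((C / k.+1%:R)%:E <= P (E k))%E) ->
  \forall w \ae P, forall n, exists2 k, (n <= k)%N & E k w.
Proof.
move=> C0 mE hE hC.
have key n : P (\bigcap_(k in [set k | (n <= k)%N]) ~` E k) = 0%E.
  apply/eqP; rewrite eq_le measure_ge0 andbT.
  have mB : measurable (\bigcap_(k in [set k | (n <= k)%N]) ~` E k).
    by apply: bigcap_measurable => [|k _]; [exists n => /=|exact: measurableC].
  pose S N := \sum_(k < N) (if (n <= k)%N then C / k.+1%:R else 0).
  have bound N : (P (\bigcap_(k in [set k | (n <= k)%N]) ~` E k) <= (expR (- S N))%:E)%E.
    apply: (@le_trans _ _ (P (\bigcap_(k < N) (if (n <= k)%N then ~` E k else setT)))).
      apply: le_measure; rewrite ?inE//.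
        rewrite bigcap_mkord; apply: bigsetI_measurable => k _.
        by case: ifP => // _; exact: measurableC.
      by move=> w h k _; case: ifP => // nk; exact: h.
    rewrite independent_complements//.
    rewrite /S; elim: N => [|N IH]; first by rewrite !big_ord0 oppr0 expR0.
    rewrite !big_ord_recr /= opprD expRD EFinM; apply: lee_pmul => //.
    - by apply: prode_ge0 => k _; case: ifP => // _; rewrite -probability_setC.
    - by case: ifP => // _; rewrite -probability_setC.
    - case: ifP => [nN|_]; last by rewrite oppr0 expR0.
      have fE : P (E N) \is a fin_num by exact: fin_num_measure.
      have := hC N; rewrite -(fineK fE) lee_fin -EFinB lee_fin => h.
      by apply: le_trans (expR_ge1Dx _); rewrite lerD2l lerN2.
  have Sdiv (M : R) : exists N, M <= S N.
    have dv := @dvg_riemannR R 1.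
    apply: contrapT => hM; have {}hM N : S N <= M.
      by rewrite leNgt; apply/negP => h; apply: hM; exists N; exact: ltW.
    apply: dv; first by rewrite ler01 lexx.
    apply: (@nondecreasing_is_cvgn R).
      by apply: nondecreasing_series => k _ _; rewrite ltW// riemannR_gt0.
    exists (n%:R + M / C) => _ [N _ <-].
    rewrite /series /= big_mkord.
    apply: (@le_trans _ _ (\sum_(k < N) ((if (n <= k)%N then 0 else 1) + C^-1 * (if (n <= k)%N then C / k.+1%:R else 0)))).
      apply: ler_sum => k _; rewrite /riemannR powRr1//; case: ifP => nk.
        by rewrite add0r mulrA mulVf ?mul1r// gt_eqF.
      by rewrite mulr0 addr0 invf_le1// ler1n.
    rewrite big_split/=; apply: lerD; last first.
      by rewrite -mulr_sumr mulrC ler_wpM2r ?invr_ge0 ?(ltW C0)//; exact: hM.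
    elim: N => [|N IH]; first by rewrite big_ord0.
    rewrite big_ord_recr /=; case: ifP => nN; first by rewrite addr0.
    apply: (@le_trans _ _ (\sum_(k < N.+1) 1)).
      rewrite big_ord_recr /= lerD2r; apply: ler_sum => k _; by case: ifP.
    by rewrite sumr_const card_ord -[leLHS]/(N.+1%:R) ler_nat ltnNge nN.
  apply/lee_addgt0Pr => e e0; rewrite add0e.
  have [N hN] := Sdiv (- ln e).
  apply: (le_trans (bound N)); rewrite lee_fin -[leRHS]lnK ?posrE// ler_expR; lra.
apply/ae_foralln => n.
exists (\bigcap_(k in [set k | (n <= k)%N]) ~` E k); split.
- by apply: bigcap_measurable => [|k _]; [exists n => /=|exact: measurableC].
- exact: key.
by move=> w /= h k /= nk Ek; apply: h; exists k.
Qed.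

End borel_cantelli_lemmas.

(** * Oscillation of Brownian paths *)

Section dyadic_chaining.
Context {R : realType}.
Implicit Types (f : R -> R) (u h C s : R).

(** Summing dyadic increments: a point at level m + 1 is at most one increment
    away from level m, and the geometric series of ratio 3/4 has sum 4.
    Continuity passes from the dyadic points to all points. *)
Lemma dyadic_chaining f u h C s : 0 < h ->
  {within `[u, u + h], continuous f} ->
  (forall m j, (j < 2 ^ m)%N ->
     `|f (u + h * j.+1%:R / 2 ^+ m) - f (u + h * j%:R / 2 ^+ m)| <= C * (3 / 4) ^+ m) ->
  u <= s <= u + h -> `|f s - f u| <= 4 * C.
Proof.
move=> h0 cf hf hs.
have hf0 : `|f (u + h) - f u| <= C.
  by have := hf 0%N 0%N isT; rewrite !expr0 !divr1 !mulr1 mulr0 addr0.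
have C0 : 0 <= C by exact: le_trans hf0.
have grid m j : (j <= 2 ^ m)%N -> `|f (u + h * j%:R / 2 ^+ m) - f u| <= 4 * C * (1 - (3 / 4) ^+ m.+1).
  elim: m j => [|m IH] j.
    case: j => [|[|//]] _.
      rewrite mulr0 mul0r addr0 subrr normr0; move: C0; lra.
    rewrite expr0 divr1 mulr1 expr1; lra.
  rewrite expnS => jm; have r0 : 0 <= (3 / 4 : R) ^+ m.+1 by apply: exprn_ge0; lra.
  have even i : u + h * (2 * i)%:R / 2 ^+ m.+1 = u + h * i%:R / 2 ^+ m.
    by rewrite natrM exprS; field; rewrite expf_neq0// pnatr_eq0.
  have hj := odd_double_half j; rewrite -muln2 mulnC in hj.
  have hC : 0 <= C * (3 / 4) ^+ m.+1 by rewrite mulr_ge0.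
  rewrite (exprS (3 / 4 : R) m.+1).
  move: hj; case: (odd j) => hj; rewrite -hj ?add0n ?add1n; last first.
    have ji : (j./2 <= 2 ^ m)%N by rewrite -(leq_pmul2l (isT : (0 < 2)%N)); rewrite add0n in hj; rewrite hj.
    have := IH _ ji; rewrite even; lra.
  have jm' : (2 * j./2 < 2 ^ m.+1)%N by rewrite expnS; apply: leq_trans jm; rewrite -[X in (_ < X)%N]hj.
  have ji : (j./2 <= 2 ^ m)%N.
    by rewrite -(leq_pmul2l (isT : (0 < 2)%N)) -expnS ltnW.
  have := hf m.+1 _ jm'; rewrite even; have := IH _ ji.
  set A := f (u + h * (2 * j./2).+1%:R / _); set B := f (u + h * j./2%:R / _); set D := f u => h1 h2.
  have -> : A - D = (A - B) + (B - D) by ring.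
  by apply: (le_trans (ler_normD _ _)); lra.
apply: contrapT => /negP; rewrite -ltNge => hlt.
have e0 : 0 < `|f s - f u| - 4 * C by rewrite subr_gt0.
have /subspace_continuousP/(_ s) := cf; rewrite /= in_itv/= => /(_ hs)/cvgrPdist_lt/(_ _ e0).
rewrite /within /= => /nbhs_ballP[dlt /= dlt0 hd].
have [m hm] : exists m, h / 2 ^+ m < dlt.
  have lim : h / 2 ^+ n @[n --> \oo] --> (0 : R).
    rewrite -[X in _ --> X](mulr0 h); apply: cvgM; first exact: cvg_cst.
    rewrite (_ : (fun n => _) = (fun n => (2^-1 : R) ^+ n)); last by apply/funext => n; rewrite exprVn.
    by apply: cvg_expr; rewrite ger0_norm ?invr_ge0// invf_lt1 ?ltr1n.
  move/cvgrPdist_lt : lim => /(_ _ dlt0)[m _ /(_ m (leqnn m))] /=.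
  rewrite sub0r normrN => hm; exists m; exact: le_lt_trans (ler_norm _) hm.
have p0 : 0 < (2 : R) ^+ m by rewrite exprn_gt0.
pose x := (s - u) * 2 ^+ m / h.
have x0 : 0 <= x by rewrite /x divr_ge0 ?(ltW h0)// mulr_ge0 ?(ltW p0)//; lra.
pose j := Num.truncn x.
have /andP[j1 j2] := truncn_itv x0; rewrite -/j in j1 j2.
have jm : (j <= 2 ^ m)%N.
  rewrite -(ler_nat R) natrX; apply: (le_trans j1); rewrite /x ler_pdivrMr// mulrC ler_wpM2l ?(ltW p0)//; lra.
pose t := u + h * j%:R / 2 ^+ m.
have ts : t <= s.
  rewrite /t; move: j1; rewrite /x ler_pdivlMr// => j1.
  by rewrite -lerBrDl ler_pdivrMr// mulrC.
have st : s - t < h / 2 ^+ m.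
  move: j2; rewrite /x ltr_pdivrMr// => j2; rewrite ltr_pdivlMr// /t.
  have -> : (s - (u + h * j%:R / 2 ^+ m)) * 2 ^+ m = (s - u) * 2 ^+ m - j%:R * h by field; rewrite gt_eqF.
  by move: j2; rewrite -natr1; lra.
have ut : u <= t by rewrite /t lerDl !mulr_ge0 ?invr_ge0 ?ler0n ?(ltW h0) ?(ltW p0).
have := hd t; rewrite /ball /= ger0_norm ?subr_ge0// => /(_ (lt_trans st hm)).
rewrite in_itv/= => /(_ _)/eqP h'; have {h'} : `|f s - f t| < `|f s - f u| - 4 * C.
  apply/eqP/h'; lra.
have := grid m j jm; rewrite -/t => h1 h2.
have r0 : 0 <= C * (3 / 4 : R) ^+ m.+1 by rewrite mulr_ge0// exprn_ge0//; lra.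
have : `|f s - f u| <= `|f s - f t| + `|f t - f u|.
  by apply: le_trans (ler_normD _ _); rewrite addrA subrK.
lra.
Qed.

End dyadic_chaining.

Section brownian_oscillation.
Context {d : measure_display} {T : measurableType d} {R : realType}.
Variable P : probability T R.
Implicit Types (B : R -> T -> R).

(** Sum of the two one-sided tails. *)
Lemma gaussian_tail (Y : T -> R) (s x : R) : measurable_fun setT Y -> 0 < s -> 0 <= x ->
  gaussian_law P Y 0 s ->
  (P [set w | x < `|Y w|]%R <= (2 * expR (- x ^+ 2 / (s ^+ 2 *+ 2)))%:E)%E.
Proof.
move=> mY s0 x0 lY.
have mray (e : R) : measurable [set y : R | x <= e * y].
  rewrite (_ : [set _ | _] = ( *%R e) @^-1` `[x, +oo[); last first.
    by apply/seteqP; split => y /=; rewrite in_itv/= andbT.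
  by rewrite -[X in measurable X]setTI; apply: measurable_funM.
have mpre (e : R) : measurable (Y @^-1` [set y : R | x <= e * y]).
  exact: measurable_preimage.
have tail (e : R) : e ^+ 2 = 1 ->
    (P (Y @^-1` [set y : R | x <= e * y]%R) <= (expR (- x ^+ 2 / (s ^+ 2 *+ 2)))%:E)%E.
  by move=> e1; rewrite (lY _ (mray e)); exact: normal_prob_tail.
apply: (@le_trans _ _ (P (Y @^-1` [set y : R | x <= 1 * y]%R `|` Y @^-1` [set y : R | x <= (-1) * y]%R))).
  apply: le_measure; rewrite ?inE; last 2 first.
  - exact: measurableU.
  - move=> w /=; rewrite mul1r mulN1r; case: (leP 0 (Y w)) => Y0.
      by rewrite ger0_norm// => /ltW; left.
    by rewrite ltr0_norm// => /ltW; right.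
  rewrite (_ : [set _ | _] = (fun w => `|Y w|) @^-1` `]x, +oo[); last first.
    by apply/seteqP; split => y /=; rewrite in_itv/= andbT.
  by apply: measurable_preimage => //; exact: measurableT_comp.
apply: (le_trans (measureU2 _ (mpre 1) (mpre (-1)))).
rewrite mulrDl !mul1r EFinD; apply: leeD.
  by apply: tail; rewrite expr1n.
by apply: tail; rewrite sqrrN expr1n.
Qed.

(** Thresholds that decrease like (3/4)^m at level m are still many standard
    deviations 2^(-m/2), since 9/16 > 1/2.  The union over the 2^m increments
    of all levels has probability O(k^(-2)).  The cells are arbitrary: long
    ones give the growth of Brownian paths, short ones their local
    oscillation. *)
Lemma brownian_oscillation B (u h : nat -> R) : standard_brownian_motion P B ->
  (forall k, 0 <= u k) -> (forall k, 0 < h k) ->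
  \forall w \ae P, \forall k \near \oo, forall s, u k <= s <= u k + h k ->
    `|B s w - B (u k) w| <= 24 * Num.sqrt (h k) * Num.sqrt (ln k.+2%:R).
Proof.
move=> [mB _ cB _ lB] u0 h0.
pose x k : R := 2 * Num.sqrt (ln k.+2%:R).
pose th k m : R := 3 * x k * Num.sqrt (h k) * (3 / 4) ^+ m.
pose t k m j : R := u k + h k * j%:R / 2 ^+ m.
have lnk k : 0 < ln (k.+2%:R : R) by rewrite ln_gt0// ltr1n.
have x0 k : 0 < x k by rewrite mulr_gt0// sqrtr_gt0.
have th0 k m : 0 <= th k m.
  by rewrite !mulr_ge0 ?(ltW (x0 k)) ?exprn_ge0//; lra.
have p0 m : 0 < (2 : R) ^+ m by rewrite exprn_gt0.
have t0 k m j : 0 <= t k m j.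
  by rewrite addr_ge0// !mulr_ge0 ?invr_ge0 ?(ltW (h0 k)) ?(ltW (p0 m)).
have tS k m j : t k m j.+1 - t k m j = h k / 2 ^+ m.
  by rewrite /t -natr1; field; rewrite gt_eqF.
have dt0 k m : 0 < h k / 2 ^+ m by rewrite divr_gt0.
have lt k m j : t k m j < t k m j.+1 by rewrite -subr_gt0 tS.
have mD k m j : measurable_fun setT (B (t k m j.+1) \- B (t k m j)).
  by apply: measurable_funB; exact: mB.
pose A k m j := [set w | th k m < `|B (t k m j.+1) w - B (t k m j) w|].
have mA k m j : measurable (A k m j).
  rewrite (_ : A k m j = (fun w => `|(B (t k m j.+1) \- B (t k m j)) w|) @^-1` `]th k m, +oo[); last first.
    by apply/seteqP; split => y /=; rewrite in_itv/= andbT.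
  by apply: measurable_preimage => //; exact: measurableT_comp.
pose q k : R := k.+2%:R ^- 2.
have q0 k : 0 < q k by rewrite invr_gt0 exprn_gt0.
have q4 k : q k <= 1 / 4.
  rewrite /q div1r lef_pV2 ?posrE ?exprn_gt0// (_ : 4 = 2%:R ^+ 2 :> R); last by rewrite -natrX.
  by rewrite lerXn2r ?nnegrE// ler_nat.
have pA k m j : (P (A k m j) <= (2 * q k ^+ m.+1)%:E)%E.
  have s0 : 0 < Num.sqrt (h k / 2 ^+ m) by rewrite sqrtr_gt0.
  have := lB _ _ (t0 k m j) (lt k m j); rewrite tS => lD.
  apply: (le_trans (gaussian_tail (mD k m j) s0 (th0 k m) lD)).
  rewrite lee_fin ler_wpM2l//.
  have -> : q k ^+ m.+1 = expR (- (2 * ln k.+2%:R * m.+1%:R)).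
    rewrite /q -exprVn -[k.+2%:R in LHS]lnK ?posrE ?ltr0n// -expRN -exprM -expRM_natl.
    by congr expR; rewrite natrM; ring.
  rewrite ler_expR sqr_sqrtr ?(ltW (dt0 k m))// mulNr lerN2 ler_pdivlMr; last by rewrite mulrn_wgt0.
  have -> : 2 * ln k.+2%:R * m.+1%:R * (h k / 2 ^+ m *+ 2) = ln k.+2%:R * h k * (4 * m.+1%:R / 2 ^+ m) :> R.
    by field; rewrite gt_eqF.
  have -> : th k m ^+ 2 = ln k.+2%:R * h k * (36 * (9 / 8) ^+ m / 2 ^+ m).
    have e1 : ((3 / 4) ^+ m) ^+ 2 = (9 / 8) ^+ m / 2 ^+ m :> R.
      by rewrite -exprM mulnC exprM -exprVn -exprMn; congr (_ ^+ m); field.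
    transitivity (36 * Num.sqrt (ln k.+2%:R) ^+ 2 * Num.sqrt (h k) ^+ 2 * ((3 / 4) ^+ m) ^+ 2).
      by rewrite /th /x; ring.
    by rewrite e1 !sqr_sqrtr ?(ltW (h0 k)) ?(ltW (lnk k))//; ring.
  rewrite ler_wpM2l ?mulr_ge0 ?(ltW (h0 k)) ?(ltW (lnk k))// ler_wpM2r ?invr_ge0 ?(ltW (p0 m))//.
  (* Bernoulli's inequality: the ratio 9/8 of 9/16 to 1/2 beats the linear factor m + 1. *)
  have : 1 + m%:R / 8 <= (9 / 8 : R) ^+ m.
    elim: (m) => [|n IH]; first by rewrite expr0; lra.
    rewrite exprS -natr1; have n0 : (0 : R) <= n%:R by exact: ler0n.
    have : (9 / 8) * (1 + n%:R / 8) <= 9 / 8 * (9 / 8 : R) ^+ n by rewrite ler_wpM2l//; lra.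
    lra.
  have m0 : (0 : R) <= m%:R by exact: ler0n.
  rewrite -(natr1 m); move: (_ ^+ m) => X; lra.
pose F k := \bigcup_m \bigcup_(j < (2 ^ m)%N) A k m j.
have mF k : measurable (F k).
  by apply: bigcupT_measurable => m; apply: bigcup_measurable.
have pF k : (P (F k) <= (4 * q k)%:E)%E.
  apply: (@le_trans _ _ (\sum_(m <oo) P (\bigcup_(j < (2 ^ m)%N) A k m j))%E).
    apply: measure_sigma_subadditive => //; first by move=> m; exact: bigcup_measurable.
  apply: lime_le; first exact: is_cvg_nneseries.
  near=> N; rewrite big_mkord.
  apply: (@le_trans _ _ (\sum_(m < N) (2 * q k * (2 * q k) ^+ m)%:E)%E).
    apply: lee_sum => m _; rewrite bigcup_mkord.
    apply: (le_trans (@Boole_inequality _ _ _ P (A k m) (2 ^ m)%N _)) => //.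
    apply: (@le_trans _ _ (\sum_(j < (2 ^ m)%N) (2 * q k ^+ m.+1)%:E)%E).
      by apply: lee_sum => j _; exact: pA.
    rewrite sumEFin lee_fin sumr_const card_ord -[X in X <= _]mulr_natr natrX.
    by rewrite le_eqVlt; apply/orP; left; apply/eqP; rewrite exprMn exprS; ring.
  rewrite sumEFin lee_fin.
  have h2 : forall n, \sum_(m < n) 2 * q k * (2 * q k) ^+ m <= 4 * q k * (1 - (2 * q k) ^+ n).
    elim=> [|n IH]; first by rewrite big_ord0 expr0; lra.
    rewrite big_ord_recr/= exprS.
    have e0 : 0 <= q k * (2 * q k) ^+ n by rewrite mulr_ge0 ?exprn_ge0 ?mulr_ge0 ?(ltW (q0 k)).
    have : q k * (q k * (2 * q k) ^+ n) <= 1 / 4 * (q k * (2 * q k) ^+ n) by rewrite ler_wpM2r.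
    move: IH; lra.
  apply: (le_trans (h2 N)); rewrite ler_piMr ?mulr_ge0 ?(ltW (q0 k))//.
  by rewrite gerBl exprn_ge0// mulr_ge0// ltW.
have bc := @borel_cantelli1 _ _ _ P F (fun k => 4 * q k) 8 mF pF _ _.
have {}bc : \forall w \ae P, \forall k \near \oo, ~ F k w.
  apply: bc => [k|n]; first by rewrite mulr_ge0// ltW.
  rewrite -mulr_sumr; have := @p_series_bound R 2 n (ltr1n R 2).
  have -> : (1 + (2 - 1)^-1 : R) = 2 by field.
  move=> hp; have : \sum_(k < n) q k <= \sum_(k < n) (k.+1%:R : R) `^ (- 2).
    apply: ler_sum => k _; rewrite /q powRN -powR_mulrn// lef_pV2 ?posrE ?powR_gt0 ?exprn_gt0//.
    by rewrite powR_mulrn// powR_mulrn// lerXn2r ?nnegrE// ler_nat.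
  lra.
apply: filterS2 bc cB => w [K _ hK] cw.
exists K => // k /= Kk s hs.
have cwk : {within `[u k, u k + h k], continuous (B ^~ w)}.
  by apply: continuous_subspaceW cw => z /=; rewrite !in_itv/= andbT => /andP[uz _]; exact: le_trans uz.
have := @dyadic_chaining R (B ^~ w) (u k) (h k) (3 * x k * Num.sqrt (h k)) s (h0 k) cwk _ hs.
have -> : 4 * (3 * x k * Num.sqrt (h k)) = 24 * Num.sqrt (h k) * Num.sqrt (ln k.+2%:R).
  by rewrite /x; ring.
apply => m j jm; rewrite leNgt; apply/negP => hA; apply: (hK k Kk).
by exists m => //; exists j.
Unshelve. all: by end_near. Qed.

End brownian_oscillation.

(** * The Ornstein-Uhlenbeck path on a grid *)

Section ou_cells.
Context {R : realType}.
Implicit Types (f : R -> R) (s t M h : R).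

(** Finitely many exceptional cells only contribute a constant, by compactness. *)
Lemma cells_uniform_bound f (u h g : nat -> R) :
  {within `[0, +oo[, continuous f} ->
  (forall k, 0 <= u k) -> (forall k, 0 < h k) -> (forall k, 0 <= g k) ->
  (\forall k \near \oo, forall s, u k <= s <= u k + h k -> `|f s - f (u k)| <= g k) ->
  exists2 K0, 0 <= K0 &
    forall k s, u k <= s <= u k + h k -> `|f s - f (u k)| <= K0 + g k.
Proof.
move=> cf u0 h0 g0 [K _ hK].
have [K0 K00 hK0] : exists2 K0, 0 <= K0 &
    forall k, (k < K)%N -> forall s, u k <= s <= u k + h k -> `|f s - f (u k)| <= K0.
  elim: (K) => [|n [K0 K00 IH]]; first by exists 0.
  have uh : u n <= u n + h n by rewrite lerDl ltW.
  have cfn : {within `[u n, u n + h n], continuous (fun s => `|f s - f (u n)|)}.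
    have cn : {within `[u n, u n + h n], continuous f}.
      apply: continuous_subspaceW cf => z /=; rewrite !in_itv/= andbT => /andP[uz _].
      exact: le_trans uz.
    by move=> s; apply: cvg_norm; apply: cvgB; [exact: cn|exact: cvg_cst].
  have [c _ hc] := EVT_max uh cfn.
  exists (K0 + `|f c - f (u n)|); first exact: addr_ge0.
  move=> k; rewrite ltnS leq_eqVlt => /orP[/eqP-> s hs|kn s hs].
    by apply: (le_trans (hc s _)); rewrite ?in_itv// lerDr.
  by apply: (le_trans (IH k kn s hs)); rewrite lerDl.
exists K0 => // k s hs; case: (ltnP k K) => kK.
  by apply: (le_trans (hK0 k kK s hs)); rewrite lerDl.
by apply: (le_trans (hK k kK s hs)); rewrite lerDr.
Qed.

Section path.
Variables (a : R) (u beta : R -> R).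
Hypothesis a_lt0 : a < 0.
Hypothesis u_cont : {within `[0, +oo[, continuous u}.
Hypothesis beta_cont : {within `[0, +oo[, continuous beta}.
Hypothesis beta0 : beta 0 = 0.
Hypothesis u_eq : forall t, 0 <= t -> u t = \int[lebesgue_measure]_(s in `[0, t]) (a * u s) + beta t.

(** On one cell u - (beta - beta s) solves the linear equation forced by
    a (beta - beta s), which is small. *)
Lemma ou_cell s t M : 0 <= s -> s <= t ->
  (forall r, s <= r <= t -> `|beta r - beta s| <= M) ->
  `|u t - expR (a * (t - s)) * u s - (beta t - beta s)| <= M * (1 - expR (a * (t - s))).
Proof.
move=> s0 st hM; have na : 0 < - a by rewrite oppr_gt0.
pose y r := u r - (beta r - beta s).
have cst f : {within `[0, +oo[, continuous f} -> {within `[s, t], continuous f}.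
  move=> cf; apply: continuous_subspaceW cf => z /=; rewrite !in_itv/= andbT => /andP[uz _].
  exact: le_trans uz.
have cy : {within `[s, t], continuous y}.
  move=> r; apply: cvgB; first exact: (cst _ u_cont).
  by apply: cvgB; [exact: (cst _ beta_cont)|exact: cvg_cst].
have dy r : s < r < t -> is_derive r 1 y (- (- a) * y r + a * (beta r - beta s)).
  move=> /andP[sr _]; have r0 : 0 < r by exact: le_lt_trans sr.
  have := derD (ou_drift_der u_cont u_eq r0) (derC (beta s) r) => h.
  have yE : y = fun r => (u r - beta r) + beta s by apply/funext => q; rewrite /y; ring.
  rewrite yE; apply: (is_derive_eq h); ring.
have eb r : s < r < t -> `|a * (beta r - beta s)| <= - a * M.
  by move=> /andP[sr rt]; rewrite normrM ltr0_norm// ler_pM2l// hM// !ltW.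
have := linear_ode_bound na st cy dy eb.
rewrite opprK (mulrAC (- a) M) divff ?gt_eqF// mul1r /y subrr subr0.
by rewrite addrAC.
Qed.

Lemma ou_start : u 0 = 0.
Proof. by rewrite u_eq// rint_set1 beta0 addr0. Qed.

Variables (h : R) (V O : nat -> R).
Hypothesis h_gt0 : 0 < h.
Hypothesis V0 : V 0%N = 0.
Hypothesis VS : forall k, V k.+1 = expR (a * h) * V k + (beta (k.+1%:R * h) - beta (k%:R * h)).
Hypothesis O_le : forall k, O k <= O k.+1.
Hypothesis osc : forall k s, k%:R * h <= s <= k%:R * h + h -> `|beta s - beta (k%:R * h)| <= O k.

Lemma osc_ge0 k : 0 <= O k.
Proof.
by apply: le_trans (@osc k (k%:R * h) _); rewrite // lexx lerDl ltW.
Qed.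

(** The errors made on the successive cells are averaged with the weights
    (1 - rho) rho^j, so they do not accumulate: a nondecreasing bound on the
    oscillation is also a bound on the error. *)
Lemma ou_grid k : `|u (k%:R * h) - V k| <= O k.
Proof.
have e1 : expR (a * h) <= 1 by rewrite -expR0 ler_expR nmulr_rle0// ltW.
elim: k => [|k IH]; first by rewrite mul0r ou_start V0 subrr normr0 osc_ge0.
have kh : k.+1%:R * h = k%:R * h + h by rewrite -(natr1 k); ring.
have := @ou_cell (k%:R * h) (k.+1%:R * h) (O k) _ _ _; rewrite kh.
rewrite mulr_ge0 ?(ltW h_gt0)// lerDl ltW// => /(_ isT isT (@osc k)).
rewrite (_ : k%:R * h + h - k%:R * h = h); last by ring.
move=> hc.
have -> : u (k%:R * h + h) - V k.+1 = (u (k%:R * h + h) - expR (a * h) * u (k%:R * h) - (beta (k%:R * h + h) - beta (k%:R * h))) + expR (a * h) * (u (k%:R * h) - V k).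
  by rewrite VS kh; ring.
apply: (le_trans (ler_normD _ _)); rewrite normrM (ger0_norm (expR_ge0 _)).
have : expR (a * h) * `|u (k%:R * h) - V k| <= expR (a * h) * O k by rewrite ler_wpM2l ?expR_ge0.
move: hc (O_le k); lra.
Qed.

Lemma ou_between_grid k t : k%:R * h <= t <= k%:R * h + h -> `|u t| <= `|V k| + 3 * O k.
Proof.
move=> /andP[kt tk]; have kh0 : 0 <= k%:R * h by rewrite mulr_ge0 ?(ltW h_gt0).
have hosc r : k%:R * h <= r <= t -> `|beta r - beta (k%:R * h)| <= O k.
  by move=> /andP[kr rt]; apply: osc; rewrite kr (le_trans rt).
have := ou_cell kh0 kt hosc; set q := expR _; set s := k%:R * h => hc.
have q0 : 0 <= q by exact: expR_ge0.
have q1 : q <= 1 by rewrite -expR0 ler_expR nmulr_rle0// subr_ge0.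
have hq : O k * (1 - q) <= O k.
  by rewrite -[leRHS]mulr1 ler_wpM2l ?osc_ge0// gerBl.
have h1 := @hosc t; have {h1}h1 := h1 ltac:(by rewrite kt lexx).
have h2 := ou_grid k; rewrite -/s in h1 h2.
have h3 : `|q * u s| <= `|u s| by rewrite normrM (ger0_norm q0) ler_piMl.
have h4 : `|u s| <= `|u s - V k| + `|V k| by rewrite -{1}(subrK (V k) (u s)) ler_normD.
have h5 : `|u t| <= `|u t - q * u s - (beta t - beta s)| + (`|beta t - beta s| + `|q * u s|).
  rewrite -{1}(subrK (q * u s) (u t)) -{1}(subrK (beta t - beta s) (u t - q * u s)).
  by rewrite -addrA; apply: (le_trans (ler_normD _ _)); rewrite lerD2l ler_normD.
lra.
Qed.

End path.

Lemma ln_le_sqrt (x : R) : 0 < x -> ln x <= 2 * Num.sqrt x.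
Proof.
move=> x0; have s0 : 0 < Num.sqrt x by rewrite sqrtr_gt0.
rewrite -{1}(sqr_sqrtr (ltW x0)) lnXn// mulr2n.
have := ln_sublinear s0; lra.
Qed.

(** log (2 + t) grows less than sqrt (1 + t), and 1/2 + 1/4 = 3/4. *)
Lemma cells_growth f (c K0 : R) : 0 <= c -> 0 <= K0 -> f 0 = 0 ->
  (forall (k : nat) s, 0 <= s <= k.+1%:R ->
     `|f s - f 0| <= K0 + c * (Num.sqrt k.+1%:R * Num.sqrt (ln k.+2%:R))) ->
  forall t, 0 <= t -> `|f t| <= (K0 + 2 * c) * (1 + t) `^ (3 / 4).
Proof.
move=> c0 K00 f0 hf t t0; have /andP[kt tk] := truncn_itv t0.
set k := Num.truncn t in kt tk.
have := hf k t; rewrite t0 (ltW tk) f0 subr0 => /(_ isT) h.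
have t1 : 1 <= 1 + t by rewrite lerDl.
have r1 : 1 <= (1 + t) `^ (3 / 4).
  by rewrite -[X in X <= _](powRr0 (1 + t)) ler_powR//; lra.
have q : Num.sqrt k.+1%:R * Num.sqrt (ln k.+2%:R) <= 2 * (1 + t) `^ (3 / 4).
  rewrite -sqrtrM// -[leRHS]ger0_norm ?mulr_ge0 ?powR_ge0// -sqrtr_sqr ler_sqrt; last exact: exprn_ge0 (mulr_ge0 _ (powR_ge0 _ _)).
  rewrite exprMn -(powR_mulrn 2 (powR_ge0 (1 + t) (3 / 4))) -powRrM.
  have -> : 3 / 4 * 2%:R = 1 + 2^-1 :> R by field.
  rewrite powRD; last by rewrite implybE gt_eqF ?orbT// (lt_le_trans ltr01).
  rewrite powRr1 ?(le_trans ler01)// powR12_sqrt ?(le_trans ler01)//.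
  have k1 : k.+1%:R <= 1 + t by rewrite -natr1 addrC lerD2l.
  have k2 : ln k.+2%:R <= 4 * Num.sqrt (1 + t).
    apply: (le_trans (ln_le_sqrt _)) => //.
    have : Num.sqrt k.+2%:R <= Num.sqrt (4 * (1 + t)).
      have k2 : k.+2%:R <= 4 * (1 + t) by rewrite -natr1; move: k1 t1; lra.
      by rewrite ler_sqrt//; exact: le_trans k2.
    have four : (0 : R) <= 4 by exact: ler0n.
    rewrite (sqrtrM _ four) (_ : 4 = 2 ^+ 2 :> R); last by rewrite -natrX.
    by rewrite sqrtr_sqr ger0_norm//; lra.
  rewrite (_ : 2 ^+ 2 = 4 :> R); last by rewrite -natrX.
  rewrite mulrCA; apply: ler_pM => //; rewrite ln_ge0// ler1n//.
apply: (le_trans h).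
have : c * (Num.sqrt k.+1%:R * Num.sqrt (ln k.+2%:R)) <= c * (2 * (1 + t) `^ (3 / 4)) by rewrite ler_wpM2l.
have : K0 * 1 <= K0 * (1 + t) `^ (3 / 4) by rewrite ler_wpM2l.
lra.
Qed.

End ou_cells.

(** * Gaussian autoregressions *)

Section brownian_increments.
Context {d : measure_display} {T : measurableType d} {R : realType}.
Variable P : probability T R.
Variable B : R -> T -> R.
Hypothesis B_brownian : standard_brownian_motion P B.
Variable h : R.
Hypothesis h_gt0 : 0 < h.
Implicit Types (g : nat -> R) (A : nat -> set R) (m x e : R).

Definition increment (i : nat) (w : T) : R := B (i.+1%:R * h) w - B (i%:R * h) w.

Lemma measurable_increment i : measurable_fun setT (increment i).
Proof.
have [mB _ _ _ _] := B_brownian.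
by apply: measurable_funB; apply: mB; rewrite mulr_ge0// ltW.
Qed.

Lemma increment_indep n A : (forall i, measurable (A i)) ->
  P (\bigcap_(i < n) (increment i @^-1` A i)) =
  (\prod_(i < n) P (increment i @^-1` A i))%E.
Proof.
have [_ _ _ iB _] := B_brownian => mA.
apply: (iB n (fun i => i%:R * h) A) => //; first by rewrite mul0r.
by apply/nondecreasing_seqP => i; rewrite ler_wpM2r ?ler_nat// ltW.
Qed.

Lemma increment_law i : gaussian_law P (increment i) 0 (Num.sqrt h).
Proof.
have [_ _ _ _ lB] := B_brownian.
have -> : h = i.+1%:R * h - i%:R * h by rewrite -natr1; ring.
by apply: lB; rewrite ?mulr_ge0 ?(ltW h_gt0)// ltr_pM2r// ltr_nat.
Qed.

(** Used both for autoregressions and for Riemann sums of a deterministic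
    kernel against Brownian motion. *)
Lemma weighted_increments_law g m k : (forall i, 0 < g i) ->
  gaussian_law P (fun w => m + \sum_(i < k.+1) g i * increment i w) m
    (Num.sqrt (\sum_(i < k.+1) (g i * Num.sqrt h) ^+ 2)).
Proof.
move=> g0; have sh : 0 < Num.sqrt h by rewrite sqrtr_gt0.
pose aff i (A : set R) := (fun y : R => 0 + g i * y) @^-1` A.
have maff i (C : set R) : measurable C -> measurable (aff i C).
  by move=> mA; rewrite -[X in measurable X]setTI; exact: measurable_affine.
have preE i (C : set R) : (fun w => g i * increment i w) @^-1` C = increment i @^-1` aff i C.
  by apply/seteqP; split => w; rewrite /aff/= add0r.
have mZ i : measurable_fun setT (fun w => g i * increment i w).
  by apply: measurable_funM => //; exact: measurable_increment.
have iZ n A : (forall i, measurable (A i)) ->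
    P (\bigcap_(i < n) ((fun w => g i * increment i w) @^-1` A i)) =
    (\prod_(i < n) P ((fun w => g i * increment i w)%R @^-1` A i))%E.
  move=> mA; have := @increment_indep n (fun i => aff i (A i)) (fun i => maff i (A i) (mA i)).
  by under eq_bigr do rewrite -preE; move=> <-; congr (P _); apply: eq_bigcapr => i _; rewrite preE.
apply: (gaussian_law_sum m mZ iZ (s_ := fun i => g i * Num.sqrt h)) => i.
  by rewrite mulr_gt0.
move=> C mC; rewrite preE (increment_law i (maff i C mC)).
by rewrite (normal_prob_affine 0 (g0 i) sh mC).
Qed.

Variables (rho sigma : R).
Hypothesis rho_gt0 : 0 < rho.
Hypothesis rho_lt1 : rho < 1.
Hypothesis sigma_gt0 : 0 < sigma.

Definition autoregression (w : T) (k : nat) : R :=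
  \sum_(j < k) (rho ^+ (k - j.+1) * sigma) * increment j w.

Lemma autoregression0 w : autoregression w 0 = 0.
Proof. by rewrite /autoregression big_ord0. Qed.

(** The autoregression restarted at time k; its innovation over a block only
    involves the increments of that block. *)
Lemma autoregressionD w k n : autoregression w (k + n) =
  rho ^+ n * autoregression w k +
  \sum_(j < n) (rho ^+ (n - j.+1) * sigma) * increment (k + j) w.
Proof.
rewrite /autoregression big_split_ord /= mulr_sumr; congr (_ + _).
  apply: eq_bigr => j _; rewrite !mulrA -exprD; congr (_ ^+ _ * _ * _).
  by rewrite addnC -addnBA.
by apply: eq_bigr => j _; rewrite -addnS subnDl.
Qed.

Lemma autoregressionS w k :
  autoregression w k.+1 = rho * autoregression w k + sigma * increment k w.
Proof.
by rewrite -addn1 autoregressionD big_ord1 expr1 subnn expr0 mul1r addn0.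
Qed.

Lemma measurable_autoregression k : measurable_fun setT (autoregression ^~ k).
Proof.
apply: measurable_sum => j; apply: measurable_funM => //.
exact: measurable_increment.
Qed.

(** The limit of the standard deviations of the autoregression; it dominates
    all of them. *)
Definition stationary_sd : R := Num.sqrt (sigma ^+ 2 * h / (1 - rho ^+ 2)).

Lemma geometric_sum_sq n :
  \sum_(j < n) rho ^+ (n - j.+1) ^+ 2 = (1 - (rho ^+ n) ^+ 2) / (1 - rho ^+ 2).
Proof.
have r2 : 1 - rho ^+ 2 != 0.
  by rewrite subr_eq0 eq_sym -(expr1n _ 2) eqrXn2 ?lt_eqF// ltW.
elim: n => [|n IH]; first by rewrite big_ord0 expr0 expr1n subrr mul0r.
rewrite big_ord_recl /= subSS subn0 (eq_bigr (fun j : 'I_n => rho ^+ (n - j.+1) ^+ 2))//.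
rewrite IH (exprS rho n) exprMn; set X := rho ^+ n.
by field.
Qed.

Lemma stationary_sd_gt0 : 0 < stationary_sd.
Proof.
have r2 : 0 < 1 - rho ^+ 2 by rewrite subr_gt0 expr_lt1// ltW.
by rewrite sqrtr_gt0 !mulr_gt0 ?exprn_gt0// invr_gt0.
Qed.

Lemma autoregression_tail k x : 0 <= x ->
  (P [set w | (stationary_sd * x < `|autoregression w k.+1|)%R] <= (2 * expR (- x ^+ 2 / 2))%:E)%E.
Proof.
move=> x0; have r2 : 0 < 1 - rho ^+ 2 by rewrite subr_gt0 expr_lt1// ltW.
have S0 := stationary_sd_gt0.
pose s : R := Num.sqrt (\sum_(i < k.+1) (rho ^+ (k.+1 - i.+1) * sigma * Num.sqrt h) ^+ 2).
have sE : s ^+ 2 = sigma ^+ 2 * h / (1 - rho ^+ 2) * (1 - (rho ^+ k.+1) ^+ 2).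
  rewrite sqr_sqrtr; last by apply: sumr_ge0 => i _; exact: sqr_ge0.
  rewrite (eq_bigr (fun i : 'I_k.+1 => (sigma ^+ 2 * h) * (rho ^+ (k.+1 - i.+1) ^+ 2))).
    by rewrite -mulr_sumr geometric_sum_sq; ring.
  by move=> i _; rewrite !exprMn sqr_sqrtr ?(ltW h_gt0)//; ring.
have rk : (rho ^+ k.+1) ^+ 2 < 1 by rewrite expr_lt1 ?exprn_ge0 ?expr_lt1 ?ltW.
have s0 : 0 < s.
  rewrite sqrtr_gt0 big_ord_recr/= ltr_wpDl//.
    by apply: sumr_ge0 => i _; exact: sqr_ge0.
  by rewrite exprn_gt0// !mulr_gt0 ?exprn_gt0 ?sqrtr_gt0.
have law : gaussian_law P (autoregression ^~ k.+1) 0 s.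
  have := @weighted_increments_law (fun i => rho ^+ (k.+1 - i.+1) * sigma) 0 k.
  rewrite (_ : (fun w => 0 + _) = autoregression ^~ k.+1); last by apply/funext => w; rewrite add0r.
  by apply => i; rewrite mulr_gt0// exprn_gt0.
apply: (le_trans (gaussian_tail (measurable_autoregression k.+1) s0 (mulr_ge0 (ltW S0) x0) law)).
rewrite lee_fin ler_wpM2l// ler_expR !mulNr lerN2 sE exprMn /stationary_sd sqr_sqrtr; last first.
  exact: divr_ge0 (mulr_ge0 (sqr_ge0 _) (ltW h_gt0)) (ltW r2).
set D := sigma ^+ 2 * h / _; have D0 : 0 < D by rewrite !mulr_gt0 ?exprn_gt0 ?invr_gt0.
rewrite ler_pdivlMr; last by rewrite mulrn_wgt0// mulr_gt0// subr_gt0.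
have -> : x ^+ 2 / 2 * (D * (1 - (rho ^+ k.+1) ^+ 2) *+ 2) = D * x ^+ 2 * (1 - (rho ^+ k.+1) ^+ 2).
  by field.
by apply: ler_piMr; rewrite ?gerBl ?sqr_ge0//; exact: mulr_ge0 (ltW D0) (sqr_ge0 x).
Qed.

(** At the level (1 + e) sqrt (2 log k) the Gaussian tail is k^(-(1 + e)^2),
    which is summable. *)
Lemma autoregression_upper (e : R) : 0 < e -> \forall w \ae P, \forall k \near \oo,
  `|autoregression w k| <= stationary_sd * ((1 + e) * Num.sqrt (2 * ln k.+2%:R)).
Proof.
move=> e0; pose p := (1 + e) ^+ 2; have p1 : 1 < p by rewrite /p exprn_egt1// ltrDl.
pose x k : R := (1 + e) * Num.sqrt (2 * ln k.+3%:R).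
have x0 k : 0 <= x k by rewrite mulr_ge0// addr_ge0// ltW.
pose F k := [set w | (stationary_sd * x k < `|autoregression w k.+1|)%R].
have mF k : measurable (F k).
  rewrite (_ : F k = (fun w => `|autoregression w k.+1|) @^-1` `]stationary_sd * x k, +oo[); last first.
    by apply/seteqP; split => y /=; rewrite in_itv/= andbT.
  apply: measurable_preimage => //; apply: measurableT_comp => //.
  exact: measurable_autoregression.
have pF k : (P (F k) <= (2 * k.+1%:R `^ (- p))%:E)%E.
  apply: (le_trans (autoregression_tail k (x0 k))); rewrite lee_fin ler_wpM2l//.
  have l0 : 0 <= ln (k.+3%:R : R) by rewrite ln_ge0// ler1n.
  rewrite /powR pnatr_eq0/= ler_expR /x exprMn sqr_sqrtr ?mulr_ge0// -/p.
  rewrite !mulNr lerN2 (_ : p * (2 * _) / 2 = p * ln k.+3%:R); last by field.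
  apply: ler_wpM2l; first exact: ltW (lt_trans ltr01 p1).
  by rewrite ler_ln ?posrE ?ltr0n// ler_nat; exact: leqW.
have := @borel_cantelli1 _ _ _ P F (fun k => 2 * k.+1%:R `^ (- p)) (2 * (1 + (p - 1)^-1)) mF pF _ _.
move=> /(_ (fun k => mulr_ge0 (ler0n R 2) (powR_ge0 _ _))) [n|].
  by rewrite -mulr_sumr ler_wpM2l// p_series_bound.
move=> N [mN N0 hN]; exists N; split => // w /= hw; apply: hN => /= -[K _ hK]; apply: hw.
exists K.+1 => // -[//|k] /= Kk; rewrite leNgt; apply/negP; exact: hK.
Qed.

End brownian_increments.

Section block_events.
Context {d : measure_display} {T : measurableType d} {R : realType}.
Variable P : probability T R.
Variable B : R -> T -> R.
Hypothesis B_brownian : standard_brownian_motion P B.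
Variable h : R.
Hypothesis h_gt0 : 0 < h.
Implicit Types (A : nat -> nat -> set R) (M : nat).
Local Notation D := (increment B h).

(** A box event on the increments of the k-th block of M cells.  Boxes are used
    instead of half-spaces because their independence is the product rule in
    the definition of Brownian motion. *)
Definition block_event M A k := \bigcap_(j < M) (D (k * M + j) @^-1` A k j).

Lemma block_event_measurable M A k : (forall k j, measurable (A k j)) ->
  measurable (block_event M A k).
Proof.
move=> mA; apply: bigcap_measurableType => j _.
by apply: measurable_preimage => //; exact: (measurable_increment B_brownian h_gt0).
Qed.

Lemma block_event_select M A N (c : nat -> bool) : (0 < M)%N -> (forall k j, measurable (A k j)) ->
  P (\bigcap_(k < N) (if c k then block_event M A k else setT)) =
  (\prod_(k < N) (if c k then \prod_(j < M) P (D (k * M + j) @^-1` A k j) else 1))%E.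
Proof.
move=> M0 mA; pose C i := if c (i %/ M)%N then A (i %/ M)%N (i %% M)%N else setT.
have mC i : measurable (C i) by rewrite /C; case: ifP.
have -> : \bigcap_(k < N) (if c k then block_event M A k else setT) =
    \bigcap_(i < (N * M)%N) (D i @^-1` C i).
  apply/seteqP; split => w /= hw.
    move=> i /= iN; have kN : (i %/ M < N)%N by rewrite ltn_divLR.
    have := hw _ kN; rewrite /C; case: ifP => // _ /(_ (i %% M)%N); rewrite /= ltn_pmod// -divn_eq.
    exact.
  move=> k /= kN; case: ifP => // ck j /= jM.
  have := hw (k * M + j)%N; rewrite /C /= divnMDl// divn_small// addn0 modnMDl modn_small// ck; apply.
  by rewrite (@leq_trans (k.+1 * M))// ?leq_mul2r ?kN ?orbT// mulSn addnC ltn_add2r.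
rewrite (increment_indep B_brownian h_gt0 _ mC) -(big_mkord xpredT (fun i => P (D i @^-1` C i))) big_nat_mul big_mkord.
apply: eq_bigr => k _; rewrite -{1}[(k * M)%N]add0n big_addn mulSn addnK big_mkord.
case: ifP => ck; last first.
  rewrite big1// => j _; rewrite /C divnDMl// ?divn_small// ck preimage_setT probability_setT//.
by apply: eq_bigr => j _; rewrite addnC /C divnMDl// divn_small// addn0 modnMDl modn_small// ck.
Qed.

Lemma block_event_prob M A k : (0 < M)%N -> (forall k j, measurable (A k j)) ->
  P (block_event M A k) = (\prod_(j < M) P (D (k * M + j) @^-1` A k j))%E.
Proof.
move=> M0 mA; have := block_event_select k.+1 (pred1 k) M0 mA.
rewrite big_ord_recr/= eqxx big1 ?mul1e => [<-|i _]; last by rewrite ltn_eqF.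
congr (P _); apply/seteqP; split => w /= hw.
  by move=> i /= _; case: eqP => // ->.
by have := hw k; rewrite /= eqxx ltnSn; apply.
Qed.

Lemma prode_ge n (r : 'I_n -> R) (F : 'I_n -> \bar R) :
  (forall j, 0 <= r j) -> (forall j, ((r j)%:E <= F j)%E) ->
  ((\prod_(j < n) r j)%:E <= \prod_(j < n) F j)%E.
Proof.
move=> r0 rF; have : 0 <= \prod_(j < n) r j /\ ((\prod_(j < n) r j)%:E <= \prod_(j < n) F j)%E.
  elim/big_rec2 : _ => [|j x y _ [y0 yx]]; first by [].
  split; first exact: mulr_ge0.
  by rewrite EFinM; apply: lee_pmul; rewrite ?lee_fin.
by case.
Qed.

Variables (rho sigma : R).
Hypothesis rho_gt0 : 0 < rho.
Hypothesis rho_lt1 : rho < 1.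
Hypothesis sigma_gt0 : 0 < sigma.
Local Notation ar := (autoregression B h rho sigma).
Local Notation sd := (stationary_sd h rho sigma).

(** By the Cauchy-Schwarz equality case, the cheapest way for the innovation
    of a block to reach s x is that the j-th increment reaches wt j * x
    standard deviations, wt being the normalised weights.  As the squares of
    wt sum to 1, the box has probability exp (- x^2 / 2) up to a factor
    exp (O(1 + x)), and x = (1 - eps) sqrt (2 log k) leaves room for that factor
    below 1 / k. *)
Lemma autoregression_lower (e eps : R) M : e ^+ 2 = 1 -> 0 < eps < 1 -> (0 < M)%N ->
  \forall w \ae P, forall n, exists2 k, (n <= k)%N &
    sd * (1 - rho ^+ M) * ((1 - eps) * Num.sqrt (2 * ln k.+1%:R)) <=
    e * ar w (k.+1 * M) + rho ^+ M * `|ar w (k * M)|.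
Proof.
move=> e1 /andP[eps0 eps1] M0.
have sh : 0 < Num.sqrt h by rewrite sqrtr_gt0.
have r2 : 0 < 1 - rho ^+ 2 by rewrite subr_gt0 expr_lt1// ltW.
pose r := rho ^+ M.
have r0 : 0 < r by rewrite exprn_gt0.
have rlt1 : r < 1 by rewrite /r exprn_ilt1 ?ltW// -lt0n.
pose S : R := \sum_(j < M) (rho ^+ (M - j.+1)) ^+ 2.
have SE : S = (1 - r ^+ 2) / (1 - rho ^+ 2) by exact: geometric_sum_sq.
have S0 : 0 < S by rewrite SE divr_gt0// subr_gt0 expr_lt1// ltW.
have sS : 0 < Num.sqrt S by rewrite sqrtr_gt0.
pose wt j : R := rho ^+ (M - j.+1) / Num.sqrt S.
have wt0 j : 0 <= wt j by rewrite divr_ge0 ?exprn_ge0 ?ltW.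
have wtsum : \sum_(j < M) wt j ^+ 2 = 1.
  rewrite (eq_bigr (fun j : 'I_M => (rho ^+ (M - j.+1)) ^+ 2 / S)) => [|j _].
    by rewrite -mulr_suml divff// gt_eqF.
  by rewrite /wt expr_div_n sqr_sqrtr// ltW.
have wt1 (j : 'I_M) : wt j <= 1.
  rewrite -(@ler_pXn2r _ 2) ?nnegrE// expr1n -wtsum (bigD1 j)//= lerDl.
  by apply: sumr_ge0 => i _; exact: sqr_ge0.
pose x k : R := (1 - eps) * Num.sqrt (2 * ln k.+1%:R).
have lnk k : 0 <= ln (k.+1%:R : R) by rewrite ln_ge0// ler1n.
have x0 k : 0 <= x k by rewrite mulr_ge0// subr_ge0 ltW.
pose A k j : set R := [set y | Num.sqrt h * (wt j * x k) <= e * y].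
have mA k j : measurable (A k j).
  rewrite (_ : A k j = ( *%R e) @^-1` `[Num.sqrt h * (wt j * x k), +oo[); last first.
    by apply/seteqP; split => y /=; rewrite in_itv/= andbT.
  by rewrite -[X in measurable X]setTI; apply: measurable_funM.
pose c0 : R := Num.sqrt h * normal_peak (Num.sqrt h).
have c00 : 0 < c0 by rewrite mulr_gt0// normal_peak_gt0// gt_eqF.
have low k : ((\prod_(j < M) (c0 * expR (- (wt j * x k + 1) ^+ 2 / 2)))%:E <= P (block_event M A k))%E.
  rewrite block_event_prob//; apply: prode_ge => j; first by rewrite mulr_ge0 ?expR_ge0 ?ltW.
  rewrite (increment_law B_brownian h_gt0 _ (mA k j)).
  have := normal_prob_ge e1 sh (mulr_ge0 (ltW sh) (mulr_ge0 (wt0 j) (x0 k))).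
  by rewrite [X in (X + 1)]mulrAC divff ?gt_eqF// mul1r.
pose kap : R := 1 - (1 - eps) ^+ 2.
have kap0 : 0 < kap by rewrite /kap subr_gt0 expr_lt1//; lra.
pose C := c0 ^+ M * expR (- (M%:R / 2 + M%:R ^+ 2 / (2 * kap))).
have C0 : 0 < C by rewrite mulr_gt0 ?expR_gt0 ?exprn_gt0.
have lowC k : ((C / k.+1%:R)%:E <= P (block_event M A k))%E.
  apply: le_trans (low k); rewrite lee_fin big_split/= prodr_const card_ord -expR_sum.
  rewrite /C -mulrA ler_pM2l ?exprn_gt0//.
  rewrite -[k.+1%:R in leLHS]lnK ?posrE ?ltr0n// -expRN -expRD ler_expR.
  have : \sum_(j < M) ((wt j * x k + 1) ^+ 2 / 2) <= (x k ^+ 2 + M%:R * (2 * x k + 1)) / 2.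
    rewrite -mulr_suml ler_pM2r ?invr_gt0//.
    apply: (@le_trans _ _ (\sum_(j < M) (x k ^+ 2 * wt j ^+ 2 + (2 * x k + 1)))).
      apply: ler_sum => j _; have : wt j * x k <= x k by rewrite ler_piMl.
      have -> : (wt j * x k + 1) ^+ 2 = x k ^+ 2 * wt j ^+ 2 + (2 * (wt j * x k) + 1) by ring.
      rewrite lerD2l; lra.
    by rewrite big_split/= -mulr_sumr wtsum mulr1 sumr_const card_ord [X in _ <= _ + X]mulr_natl.
  move=> hs; rewrite [X in _ <= X](eq_bigr (fun j : 'I_M => - ((wt j * x k + 1) ^+ 2 / 2))); last by move=> j _; rewrite mulNr.
  rewrite sumrN.
  pose s : R := Num.sqrt (2 * ln k.+1%:R).
  have s0 : 0 <= s by exact: sqrtr_ge0.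
  have sE : s ^+ 2 = 2 * ln k.+1%:R by rewrite sqr_sqrtr// mulr_ge0.
  have xs : x k <= s by rewrite /x -/s ler_piMl//; lra.
  have x2 : x k ^+ 2 = (1 - kap) * s ^+ 2 by rewrite /x -/s /kap exprMn; ring.
  have quad : M%:R * s <= kap * s ^+ 2 / 2 + M%:R ^+ 2 / (2 * kap).
    rewrite -(ler_pM2r kap0) -subr_ge0.
    have -> : (kap * s ^+ 2 / 2 + M%:R ^+ 2 / (2 * kap)) * kap - M%:R * s * kap = (kap * s - M%:R) ^+ 2 / 2.
      by field; rewrite gt_eqF.
    by rewrite divr_ge0// sqr_ge0.
  have Mx : M%:R * x k <= M%:R * s by rewrite ler_wpM2l.
  move: hs; rewrite x2; move: sE quad Mx; move: (M%:R ^+ 2 / _) (s ^+ 2) => Y Z; lra.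
have sel N (c : nat -> bool) : P (\bigcap_(k < N) (if c k then block_event M A k else setT)) =
     (\prod_(k < N) (if c k then P (block_event M A k) else 1))%E.
  by rewrite block_event_select//; apply: eq_bigr => k _; case: ifP => // _; rewrite block_event_prob.
have := borel_cantelli2 C0 (fun k => block_event_measurable M k mA) sel lowC.
move=> [N [mN N0 hN]]; exists N; split => // w /= hw; apply: hN => /= hE; apply: hw => n.
have [k nk Ek] := hE n; exists k => //.
rewrite mulSn addnC (autoregressionD B h rho sigma) -/r.
set Y := \sum_(j < M) _.
have hY : sd * (1 - r) * x k <= e * Y.
  apply: (@le_trans _ _ (sigma * Num.sqrt h * Num.sqrt S * x k)).
    apply: ler_wpM2r => //.
    rewrite -(@ler_pXn2r _ 2) ?nnegrE//; last 2 first.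
      by rewrite mulr_ge0 ?sqrtr_ge0// subr_ge0 ltW.
      by rewrite !mulr_ge0 ?sqrtr_ge0// ltW.
    have hh : 0 <= sigma ^+ 2 * h / (1 - rho ^+ 2) by exact: divr_ge0 (mulr_ge0 (sqr_ge0 _) (ltW h_gt0)) (ltW r2).
    rewrite exprMn /stationary_sd sqr_sqrtr// !exprMn !sqr_sqrtr ?(ltW h_gt0) ?(ltW S0)// SE.
    have -> : sigma ^+ 2 * h * ((1 - r ^+ 2) / (1 - rho ^+ 2)) = sigma ^+ 2 * h / (1 - rho ^+ 2) * (1 - r ^+ 2) by ring.
    apply: ler_wpM2l => //.
    have : r * r <= r * 1 by rewrite ler_wpM2l ?ltW.
    rewrite expr2 [r ^+ 2]expr2; lra.
  rewrite /Y mulr_sumr.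
  have -> : sigma * Num.sqrt h * Num.sqrt S * x k = \sum_(j < M) sigma * Num.sqrt h * x k * Num.sqrt S * wt j ^+ 2.
    by rewrite -mulr_sumr wtsum mulr1 mulrAC.
  apply: ler_sum => j _; have := Ek j (ltn_ord j); rewrite /A /= => hA.
  have -> : sigma * Num.sqrt h * x k * Num.sqrt S * wt j ^+ 2 = rho ^+ (M - j.+1) * sigma * (Num.sqrt h * (wt j * x k)).
    by rewrite /wt; field; rewrite gt_eqF.
  by rewrite (mulrCA e) ler_pM2l // mulr_gt0 // exprn_gt0.
apply: (le_trans hY); rewrite mulrDr.
have : - (r * `|ar w (k * M)|) <= e * (r * ar w (k * M)).
  rewrite mulrCA -mulrN ler_pM2l//; apply: lerNnormlW.
  rewrite normrM (_ : `|e| = 1) ?mul1r//.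
  by apply/eqP; rewrite -(@eqrXn2 _ 2) ?expr1n// real_normK ?num_real// e1.
rewrite /r; lra.
Qed.

End block_events.

(** * The logarithmic envelope of the Ornstein-Uhlenbeck process *)

Section logarithmic_scale.
Context {R : realType}.
Implicit Types (t kappa K eps : R).

(** The constants that depend on the path are absorbed by the logarithm. *)
Lemma sqrt_ln_large K : exists t0, forall t, t0 <= t -> K <= Num.sqrt (ln t).
Proof.
exists (expR (K ^+ 2)) => t ht.
have : K ^+ 2 <= ln t by rewrite -(expRK (K ^+ 2)) ler_ln ?posrE ?expR_gt0// (lt_le_trans (expR_gt0 _) ht).
move=> h; rewrite (le_trans (ler_norm K))// -sqrtr_sqr ler_wsqrtr//.
Qed.

(** Grid indices and times are affinely related, which changes the square root
    of the logarithm by a factor tending to 1. *)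
Lemma sqrt_ln_affine kappa eps : 0 < kappa -> 0 < eps ->
  exists t0, forall t, t0 <= t ->
    forall x, x <= kappa * t + 2 -> Num.sqrt (ln x) <= (1 + eps) * Num.sqrt (ln t).
Proof.
move=> k0 e0; have [t1 ht1] := sqrt_ln_large (Num.sqrt (ln (kappa + 2) / eps)).
exists (Num.max 1 t1) => t; rewrite ge_max => /andP[t1' tt] x xt.
have t0 : 0 < t by rewrite (lt_le_trans ltr01).
have lt0 : 0 <= ln t by rewrite ln_ge0.
have lk0 : 0 <= ln (kappa + 2) by rewrite ln_ge0//; lra.
have hk : ln (kappa + 2) <= eps * ln t.
  have := ht1 t tt; rewrite ler_psqrt ?nnegrE ?divr_ge0 ?(ltW e0)//.
  by rewrite ler_pdivrMr// mulrC.
have hx : ln x <= ln (kappa + 2) + ln t.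
  rewrite -lnM ?posrE//; last by lra.
  case: (leP x 0) => x0; first by rewrite ln0// lnM ?posrE ?addr_ge0//; lra.
  have p : 0 < (kappa + 2) * t by rewrite mulr_gt0//; lra.
  rewrite ler_ln ?posrE//; apply: (le_trans xt); lra.
rewrite -[leRHS]ger0_norm; last by rewrite mulr_ge0// addr_ge0// ltW.
rewrite -sqrtr_sqr ler_wsqrtr// exprMn sqr_sqrtr//.
have : eps * eps * ln t >= 0 by rewrite !mulr_ge0// ltW.
have : 0 <= eps * ln t by rewrite mulr_ge0// ltW.
have -> : (1 + eps) ^+ 2 * ln t = ln t + eps * ln t + (eps * ln t + eps * eps * ln t) by ring.
lra.
Qed.

End logarithmic_scale.

Section stationary_bounds.
Context {R : realType}.
Variables (a sigma h : R).
Hypothesis a_lt0 : a < 0.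
Hypothesis sigma_gt0 : 0 < sigma.
Hypothesis h_gt0 : 0 < h.
Local Notation s_oo := (sigma / Num.sqrt (2 * `|a|)).
Local Notation sd := (stationary_sd h (expR (a * h)) sigma).

Let na : 0 < - a. Proof. by rewrite oppr_gt0. Qed.

Let y_gt0 : 0 < 2 * - a * h. Proof. by rewrite !mulr_gt0. Qed.

Let rho2 : expR (a * h) ^+ 2 = expR (- (2 * - a * h)).
Proof. by rewrite -expRM_natl; congr expR; ring. Qed.

Let s_oo2 : s_oo ^+ 2 = sigma ^+ 2 / (2 * - a).
Proof. by rewrite expr_div_n sqr_sqrtr ?mulr_ge0// ltr0_norm. Qed.

Let s_oo_gt0 : 0 < s_oo.
Proof. by rewrite divr_gt0// sqrtr_gt0 mulr_gt0// normr_gt0 lt_eqF. Qed.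

Let rho2_lt1 : 0 < 1 - expR (- (2 * - a * h)).
Proof. by rewrite subr_gt0 expR_lt1 oppr_lt0. Qed.

Let sd2 : sd ^+ 2 = sigma ^+ 2 * h / (1 - expR (- (2 * - a * h))).
Proof.
rewrite /stationary_sd rho2 sqr_sqrtr//.
exact: divr_ge0 (mulr_ge0 (sqr_ge0 _) (ltW h_gt0)) (ltW rho2_lt1).
Qed.

(** From 1 - e^(-y) <= y at y = 2 |a| h. *)
Lemma stationary_sd_ge : s_oo <= sd.
Proof.
rewrite -(@ler_pXn2r _ 2) ?nnegrE ?sqrtr_ge0 ?(ltW s_oo_gt0)// s_oo2 sd2.
rewrite ler_pdivrMr ?mulr_gt0// [leRHS]mulrAC ler_pdivlMr//.
have := expR_ge1Dx (- (2 * - a * h)) => hx.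
have -> : sigma ^+ 2 * h * (2 * - a) = sigma ^+ 2 * (2 * - a * h) by ring.
by rewrite ler_pM2l ?exprn_gt0//; lra.
Qed.

(** From y / (1 + y) <= 1 - e^(-y) at y = 2 |a| h. *)
Lemma stationary_sd_le : sd <= s_oo * (1 + 2 * - a * h).
Proof.
pose y : R := 2 * - a * h; have y0 : 0 < y by [].
rewrite -/y; have s1 : 0 <= s_oo * (1 + y) by rewrite mulr_ge0 ?(ltW s_oo_gt0)//; lra.
rewrite -(@ler_pXn2r _ 2) ?nnegrE ?sqrtr_ge0// exprMn s_oo2 sd2 -/y.
rewrite ler_pdivrMr//.
have e1 : y <= (1 + y) * (1 - expR (- y)).
  rewrite mulrBr mulr1 expRN; have : (1 + y) / expR y <= 1.
    by rewrite ler_pdivrMr ?expR_gt0// mul1r expR_ge1Dx.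
  lra.
have -> : sigma ^+ 2 * h = sigma ^+ 2 / (2 * - a) * y by rewrite /y; field; rewrite lt_eqF.
rewrite -[leRHS]mulrA; apply: ler_wpM2l; first exact: divr_ge0 (sqr_ge0 _) (mulr_ge0 _ (ltW na)).
apply: (le_trans e1); rewrite expr2 -mulrA ler_peMl//.
  by rewrite mulr_ge0 ?(ltW rho2_lt1)//; lra.
by lra.
Qed.

End stationary_bounds.

Section ou_envelope.
Context {d : measure_display} {T : measurableType d} {R : realType}.
Variable P : probability T R.
Variables (B U : R -> T -> R) (a sigma : R).
Hypothesis B_brownian : standard_brownian_motion P B.
Hypothesis a_lt0 : a < 0.
Hypothesis sigma_gt0 : 0 < sigma.
Hypothesis U_path : \forall w \ae P, {within `[0, +oo[, continuous (U ^~ w)} /\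
  forall t : R, 0 <= t -> U t w = \int[lebesgue_measure]_(s in `[0, t]) (a * U s w) + sigma * (B t w - B 0 w).
Local Notation s_oo := (sigma / Num.sqrt (2 * `|a|)).

Lemma ou_grid_ae (h : R) : 0 < h -> \forall w \ae P, exists2 K0, 0 <= K0 &
  forall k, `|U (k%:R * h) w - autoregression B h (expR (a * h)) sigma w k|
      <= K0 + 24 * sigma * Num.sqrt h * Num.sqrt (ln k.+2%:R) /\
    forall t, k%:R * h <= t <= k%:R * h + h ->
      `|U t w| <= `|autoregression B h (expR (a * h)) sigma w k|
        + 3 * (K0 + 24 * sigma * Num.sqrt h * Num.sqrt (ln k.+2%:R)).
Proof.
move=> h0; have kh0 (k : nat) : 0 <= k%:R * h by rewrite mulr_ge0// ltW.
have osc := brownian_oscillation B_brownian kh0 (fun=> h0).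
have [_ _ cB _ _] := B_brownian.
apply: filterS3 osc cB U_path => w osc cBw [cU eU].
pose beta t := sigma * (B t w - B 0 w).
have cbeta : {within `[0, +oo[, continuous beta}.
  by move=> t; apply: cvgM; [exact: cvg_cst|apply: cvgB; [exact: cBw|exact: cvg_cst]].
pose g (k : nat) : R := 24 * sigma * Num.sqrt h * Num.sqrt (ln k.+2%:R).
have g0 k : 0 <= g k by rewrite !mulr_ge0 ?sqrtr_ge0 ?(ltW sigma_gt0).
have betaE s t : beta s - beta t = sigma * (B s w - B t w) by rewrite /beta; ring.
have ev : \forall k \near \oo, forall s, k%:R * h <= s <= k%:R * h + h ->
    `|beta s - beta (k%:R * h)| <= g k.
  apply: filterS osc => k hk s hs; rewrite betaE normrM gtr0_norm//.
  have := hk s hs; rewrite -(ler_pM2l sigma_gt0) => h1; apply: (le_trans h1).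
  by rewrite /g le_eqVlt; apply/orP; left; apply/eqP; ring.
have [K0 K00 hosc] := cells_uniform_bound cbeta kh0 (fun=> h0) g0 ev.
have gm k : K0 + g k <= K0 + g k.+1.
  rewrite lerD2l; apply: ler_wpM2l; first by rewrite !mulr_ge0 ?sqrtr_ge0 ?(ltW sigma_gt0).
  by apply: ler_wsqrtr; rewrite ler_ln ?posrE ?ltr0n// ler_nat.
have VS k : autoregression B h (expR (a * h)) sigma w k.+1 =
    expR (a * h) * autoregression B h (expR (a * h)) sigma w k + (beta (k.+1%:R * h) - beta (k%:R * h)).
  by rewrite autoregressionS betaE.
have beta0 : beta 0 = 0 by rewrite /beta subrr mulr0.
exists K0 => // k; split.
  exact: (ou_grid a_lt0 cU cbeta beta0 eU h0 (autoregression0 B h (expR (a * h)) sigma w) VS gm hosc).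
move=> t; exact: (ou_between_grid a_lt0 cU cbeta beta0 eU h0 (autoregression0 B h (expR (a * h)) sigma w) VS gm hosc).
Qed.

Lemma limit_sd_gt0 : 0 < s_oo.
Proof. by rewrite divr_gt0// sqrtr_gt0 mulr_gt0// normr_gt0 lt_eqF. Qed.

Lemma decay_lt1 (h : R) : 0 < h -> expR (a * h) < 1.
Proof. by move=> h0; rewrite -expR0 ltr_expR nmulr_rlt0. Qed.

(** With mesh h = eps^2 the discretisation error is O(eps sqrt (log k)), and K
    collects the coefficients of eps. *)
Lemma ou_upper_envelope (dl : R) : 0 < dl -> \forall w \ae P, \forall t \near +oo,
  `|U t w| <= (s_oo + dl) * Num.sqrt (2 * ln t).
Proof.
move=> d0; have na : 0 < - a by rewrite oppr_gt0.
have s0 := sigma_gt0.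
have [so soE] : exists so, so = s_oo by exists s_oo.
have so_gt0 : 0 < so by rewrite soE limit_sd_gt0.
rewrite -soE.
pose K := so * (8 * - a + 3) + 144 * sigma + 1.
have K0 : 0 < K.
  have : 0 < so * (8 * - a + 3) by rewrite mulr_gt0//; lra.
  by rewrite /K; lra.
pose eps : R := Num.min 1 (dl / K).
have e0 : 0 < eps by rewrite lt_min ltr01 divr_gt0.
have e1 : eps <= 1 by rewrite ge_min lexx.
have eK : K * eps <= dl by rewrite mulrC -ler_pdivlMr// ge_min lexx orbT.
pose h : R := eps ^+ 2; have h0 : 0 < h by rewrite exprn_gt0.
have sh : Num.sqrt h = eps by rewrite sqrtr_sqr gtr0_norm.
pose rho := expR (a * h).
have up := autoregression_upper B_brownian h0 (expR_gt0 _) (decay_lt1 h0) sigma_gt0 e0.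
apply: filterS2 up (ou_grid_ae h0) => w [k1 _ hk1] [K1 K10 hgrid].
have [t1 ht1] := sqrt_ln_affine (ltac:(by rewrite invr_gt0) : 0 < h^-1) e0.
have [t2 ht2] := sqrt_ln_large (3 * K1 / eps).
near=> t.
have tt1 : t1 <= t by near: t; apply: nbhs_pinfty_ge; rewrite num_real.
have tt2 : t2 <= t by near: t; apply: nbhs_pinfty_ge; rewrite num_real.
have t0 : 0 <= t by near: t; apply: nbhs_pinfty_ge; rewrite num_real.
have tk : k1%:R * h <= t by near: t; apply: nbhs_pinfty_ge; rewrite num_real.
have th0 : 0 <= t / h by rewrite divr_ge0// ltW.
have /andP[kt kt'] := truncn_itv th0.
set k := Num.truncn (t / h) in kt kt'.
rewrite ler_pdivlMr// in kt; rewrite ltr_pdivrMr// -natr1 mulrDl mul1r in kt'.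
have k1k : (k1 <= k)%N.
  rewrite -ltnS -(ltr_nat R) -(ltr_pM2r h0) (le_lt_trans tk)//.
  by rewrite -(natr1 k) mulrDl mul1r.
have [_ /(_ t)] := hgrid k; rewrite kt (ltW kt') => /(_ isT) hU.
have hV := hk1 k k1k.
set L := Num.sqrt (ln t).
have L0 : 0 <= L by exact: sqrtr_ge0.
have hL : Num.sqrt (ln k.+2%:R) <= (1 + eps) * L.
  apply: ht1 => //; rewrite -addn2 natrD lerD2r mulrC ler_pdivlMr//.
have hK1 : 3 * K1 <= eps * L by rewrite [leRHS]mulrC -ler_pdivrMr //; exact: ht2.
have [s2 [s2_ge1 s2E]] : exists s2 : R, 1 <= s2 /\ forall x, Num.sqrt (2 * ln x) = s2 * Num.sqrt (ln x).
  exists (Num.sqrt 2); split => [|x]; last by rewrite sqrtrM.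
  by rewrite -[leLHS]sqrtr1 ler_wsqrtr// ler1n.
have s20 : 0 <= s2 by rewrite (le_trans ler01).
rewrite s2E -/L.
move: hV; rewrite s2E; set sd := stationary_sd _ _ _; set lk := Num.sqrt (ln k.+2%:R) in hL hU *.
have lk0 : 0 <= lk by exact: sqrtr_ge0.
have sd_le : sd <= so * (1 + 2 * - a * eps).
  apply: (le_trans (stationary_sd_le a_lt0 sigma_gt0 h0)); rewrite -soE.
  by rewrite ler_pM2l// lerD2l ler_pM2l ?mulr_gt0// /h expr2 ler_piMl// ltW.
have sd0 : 0 < sd by apply: lt_le_trans (stationary_sd_ge a_lt0 sigma_gt0 h0); exact: limit_sd_gt0.
move=> hV.
rewrite sh in hU.
have c1 : sd * ((1 + eps) * (1 + eps)) <= so + so * (8 * - a + 3) * eps.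
  apply: (@le_trans _ _ (so * (1 + 2 * - a * eps) * (1 + 3 * eps))).
    have : eps * eps <= eps by rewrite ler_piMl// ltW.
    move=> ee; apply: ler_pM; rewrite ?(ltW sd0)//; first by rewrite mulr_ge0; lra.
    lra.
  have -> : so + so * (8 * - a + 3) * eps = so * (1 + (8 * - a + 3) * eps) by ring.
  rewrite -mulrA ler_pM2l//.
  have : - a * (eps * eps) <= - a * eps by rewrite ler_pM2l// ler_piMl// ltW.
  lra.
have q1 : sd * ((1 + eps) * (s2 * lk)) <= s2 * L * (sd * ((1 + eps) * (1 + eps))).
  have -> : sd * ((1 + eps) * (s2 * lk)) = sd * (1 + eps) * s2 * lk by ring.
  have -> : s2 * L * (sd * ((1 + eps) * (1 + eps))) = sd * (1 + eps) * s2 * ((1 + eps) * L) by ring.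
  by apply: ler_wpM2l => //; rewrite !mulr_ge0 ?(ltW sd0) ?sqrtr_ge0//; lra.
have q2 : s2 * L * (sd * ((1 + eps) * (1 + eps))) <= s2 * L * (so + so * (8 * - a + 3) * eps).
  by apply: ler_wpM2l => //; rewrite mulr_ge0 ?sqrtr_ge0.
have q3 : sigma * eps * lk <= 2 * sigma * eps * (s2 * L).
  have : lk <= 2 * L by apply: (le_trans hL); rewrite ler_wpM2r//; lra.
  have : L <= s2 * L by rewrite ler_peMl.
  move=> ha hb; have -> : 2 * sigma * eps * (s2 * L) = sigma * eps * (2 * (s2 * L)) by ring.
  by rewrite ler_pM2l ?mulr_gt0//; lra.
have q4 : eps * L <= eps * (s2 * L) by rewrite ler_pM2l// ler_peMl.
have q5 : (K * eps) * (s2 * L) <= dl * (s2 * L).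
  by apply: ler_wpM2r => //; rewrite mulr_ge0 ?sqrtr_ge0.
have -> : (so + dl) * (s2 * L) = so * (s2 * L) + dl * (s2 * L) by ring.
apply: (le_trans hU).
have q6 : so * (s2 * L) + (K * eps) * (s2 * L) = s2 * L * (so + so * (8 * - a + 3) * eps) + 72 * (2 * sigma * eps * (s2 * L)) + eps * (s2 * L).
  by rewrite /K; ring.
have q7 : 3 * (K1 + 24 * sigma * eps * lk) = 3 * K1 + 72 * (sigma * eps * lk) by ring.
lra.
Unshelve. all: by end_near. Qed.

(** The block length M is chosen so that the value at the start of the block,
    of order sqrt (log k) as well, is damped by rho^M <= eps. *)
Lemma ou_lower_envelope (e dl : R) : e ^+ 2 = 1 -> 0 < dl -> dl <= s_oo ->
  \forall w \ae P, forall N : R, exists2 t, N <= t &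
    (s_oo - dl) * Num.sqrt (2 * ln t) <= e * U t w.
Proof.
move=> e2 d0 ds; have na : 0 < - a by rewrite oppr_gt0.
have s0 := sigma_gt0.
have [so soE] : exists so, so = s_oo by exists s_oo.
have so_gt0 : 0 < so by rewrite soE limit_sd_gt0.
rewrite -soE in ds *.
pose K := 3 * so + 4 * (1 + 2 * - a) * so + 48 * sigma + 1.
have K0 : 0 < K.
  have : 0 < 4 * (1 + 2 * - a) * so by rewrite mulr_gt0//; lra.
  by rewrite /K; lra.
pose eps : R := Num.min (1 / 2) (dl / K).
have e0 : 0 < eps by rewrite lt_min !divr_gt0.
have e1 : eps <= 1 / 2 by rewrite ge_min lexx.
have eK : K * eps <= dl by rewrite mulrC -ler_pdivlMr// ge_min lexx orbT.
pose h : R := eps ^+ 2; have h0 : 0 < h by rewrite exprn_gt0.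
have h1 : h <= 1 by rewrite exprn_ile1 ?ltW//; lra.
have sh : Num.sqrt h = eps by rewrite sqrtr_sqr gtr0_norm.
pose rho := expR (a * h).
have [M M0 hM] : exists2 M, (0 < M)%N & rho ^+ M <= eps.
  have : (rho ^+ n @[n --> \oo] --> (0 : R)).
    by apply: cvg_expr; rewrite ger0_norm ?expR_ge0// decay_lt1.
  move/cvgrPdist_lt => /(_ _ e0)[n _ hn]; exists n.+1 => //.
  have := hn n.+1 (leqnSn n); rewrite /= sub0r normrN => hh.
  exact: le_trans (ler_norm _) (ltW hh).
have M0' : 0 < (M%:R : R) by rewrite ltr0n.
have up := autoregression_upper B_brownian h0 (expR_gt0 _) (decay_lt1 h0) sigma_gt0 e0.
have lo := @autoregression_lower _ _ _ _ _ B_brownian _ h0 _ _ (expR_gt0 _) (decay_lt1 h0) sigma_gt0 e eps M e2 (ltac:(apply/andP; split => //; lra)) M0.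
apply: filterS3 up lo (ou_grid_ae h0) => w [k1 _ hk1] hlo [K1 K10 hgrid] N.
have [t1 ht1] := sqrt_ln_affine M0' e0.
have [t2 ht2] := sqrt_ln_large (K1 / eps).
pose n := maxn k1 (maxn (Num.truncn t1).+1 (maxn (Num.truncn t2).+1 (Num.truncn (N / (M%:R * h))).+1)).
have [k nk hk] := hlo n.
have up_trunc (x : R) : ((Num.truncn x).+1 <= k)%N -> x <= k.+1%:R.
  move=> xk; apply: (le_trans (ltW (truncnS_gt x))); rewrite ler_nat; exact: leqW.
move: nk; rewrite !geq_max => /and4P[k1k /up_trunc t1k /up_trunc t2k /up_trunc Nk].
have Mh : 0 < M%:R * h by rewrite mulr_gt0.
exists ((k.+1 * M)%:R * h).
  by move: Nk; rewrite ler_pdivrMr// natrM mulrA.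
set t := _ * h; pose L := Num.sqrt (ln (k.+1%:R : R)).
have L0 : 0 <= L by exact: sqrtr_ge0.
have [hU _] := hgrid (k.+1 * M)%N.
have hV := hk1 (k * M)%N (leq_trans k1k (leq_pmulr k M0)).
have hL1 : Num.sqrt (ln (k.+1 * M).+2%:R) <= (1 + eps) * L.
  by apply: ht1 => //; rewrite -addn2 natrD natrM mulrC.
have hL2 : Num.sqrt (ln (k * M).+2%:R) <= (1 + eps) * L.
  by apply: ht1 => //; rewrite -addn2 natrD natrM lerD2r mulrC ler_pM2l// ler_nat.
have hL3 : Num.sqrt (ln t) <= (1 + eps) * L.
  apply: ht1 => //; rewrite /t natrM (mulrC k.+1%:R).
  have : M%:R * k.+1%:R * h <= M%:R * k.+1%:R * 1 by rewrite ler_wpM2l// mulr_ge0.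
  lra.
have hK1 : K1 <= eps * L by rewrite [leRHS]mulrC -ler_pdivrMr //; exact: ht2.
have [s2 [s2_ge1 s2E]] : exists s2 : R, 1 <= s2 /\ forall x, Num.sqrt (2 * ln x) = s2 * Num.sqrt (ln x).
  exists (Num.sqrt 2); split => [|x]; last by rewrite sqrtrM.
  by rewrite -[leLHS]sqrtr1 ler_wsqrtr// ler1n.
have s20 : 0 <= s2 by rewrite (le_trans ler01).
move: hk hV; rewrite !s2E -/L -/t in hU *; set sd := stationary_sd _ _ _.
set V1 := autoregression _ _ _ _ _ _ in hU *.
set V0 := autoregression _ _ _ _ _ _.
set l1 := Num.sqrt (ln (k.+1 * M).+2%:R) in hL1 hU *.
set l2 := Num.sqrt (ln (k * M).+2%:R) in hL2 *.
set l3 := Num.sqrt (ln t) in hL3 *.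
rewrite sh in hU => hk hV.
have r0 : 0 <= rho ^+ M by rewrite exprn_ge0 ?expR_ge0.
have sd_le : sd <= so * (1 + 2 * - a).
  apply: (le_trans (stationary_sd_le a_lt0 sigma_gt0 h0)); rewrite -soE.
  by rewrite ler_pM2l// lerD2l ler_piMr// mulr_ge0// ltW.
have sd_ge : so <= sd by rewrite soE; exact: stationary_sd_ge.
have sd0 : 0 < sd by exact: lt_le_trans sd_ge.
have sL0 : 0 <= s2 * L by rewrite mulr_ge0.
have eU : e * V1 - `|U t w - V1| <= e * U t w.
  have : - `|U t w - V1| <= e * (U t w - V1).
    apply: lerNnormlW; rewrite normrM (_ : `|e| = 1) ?mul1r//.
    by apply/eqP; rewrite -(@eqrXn2 _ 2) ?expr1n// real_normK ?num_real// e2.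
  lra.
have q1 : so * (1 - 2 * eps) * (s2 * L) <= sd * (1 - rho ^+ M) * ((1 - eps) * (s2 * L)).
  rewrite [leRHS]mulrA; apply: ler_wpM2r => //; rewrite -mulrA.
  apply: ler_pM => //; [exact: ltW|lra|].
  have : rho ^+ M * (1 - eps) <= eps * (1 - eps) by rewrite ler_wpM2r//; lra.
  have : 0 <= eps * eps by rewrite mulr_ge0// ltW.
  lra.
have q2 : rho ^+ M * `|V0| <= 4 * (1 + 2 * - a) * so * eps * (s2 * L).
  apply: (@le_trans _ _ (eps * (so * (1 + 2 * - a) * (2 * (s2 * (2 * L)))))).
    apply: ler_pM => //; apply: (le_trans hV); apply: ler_pM => //; first exact: ltW.
      by rewrite !mulr_ge0 ?sqrtr_ge0//; lra.
    apply: ler_pM; rewrite ?mulr_ge0 ?sqrtr_ge0//; first by lra.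
      by lra.
    apply: ler_wpM2l => //; apply: (le_trans hL2); apply: ler_wpM2r => //; lra.
  by rewrite le_eqVlt; apply/orP; left; apply/eqP; ring.
have q3 : sigma * eps * l1 <= 2 * sigma * eps * (s2 * L).
  have : l1 <= 2 * L by apply: (le_trans hL1); rewrite ler_wpM2r//; lra.
  have : L <= s2 * L by rewrite ler_peMl.
  move=> ha hb; have -> : 2 * sigma * eps * (s2 * L) = sigma * eps * (2 * (s2 * L)) by ring.
  by rewrite ler_pM2l ?mulr_gt0//; lra.
have q4 : eps * L <= eps * (s2 * L) by rewrite ler_pM2l// ler_peMl.
have q5 : (K * eps) * (s2 * L) <= dl * (s2 * L) by exact: ler_wpM2r.
have q6 : (so - dl) * (s2 * l3) <= (so - dl + so * eps) * (s2 * L).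
  apply: (@le_trans _ _ ((so - dl) * (s2 * ((1 + eps) * L)))).
    by do 2 (apply: ler_wpM2l => //; rewrite ?subr_ge0//).
  have -> : (so - dl) * (s2 * ((1 + eps) * L)) = (so - dl + so * eps - dl * eps) * (s2 * L) by ring.
  apply: ler_wpM2r => //; rewrite gerBl mulr_ge0// ltW//.
have q7 : (K * eps) * (s2 * L) = 3 * so * eps * (s2 * L) + 4 * (1 + 2 * - a) * so * eps * (s2 * L) + 24 * (2 * sigma * eps * (s2 * L)) + eps * (s2 * L).
  by rewrite /K; ring.
apply: (le_trans q6); apply: le_trans eU.
have q8 : (so - dl + so * eps) * (s2 * L) = so * (s2 * L) - dl * (s2 * L) + so * eps * (s2 * L) by ring.
have q9 : so * (1 - 2 * eps) * (s2 * L) = so * (s2 * L) - 2 * (so * eps * (s2 * L)) by ring.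
have q10 : 3 * so * eps * (s2 * L) = 3 * (so * eps * (s2 * L)) by ring.
have q11 : K1 + 24 * sigma * eps * l1 = K1 + 24 * (sigma * eps * l1) by ring.
rewrite q11 in hU.
lra.
Qed.

End ou_envelope.

Section limsup_envelope.
Context {R : realType}.
Implicit Types (g x u : R -> R) (s dl N : R).

Lemma limf_esup_pinfty g s :
  (forall dl, 0 < dl -> \forall t \near +oo, g t <= s + dl) ->
  (forall dl, 0 < dl -> forall N, exists2 t, N < t & s - dl <= g t) ->
  limf_esup (fun t => (g t)%:E) +oo%R = s%:E.
Proof.
move=> up lo; rewrite limf_esupE; apply/eqP; rewrite eq_le; apply/andP; split.
  apply/lee_addgt0Pr => dl d0; apply: ge_ereal_inf.
  exists (ereal_sup ((fun t => (g t)%:E) @` [set t | g t <= s + dl])).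
    by exists [set t | g t <= s + dl] => //; exact: up.
  by apply: ge_ereal_sup => _ [t /= gt <-]; rewrite -EFinD lee_fin.
apply: le_ereal_inf_tmp => _ [V [N [_ VN]] <-].
apply/lee_subgt0Pr => dl d0; have [t Nt st] := lo dl d0 N.
apply: (@le_trans _ _ (g t)%:E); first by rewrite -EFinB lee_fin.
by apply: ereal_sup_ubound; exists t => //; exact: VN.
Qed.

(** A bounded perturbation does not change the envelope; the sign e = -1 turns
    the lower limit into an upper limit. *)
Lemma log_envelope_limits x u s N : 0 < s ->
  (forall t : R, 0 <= t -> `|x t - u t| <= N) ->
  (forall dl, 0 < dl -> dl <= s -> \forall t \near +oo, `|u t| <= (s + dl) * Num.sqrt (2 * ln t)) ->
  (forall e dl, e ^+ 2 = 1 -> 0 < dl -> dl <= s -> forall M, exists2 t, M <= t &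
     (s - dl) * Num.sqrt (2 * ln t) <= e * u t) ->
  limf_esup (fun t => (x t / Num.sqrt (2 * ln t))%:E) +oo%R = s%:E /\
  limf_einf (fun t => (x t / Num.sqrt (2 * ln t))%:E) +oo%R = (- s)%:E.
Proof.
move=> s0 xu up lo.
have N0 : 0 <= N by exact: le_trans (xu 0 (lexx 0)).
have large (K : R) : exists t0, 2 <= t0 /\ forall t, t0 <= t -> K <= Num.sqrt (2 * ln t).
  have [t0 ht0] := sqrt_ln_large K; exists (Num.max 2 t0); split; first by rewrite le_max lexx.
  move=> t; rewrite ge_max => /andP[t2 tt0]; apply: (le_trans (ht0 t tt0)); apply: ler_wsqrtr.
  have : 0 <= ln t by rewrite ln_ge0//; lra.
  lra.
suff h e : e ^+ 2 = 1 -> limf_esup (fun t => (e * x t / Num.sqrt (2 * ln t))%:E) +oo%R = s%:E.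
  split.
    have := h 1 (expr1n _ _); congr (limf_esup _ _ = _); apply: funext => t; by rewrite mul1r.
  rewrite /limf_einf EFinN -(h (-1)); last by rewrite sqrrN expr1n.
  by congr (- limf_esup _ _)%E; apply: funext => t; rewrite mulN1r mulNr.
move=> e2; have ne : `|e| = 1.
  by apply/eqP; rewrite -(@eqrXn2 _ 2) ?expr1n// real_normK ?num_real// e2.
have halve : forall dl, 0 < dl -> exists dm : R, [/\ 0 < dm, dm <= s & dm + dm <= dl].
  move=> dl d0; exists (Num.min dl s / 2).
  have h1 : Num.min dl s <= dl by rewrite ge_min lexx.
  have h2 : Num.min dl s <= s by rewrite ge_min lexx orbT.
  have h3 : 0 < Num.min dl s by rewrite lt_min d0.
  by split; lra.
have scale dl : 0 < dl -> exists (dm t0 : R), [/\ 0 < dm, dm <= s &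
    forall t, t0 <= t -> 0 < Num.sqrt (2 * ln t) /\
      (0 <= t /\ dm * Num.sqrt (2 * ln t) + N <= dl * Num.sqrt (2 * ln t))].
  move=> d0; have [dm [dm0 dms dmd]] := halve dl d0.
  have [t0 [t02 ht0]] := large (N / dm + 1).
  exists dm, t0; split => // t t0t; have := ht0 t t0t; set D := Num.sqrt _ => hD.
  have nd : 0 <= N / dm by rewrite divr_ge0// ltW.
  split; first by lra.
  split; first by lra.
  have : N <= dm * D by rewrite mulrC -ler_pdivrMr//; lra.
  have : (dm + dm) * D <= dl * D by rewrite ler_wpM2r//; lra.
  lra.
apply: limf_esup_pinfty => dl d0; have [dm [t0 [dm0 dms hD]]] := scale dl d0.
  have up' := up dm dm0 dms.
  near=> t.
  have [D0 [tp hN]] : 0 < Num.sqrt (2 * ln t) /\ (0 <= t /\ dm * Num.sqrt (2 * ln t) + N <= dl * Num.sqrt (2 * ln t)).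
    by apply: hD; near: t; apply: nbhs_pinfty_ge; rewrite num_real.
  have ut : `|u t| <= (s + dm) * Num.sqrt (2 * ln t) by near: t.
  rewrite ler_pdivrMr//; apply: (le_trans (ler_norm _)); rewrite normrM ne mul1r.
  have := xu t tp; have : `|x t| <= `|x t - u t| + `|u t| by rewrite -{1}(subrK (u t) (x t)) ler_normD.
  lra.
move=> M; have [t Mt ut] := lo e dm e2 dm0 dms (Num.max t0 (M + 1)).
move: Mt; rewrite ge_max => /andP[tt0 tM]; exists t; first by lra.
have [D0 [tp hN]] := hD t tt0.
rewrite ler_pdivlMr//.
have : - N <= e * (x t - u t) by apply: lerNnormlW; rewrite normrM ne mul1r; exact: xu.
lra.
Unshelve. all: by end_near. Qed.

End limsup_envelope.

(** * The limit as a Wiener integral *)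

Section riemann_sums.
Context {R : realType}.
Implicit Types (f df : R -> R) (s t M D e h : R).

(** Used with D = 0 as a Lipschitz estimate and with D a value of the
    derivative as the error of a Riemann sum on one cell. *)
Lemma mean_value_bound f df D M s t : s <= t ->
  {within `[s, t], continuous f} ->
  (forall r, s < r < t -> is_derive r 1 f (df r)) ->
  (forall r, s < r < t -> `|df r - D| <= M) ->
  `|f t - f s - D * (t - s)| <= M * (t - s).
Proof.
move=> st cf hf hD.
have upper (k : R) : {within `[s, t], continuous (fun r => k * r)}.
  apply: (@derivable_within_continuous _ _ (fun r : R => k * r)) => r _.
  by have [] := derZ k (derI r).
have h1 : (M + D) * s - f s <= (M + D) * t - f t.
  apply: (@derive_nondecreasing _ (fun r => (M + D) * r - f r) (fun r => (M + D) * 1 - df r)) => //.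
  - by move=> r; apply: cvgB; [exact: upper|exact: cf].
  - by move=> r hr; exact: (derB (derZ (M + D) (derI r)) (hf r hr)).
  - by move=> r hr; have := hD r hr; rewrite ler_norml mulr1 => /andP[]; lra.
have h2 : (M - D) * s + f s <= (M - D) * t + f t.
  apply: (@derive_nondecreasing _ (fun r => (M - D) * r + f r) (fun r => (M - D) * 1 + df r)) => //.
  - by move=> r; apply: cvgD; [exact: upper|exact: cf].
  - by move=> r hr; exact: (derD (derZ (M - D) (derI r)) (hf r hr)).
  - by move=> r hr; have := hD r hr; rewrite ler_norml mulr1 => /andP[]; lra.
by rewrite ler_norml; apply/andP; split; lra.
Qed.

Lemma telescoping_bound f (D : nat -> R) h e n :
  (forall i, (i < n)%N -> `|f (i.+1%:R * h) - f (i%:R * h) - D i| <= e) ->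
  `|f (n%:R * h) - f 0 - \sum_(i < n) D i| <= n%:R * e.
Proof.
elim: n => [|n IH] hf.
  by rewrite big_ord0 mul0r subrr subr0 normr0 mul0r.
have := IH (fun i hi => hf i (ltnW hi)); have := hf n (ltnSn n).
rewrite big_ord_recr/= -natr1 (mulrDl _ _ e) mul1r => h1 h2.
set A := f (n%:R * h) in h1 h2; set S := \sum_(i < n) D i in h2 *.
set F := f _ in h1 *.
have -> : F - f 0 - (S + D n) = (A - f 0 - S) + (F - A - D n) by ring.
by apply: (le_trans (ler_normD _ _)); exact: lerD.
Qed.

(** Heine's theorem, by compactness of the segment. *)
Lemma within_uniform f a b : {within `[a, b], continuous f} ->
  forall e, 0 < e -> exists2 dl : R, 0 < dl &
    forall s t, a <= s <= b -> a <= t <= b -> `|s - t| < dl -> `|f s - f t| < e.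
Proof.
move=> cf e e0; have /compact_near_coveringP cov := @segment_compact R a b.
pose Q (dl s : R) := forall t, a <= t <= b -> `|s - t| < dl -> a <= s <= b -> `|f s - f t| < e.
have [] : \forall dl \near 0^'+, `[a, b]%classic `<=` Q dl.
  apply: cov => x; rewrite /= in_itv/= => xab.
  have e20 : 0 < e / 2 by rewrite divr_gt0.
  have /subspace_continuousP/(_ x) := cf; rewrite /= in_itv/= => /(_ xab)/cvgrPdist_lt/(_ _ e20).
  rewrite /within /= => /nbhs_ballP[r /= r0 hr].
  have {}hr y : a <= y <= b -> `|x - y| < r -> `|f x - f y| < e / 2.
    by move=> yab xy; apply: (hr y xy); rewrite in_itv.
  have r20 : 0 < r / 2 by rewrite divr_gt0.
  near=> y dl; rewrite /Q /= => t tab yt yab.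
  have xy : `|x - y| < r / 2 by near: y; exists (r / 2).
  have dr : dl < r / 2 by near: dl; exact: nbhs_right_lt.
  have xt : `|x - t| < r.
    by rewrite -(subrK y x) -addrA (le_lt_trans (ler_normD _ _))//; lra.
  have h1 := hr t tab xt; have h2 : `|f x - f y| < e / 2 by apply: hr => //; lra.
  rewrite -(subrK (f x) (f y)) -addrA (le_lt_trans (ler_normD _ _))// distrC; lra.
move=> dl /= dl0 hdl; exists (dl / 2); first by rewrite divr_gt0.
move=> s t sab tab st; apply: (hdl (dl / 2)) => //=.
- by rewrite sub0r normrN gtr0_norm ?divr_gt0// ltr_pdivrMr//; lra.
- by rewrite divr_gt0.
Unshelve. all: by end_near. Qed.

(** Cellwise errors of size o(h) add up to o(1) over n / h cells. *)
Lemma telescoping_cvg f (D : nat -> nat -> R) (n : nat) :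
  (forall e, 0 < e -> \forall N \near \oo, forall i, (i < n * N.+1)%N ->
     `|f (i.+1%:R * N.+1%:R^-1) - f (i%:R * N.+1%:R^-1) - D N i| <= e * N.+1%:R^-1) ->
  \sum_(i < (n * N.+1)%N) D N i @[N --> \oo] --> f n%:R - f 0.
Proof.
move=> hD; apply/cvgrPdist_le => e e0.
have n0 : 0 < n%:R + 1 :> R by rewrite ltr_wpDl.
have := hD (e / (n%:R + 1)) (divr_gt0 e0 n0); apply: filterS => N hN.
have N0 : N.+1%:R != 0 :> R by rewrite pnatr_eq0.
have := telescoping_bound hN; rewrite natrM mulfK// => h; apply: (le_trans h).
rewrite mulrACA divff// mulr1 mulrCA -[leRHS]mulr1; apply: ler_wpM2l; first exact: ltW.
rewrite ler_pdivrMr// mul1r; lra.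
Qed.

End riemann_sums.

Section kernel_riemann_sums.
Context {R : realType}.
Variable c : R.
Hypothesis c_gt0 : 0 < c.
Local Notation g := (limit_kernel c).
Local Notation K := (c^-1 + 1).
Implicit Types (s t e : R).

Let g_within s t : 0 <= s -> {within `[s, t], continuous g}.
Proof. by move=> s0; exact: within_itvcy_itvcc (within_itvcy_itvcy s0 (limit_kernel_cont c_gt0)). Qed.

Lemma limit_kernel_lipschitz s t : 0 <= s -> s <= t -> `|g t - g s| <= K * (t - s).
Proof.
move=> s0 st; rewrite -[X in `|X|]subr0 -(mul0r (t - s)).
apply: (@mean_value_bound _ g (limit_kernel' c) 0 K s t st); first exact: g_within.
  by move=> r /andP[sr _]; apply: limit_kernel_der => //; lra.
by move=> r /andP[sr _]; rewrite subr0; apply: limit_kernel'_bound => //; lra.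
Qed.

Lemma kernel_energy_riemann (n : nat) :
  \sum_(i < (n * N.+1)%N) g (i.+1%:R * N.+1%:R^-1) ^+ 2 * N.+1%:R^-1 @[N --> \oo]
    --> kernel_energy c n%:R.
Proof.
have := @telescoping_cvg _ (kernel_energy c) (fun N i => g (i.+1%:R * N.+1%:R^-1) ^+ 2 * N.+1%:R^-1) n.
rewrite kernel_energy0 subr0; apply => e e0.
pose C := 2 * c^-1 * K; have ci : 0 < c^-1 by rewrite invr_gt0.
have C0 : 0 < C by rewrite !mulr_gt0//; lra.
near=> N; set h : R := N.+1%:R^-1.
have h0 : 0 < h by rewrite invr_gt0.
have he : C * h <= e.
  rewrite mulrC -ler_pdivlMr// ltW// /h.
  by near: N; apply: near_infty_natSinv_lt (PosNum (divr_gt0 e0 C0)).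
move=> i _.
have s0 : 0 <= i%:R * h by rewrite mulr_ge0// ltW.
have tE : i.+1%:R * h - i%:R * h = h by rewrite -natr1; ring.
have st : i%:R * h <= i.+1%:R * h by rewrite -subr_ge0 tE ltW.
have := @mean_value_bound _ (kernel_energy c) (fun r => g r ^+ 2) (g (i.+1%:R * h) ^+ 2) e _ _ st.
rewrite tE; apply.
- exact: within_itvcy_itvcc (within_itvcy_itvcy s0 (kernel_energy_cont c_gt0)).
- by move=> r /andP[sr _]; apply: kernel_energy_der => //; lra.
move=> r /andP[sr rt]; apply: le_trans he.
have r0 : 0 <= r by lra.
have hl := limit_kernel_lipschitz r0 (ltW rt).
rewrite subr_sqr normrM /C (_ : 2 * c^-1 * K * h = (K * h) * (2 * c^-1)); last by ring.
apply: ler_pM => //.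
  by rewrite distrC; apply: (le_trans hl); apply: ler_wpM2l; lra.
have b1 := limit_kernel_le_inv c_gt0 r0.
have t0 : 0 <= i.+1%:R * h by lra.
have b2 := limit_kernel_le_inv c_gt0 t0.
have p1 : 0 < g r by apply: limit_kernel_gt0 => //; lra.
have p2 : 0 < g (i.+1%:R * h) by apply: limit_kernel_gt0 => //; lra.
by rewrite ger0_norm; lra.
Unshelve. all: by end_near. Qed.

Variables (x beta : R -> R).
Hypothesis x_cont : {within `[-1, +oo[, continuous x}.
Hypothesis beta_cont : {within `[0, +oo[, continuous beta}.
Hypothesis x_eq : forall t, 0 <= t ->
  x t = x 0 + \int[lebesgue_measure]_(s in `[0, t])
    (- c * x s + c / (1 + s) * \int[lebesgue_measure]_(q in `[-1, s]) x q) + beta t.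
Local Notation m := (time_avg x).

(** The conditional expectation of the limit given the past when b = - a = c. *)
Definition limit_martingale t := m t + g t * (x t - m t).
Local Notation L := limit_martingale.

(** Written without stochastic integral: by the equation of the kernel g,
    the function m + g (x - beta - m) has derivative - g' beta, so that the
    increment of the martingale differs from g(t) (beta t - beta s) by the
    integral of g' (beta s - beta r) over the cell. *)
Lemma limit_martingale_cell s t O : 0 <= s -> s <= t ->
  (forall r, s <= r <= t -> `|beta r - beta s| <= O) ->
  `|L t - L s - g t * (beta t - beta s)| <= K * O * (t - s).
Proof.
move=> s0 st hO.
have ws (f : R -> R) : {within `[0, +oo[, continuous f} -> {within `[s, t], continuous f}.
  by move=> cf; exact: within_itvcy_itvcc (within_itvcy_itvcy s0 cf).
pose Y r := m r + g r * (x r - beta r - m r) + g r * beta s.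
pose dY r := - limit_kernel' c r * (beta r - beta s).
have YE : L t - L s - g t * (beta t - beta s) = Y t - Y s - 0 * (t - s).
  by rewrite /Y /limit_martingale; ring.
rewrite YE; apply: (@mean_value_bound _ Y dY 0 (K * O) s t st).
- have cm := ws _ (time_avg_cont x_cont); have cg := ws _ (limit_kernel_cont c_gt0).
  have cb := ws _ beta_cont; have cx := ws _ (within_cont_from0 x_cont).
  move=> r; apply: cvgD; last by apply: cvgM; [exact: cg|exact: cvg_cst].
  apply: cvgD; first exact: cm.
  by apply: cvgM; [exact: cg|apply: cvgB; [apply: cvgB; [exact: cx|exact: cb]|exact: cm]].
- move=> r /andP[sr _]; have r0 : 0 < r by lra.
  have r1 : -1 < r by lra.
  have dm := time_avg_der x_cont r0; have dv := drift_x_der x_cont x_eq r0.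
  have dg := limit_kernel_der c_gt0 r1.
  apply: (is_derive_eq (derD (derD dm (derM dg (derB dv dm))) (derM dg (derC (beta s) r)))).
  rewrite /dY; have -> : limit_kernel' c r = g r / (1 + r) + c * g r - (1 + r)^-1.
    by rewrite /limit_kernel' /limit_kernel; field; rewrite !gt_eqF//; lra.
  by field; rewrite gt_eqF//; lra.
- move=> r /andP[sr rt]; rewrite /dY subr0 normrM normrN; apply: ler_pM => //.
    by apply: limit_kernel'_bound => //; lra.
  by apply: hO; lra.
Qed.

Lemma limit_martingale_sum (n : nat) :
  \sum_(i < (n * N.+1)%N) g (i.+1%:R * N.+1%:R^-1) *
     (beta (i.+1%:R * N.+1%:R^-1) - beta (i%:R * N.+1%:R^-1)) @[N --> \oo]
    --> L n%:R - L 0.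
Proof.
apply: (@telescoping_cvg _ L (fun N i => g (i.+1%:R * N.+1%:R^-1) *
     (beta (i.+1%:R * N.+1%:R^-1) - beta (i%:R * N.+1%:R^-1)))) => e e0.
have ci : 0 < c^-1 by rewrite invr_gt0.
have K0 : 0 < K by lra.
have [dl dl0 hdl] := within_uniform (within_itvcy_itvcc beta_cont (b := n%:R)) (divr_gt0 e0 K0).
near=> N; set h : R := N.+1%:R^-1.
have h0 : 0 < h by rewrite invr_gt0.
have hd : h < dl by rewrite /h; near: N; apply: near_infty_natSinv_lt (PosNum dl0).
move=> i iN.
have s0 : 0 <= i%:R * h by rewrite mulr_ge0// ltW.
have tE : i.+1%:R * h - i%:R * h = h by rewrite -natr1; ring.
have st : i%:R * h <= i.+1%:R * h by rewrite -subr_ge0 tE ltW.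
have tn : i.+1%:R * h <= n%:R.
  by rewrite /h ler_pdivrMr// -natrM ler_nat.
have := @limit_martingale_cell (i%:R * h) (i.+1%:R * h) (e / K) s0 st.
rewrite tE mulrCA divff ?gt_eqF// mulr1; apply => r /andP[sr rt].
apply/ltW/hdl; [lra|lra|]; rewrite ger0_norm; lra.
Unshelve. all: by end_near. Qed.

End kernel_riemann_sums.

Section limit_of_martingale.
Context {R : realType}.

(** Since m + g (x - m) = m + g (z - m) + g u, where z - m converges and u is
    o(t), everything but m is killed by the kernel g = O(1 / t). *)
Lemma limit_martingale_cvg (c : R) (x u beta : R -> R) (C l : R) : 0 < c ->
  (forall t, 0 <= t -> `|beta t| <= C * (1 + t) `^ (3 / 4)) ->
  (forall t, 0 <= t -> `|drift_u u beta t| <= C * (1 + t) `^ (3 / 4)) ->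
  time_avg x t @[t --> +oo] --> l -> gap_xu x u t @[t --> +oo] --> l ->
  limit_martingale c x t @[t --> +oo] --> l.
Proof.
move=> c0 hb hy hm hz.
have gu : limit_kernel c t * u t @[t --> +oo] --> (0 : R).
  have d4 : 0 < 1 / 4 :> R by rewrite divr_gt0.
  have hp : 2 * C / c * (1 + t) `^ (- (1 / 4)) @[t --> +oo] --> (0 : R).
    rewrite -[X in _ --> X](mulr0 (2 * C / c)); apply: cvgM; first exact: cvg_cst.
    exact: powRN_cvg0.
  have hn : - (2 * C / c * (1 + t) `^ (- (1 / 4))) @[t --> +oo] --> (0 : R).
    by rewrite -[X in _ --> X]oppr0; exact: cvgN hp.
  apply: (squeeze_cvgr _ hn hp); near=> t.
  have t0 : 0 <= t by near: t; apply: nbhs_pinfty_ge; rewrite num_real.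
  rewrite -ler_norml; have t1 : 0 < 1 + t by lra.
  have g0 : 0 < limit_kernel c t by apply: limit_kernel_gt0 => //; lra.
  have g1 : limit_kernel c t <= (c * (1 + t))^-1 by apply: limit_kernel_le => //; lra.
  have ut : `|u t| <= 2 * C * (1 + t) `^ (3 / 4).
    rewrite -(subrK (beta t) (u t)); apply: (le_trans (ler_normD _ _)).
    by have := hb t t0; have := hy t t0; rewrite /drift_u; lra.
  rewrite normrM (gtr0_norm g0).
  apply: (@le_trans _ _ ((c * (1 + t))^-1 * (2 * C * (1 + t) `^ (3 / 4)))).
    by apply: ler_pM => //; exact: ltW.
  rewrite (@powR_succ _ (1 + t) (- (1 / 4)) (3 / 4) t1); last by lra.
  by rewrite le_eqVlt; apply/orP; left; apply/eqP; field; rewrite !gt_eqF.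
have gd : limit_kernel c t * (gap_xu x u t - time_avg x t) @[t --> +oo] --> (0 * (l - l) : R).
  by apply: cvgM; [exact: limit_kernel_cvg0|apply: cvgB].
rewrite subrr mulr0 in gd.
have -> : limit_martingale c x = (fun t => time_avg x t
    + (limit_kernel c t * (gap_xu x u t - time_avg x t) + limit_kernel c t * u t)).
  by apply: funext => t; rewrite /limit_martingale /gap_xu; ring.
by rewrite -[X in _ --> X]addr0 -[X in _ --> _ + X](addr0 0); apply: cvgD => //; exact: cvgD.
Unshelve. all: by end_near. Qed.

End limit_of_martingale.

Section wiener_integral.
Context {d : measure_display} {T : measurableType d} {R : realType}.
Variable P : probability T R.
Variable B : R -> T -> R.
Hypothesis B_brownian : standard_brownian_motion P B.
Variable sigma : R.
Hypothesis sigma_gt0 : 0 < sigma.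

(** The oscillation bound on the cells [0, k + 1]. *)
Lemma brownian_growth : \forall w \ae P, exists C : R, forall t : R, 0 <= t ->
  `|sigma * (B t w - B 0 w)| <= C * (1 + t) `^ (3 / 4).
Proof.
have osc := brownian_oscillation B_brownian (fun=> lexx (0 : R)) (fun k => ltr0Sn R k).
have [_ _ cB _ _] := B_brownian.
apply: filterS2 osc cB => w osc cw.
pose f t := sigma * (B t w - B 0 w).
have cf : {within `[0, +oo[, continuous f}.
  by move=> t; apply: cvgM; [exact: cvg_cst|apply: cvgB; [exact: cw|exact: cvg_cst]].
pose c : R := sigma * 24.
have c0 : 0 <= c by rewrite mulr_ge0// ltW.
pose q (k : nat) : R := c * (Num.sqrt k.+1%:R * Num.sqrt (ln k.+2%:R)).
have q0 k : 0 <= q k by exact: mulr_ge0 c0 (mulr_ge0 (sqrtr_ge0 _) (sqrtr_ge0 _)).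
have [K0 K00 hK] : exists2 K0, 0 <= K0 &
    forall (k : nat) s, 0 <= s <= 0 + k.+1%:R -> `|f s - f 0| <= K0 + q k.
  apply: (cells_uniform_bound cf (fun=> lexx (0 : R)) (fun k => ltr0Sn R k) q0).
  apply: filterS osc => k hk s hs; have := hk s hs.
  rewrite -(ler_pM2l sigma_gt0) -{1}(gtr0_norm sigma_gt0) -normrM => h.
  rewrite (_ : f s - f 0 = sigma * (B s w - B 0 w)); last by rewrite /f; ring.
  by apply: (le_trans h); rewrite /q /c; rewrite le_eqVlt; apply/orP; left; apply/eqP; ring.
exists (K0 + 2 * c); apply: (cells_growth c0 K00); first by rewrite /f subrr mulr0.
by move=> k s hs; apply: hK; rewrite add0r.
Qed.

(** Limits of measurable functions that only exist almost surely are replaced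
    by the upper limit, so that no measurability of the limit itself is
    assumed. *)
Lemma limsup_measurable (Y : nat -> T -> R) : (forall n, measurable_fun setT (Y n)) ->
  exists Z : T -> R, measurable_fun setT Z /\
    forall w (l : R), Y n w @[n --> \oo] --> l -> Z w = l.
Proof.
move=> mY; exists (fun w => fine (limn_esup (fun n => (Y n w)%:E))); split.
  apply: measurableT_comp => //; apply: measurable_fun_limn_esup => n.
  exact/measurable_EFinP.
move=> w l hl; have hE : (Y n w)%:E @[n --> \oo] --> l%:E by apply: cvg_EFin => //; exact: nearW.
by rewrite is_cvg_limn_esupE; [rewrite (cvg_lim _ hE)|apply/cvg_ex; exists l%:E].
Qed.

Variables (c m : R) (M : nat -> T -> R) (l : T -> R).
Hypothesis c_gt0 : 0 < c.
Local Notation g := (limit_kernel c).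
Local Notation S := (fun (n N : nat) (w : T) =>
  \sum_(i < (n * N.+1)%N) g (i.+1%:R * N.+1%:R^-1) *
     (sigma * (B (i.+1%:R * N.+1%:R^-1) w - B (i%:R * N.+1%:R^-1) w))).
Hypothesis S_cvg : \forall w \ae P, forall n, S n N w @[N --> \oo] --> M n w - m.
Hypothesis M_cvg : \forall w \ae P, M n w @[n --> \oo] --> l w.

(** Two successive limits of Gaussian variables: Riemann sums over [0, n]
    for the mesh, then n.  The limit l is only an almost sure limit of paths;
    the random variable L is built from the Riemann sums. *)
Lemma wiener_integral_law : exists L : {RV P >-> R},
  gaussian_law P L m (sigma * Num.sqrt (\int[lebesgue_measure]_(u in `[0, +oo[) (g u ^+ 2))) /\
  \forall w \ae P, L w = l w.
Proof.
pose wt N i : R := sigma * g (i.+1%:R * N.+1%:R^-1).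
pose Y n N w := m + \sum_(i < (n.+1 * N.+1)%N) wt N i * increment B N.+1%:R^-1 i w.
have h0 N : 0 < N.+1%:R^-1 :> R by rewrite invr_gt0.
have wt0 N i : 0 < wt N i.
  rewrite mulr_gt0// limit_kernel_gt0//.
  exact: lt_le_trans (ltrN10 R) (mulr_ge0 (ler0n _ _) (ltW (h0 N))).
have YE n N w : Y n N w = m + S n.+1 N w.
  by congr (m + _); apply: eq_bigr => i _; rewrite /wt /increment; ring.
have mY n N : measurable_fun setT (Y n N).
  apply: measurable_funD => //; apply: measurable_sum => i; apply: measurable_funM => //.
  exact: (measurable_increment B_brownian (h0 N)).
have lY n N : gaussian_law P (Y n N) m
    (Num.sqrt (\sum_(i < (n.+1 * N.+1)%N) (wt N i * Num.sqrt N.+1%:R^-1) ^+ 2)).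
  have : (0 < n.+1 * N.+1)%N by rewrite muln_gt0.
  rewrite /Y; case: (n.+1 * N.+1)%N => // k _.
  exact: (weighted_increments_law B_brownian (h0 N)).
have sqrt_cvg (v : nat -> R) (y : R) : v k @[k --> \oo] --> y -> Num.sqrt (v k) @[k --> \oo] --> Num.sqrt y.
  by move=> vy; apply: (cvg_comp _ _ vy); exact: sqrt_continuous.
pose sd n : R := Num.sqrt (sigma ^+ 2 * kernel_energy c n.+1%:R).
have sdE n : Num.sqrt (\sum_(i < (n.+1 * N.+1)%N) (wt N i * Num.sqrt N.+1%:R^-1) ^+ 2)
    @[N --> \oo] --> sd n.
  apply: sqrt_cvg.
  have -> : (fun N => \sum_(i < (n.+1 * N.+1)%N) (wt N i * Num.sqrt N.+1%:R^-1) ^+ 2) =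
      (fun N => sigma ^+ 2 * \sum_(i < (n.+1 * N.+1)%N) g (i.+1%:R * N.+1%:R^-1) ^+ 2 * N.+1%:R^-1).
    apply: funext => N; rewrite mulr_sumr; apply: eq_bigr => i _.
    by rewrite /wt !exprMn sqr_sqrtr ?(ltW (h0 N))//; ring.
  by apply: cvgM; [exact: cvg_cst|exact: kernel_energy_riemann].
have sd_gt0 n : 0 < sd n by rewrite sqrtr_gt0 mulr_gt0 ?exprn_gt0// kernel_energy_gt0.
have [Z hZ] := choice (fun n => limsup_measurable (mY n)).
have [L [mL hL]] := limsup_measurable (fun n => (hZ n).1).
have YM : \forall w \ae P, forall n, Y n N w @[N --> \oo] --> M n.+1 w.
  apply: filterS S_cvg => w hw n; rewrite (_ : Y n ^~ w = fun N => m + S n.+1 N w); last first.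
    by apply: funext => N; exact: YE.
  rewrite -[M n.+1 w](subrK m) addrC; apply: cvgD; first exact: cvg_cst.
  exact: hw.
have ZM : \forall w \ae P, forall n, Z n w = M n.+1 w.
  by apply: filterS YM => w hw n; exact: (hZ n).2 (hw n).
have lZ n : gaussian_law P (Z n) m (sd n).
  apply: (gaussian_law_limit (sd_gt0 n) (hZ n).1 (mY n) (lY n) (sdE n)).
  by apply: filterS2 YM ZM => w hY ->; exact: hY.
have Zl : \forall w \ae P, Z n w @[n --> \oo] --> l w.
  apply: filterS2 ZM M_cvg => w hZM hM.
  rewrite (_ : Z ^~ w = fun n => M n.+1 w); last by apply: funext.
  by rewrite (cvg_shiftS (M ^~ w)).
have Ll : \forall w \ae P, L w = l w by apply: filterS Zl => w; exact: hL.
pose E : R := \int[lebesgue_measure]_(u in `[0, +oo[) (g u ^+ 2).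
have E0 : 0 < E by exact: kernel_energy_total_gt0.
have EE : Num.sqrt (sigma ^+ 2 * E) = sigma * Num.sqrt E.
  by rewrite sqrtrM ?sqr_ge0// sqrtr_sqr gtr0_norm.
have sdl : sd n @[n --> \oo] --> sigma * Num.sqrt E.
  rewrite -EE; apply: sqrt_cvg; apply: cvgM; first exact: cvg_cst.
  have nat_oo : n.+1%:R @[n --> \oo] --> (+oo : set_system R).
    by rewrite (cvg_shiftS (fun n => n%:R : R)); exact: cvgr_idn.
  exact: (cvg_comp _ _ nat_oo (kernel_energy_cvg c_gt0)).
pose X : {RV P >-> R} := HB.pack L (isMeasurableFun.Build _ _ _ _ L mL).
exists X; split => //.
apply: (gaussian_law_limit _ mL (fun n => (hZ n).1) lZ sdl); first by rewrite mulr_gt0// sqrtr_gt0.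
by apply: filterS2 Zl Ll => w hZ' ->.
Qed.

End wiener_integral.

(** * Values of the constants *)

Section gamma_one.
Context {R : realType}.

Lemma Gamma1 : Gamma 1 = 1 :> R.
Proof.
have dF (s : R) : is_derive s 1 (fun s => - expR (- s)) (expR (- s)).
  by apply: (is_derive_eq (derN (der_expR (derN (derI s))))); ring.
have cE : {within `[0, +oo[, continuous (fun s : R => expR (- s))}.
  apply: (@derivable_within_continuous _ _ (fun s : R => expR (- s))) => s _.
  by have [] := der_expR (derN (derI s)).
transitivity (\int[lebesgue_measure]_(s in `[0, +oo[) (1 * expR (- s)) : R).
  rewrite /Gamma /Rintegral integral_itv_obnd_cbnd; last first.
    apply/measurable_EFinP; apply: measurable_funM; apply: measurable_funTS.
      exact: measurable_powR.
    by apply: measurableT_comp => //; exact: measurableT_comp.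
  by congr fine; apply: eq_integral => s _; rewrite subrr powRr0.
rewrite (@rint_pinfty_derivative _ 1 (fun s => expR (- s)) (fun s => - expR (- s)) 0)//.
- by rewrite opprK oppr0 expR0 mulr1.
- rewrite -[X in _ --> X]oppr0; apply: cvgN; exact: cvgr_expR.
Qed.

End gamma_one.

Section kernel_constants.
Context {R : realType}.
Variable c : R.
Hypothesis c_gt0 : 0 < c.
Local Notation mu := (@lebesgue_measure R).
Local Notation g := (limit_kernel c).
Implicit Types (k u v s : R).

Lemma tricomi_tail k u : 0 <= k -> 0 <= u ->
  \int[mu]_(s in `[u, +oo[) (k * tricomi 2 2 (c * (1 + s))) =
  k * (c^-1 * ((c * (1 + u))^-1 - tricomi22 (c * (1 + u)))).
Proof.
move=> k0 u0; rewrite -(tricomi22_tail c_gt0 k0 u0); apply: eq_Rintegral => s.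
rewrite inE/= in_itv/= andbT => us; rewrite tricomi_2_2// mulr_gt0//; lra.
Qed.

Lemma tricomi_tail1 u : 0 <= u ->
  \int[mu]_(s in `[u, +oo[) tricomi 2 2 (c * (1 + s)) =
  c^-1 * ((c * (1 + u))^-1 - tricomi22 (c * (1 + u))).
Proof.
move=> u0; rewrite -[RHS]mul1r -(tricomi_tail ler01 u0).
by apply: eq_Rintegral => s _; rewrite mul1r.
Qed.

Lemma limit_mean_tail :
  c ^+ 2 * (\int[mu]_(s in `[0, +oo[) tricomi 2 2 (c * (1 + s))) = 1 - g 0.
Proof.
rewrite tricomi_tail1// /limit_kernel !addr0 !mulr1.
by field; rewrite gt_eqF.
Qed.

Lemma limit_mean_start :
  c ^+ 2 * (\int[mu]_(u in `[0, +oo[) (expR (- c * u) *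
     \int[mu]_(s in `[u, +oo[) tricomi 2 2 (c * (1 + s)))) = g 0.
Proof.
have k0 : 0 <= c ^- 2 by rewrite invr_ge0 sqr_ge0.
have -> : \int[mu]_(u in `[0, +oo[) (expR (- c * u) *
     \int[mu]_(s in `[u, +oo[) tricomi 2 2 (c * (1 + s))) = c ^- 2 * g 0.
  have := tricomi22_tail2 c_gt0 k0 (lexx 0); rewrite mulr0 expR0 mul1r => <-.
  apply: eq_Rintegral => u; rewrite inE/= in_itv/= andbT => u0.
  rewrite tricomi_tail1//; move: (c^-1 * _) => y.
  by field; rewrite gt_eqF.
by rewrite mulrA divff ?mul1r// expf_neq0// gt_eqF.
Qed.

(** The inner double integral is e^(-c u) g(u), whose square cancels the weight
    e^(2 c u). *)
Lemma limit_variance :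
  \int[mu]_(u in `[0, +oo[) (expR (2 * c * u) *
     (\int[mu]_(v in `[u, +oo[) (expR (- c * v) *
        \int[mu]_(s in `[v, +oo[) (c ^+ 2 * tricomi 2 2 (c * (1 + s))))) ^+ 2) =
  \int[mu]_(u in `[0, +oo[) (g u ^+ 2).
Proof.
apply: eq_Rintegral => u; rewrite inE/= in_itv/= andbT => u0.
have -> : \int[mu]_(v in `[u, +oo[) (expR (- c * v) *
    \int[mu]_(s in `[v, +oo[) (c ^+ 2 * tricomi 2 2 (c * (1 + s)))) = expR (- c * u) * g u.
  rewrite -[RHS]mul1r -(tricomi22_tail2 c_gt0 ler01 u0).
  apply: eq_Rintegral => v; rewrite inE/= in_itv/= andbT => uv; rewrite mul1r tricomi_tail//.
    by rewrite sqr_ge0.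
  exact: le_trans uv.
rewrite exprMn mulrA -expRM_natl -expRD (_ : _ + _ = 0) ?expR0 ?mul1r//.
by ring.
Qed.

End kernel_constants.

(** * Asymptotics of the solution *)

Section average_solution.
Context {d : measure_display} {T : measurableType d} {R : realType}.
Variable P : probability T R.
Variables (B X U : R -> T -> R) (a b sigma : R) (psi : R -> R).
Hypothesis B_brownian : standard_brownian_motion P B.
Hypothesis sigma_gt0 : 0 < sigma.
Hypothesis a_lt0 : a < 0.
Hypothesis ab_le0 : a + b <= 0.
Hypothesis X_solution : average_sde_solution P a b sigma psi B X.
Hypothesis U_solution : ornstein_uhlenbeck_solution P a sigma B U.
Local Notation beta w := (fun t => sigma * (B t w - B 0 w)).
Local Notation mu := (@lebesgue_measure R).

Lemma beta_path : \forall w \ae P, {within `[0, +oo[, continuous (beta w)} /\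
  exists C : R, forall t : R, 0 <= t -> `|beta w t| <= C * (1 + t) `^ (3 / 4).
Proof.
have [_ _ cB _ _] := B_brownian.
apply: filterS2 cB (brownian_growth B_brownian sigma_gt0) => w cw hC; split => //.
by move=> t; apply: cvgM; [exact: cvg_cst|apply: cvgB; [exact: cw|exact: cvg_cst]].
Qed.

Lemma ou_path : \forall w \ae P, {within `[0, +oo[, continuous (U ^~ w)} /\
  forall t : R, 0 <= t -> U t w = \int[mu]_(s in `[0, t]) (a * U s w) + sigma * (B t w - B 0 w).
Proof.
apply: filterS U_solution => w [cU U0 eU]; split => // t t0.
by rewrite eU// U0 add0r.
Qed.

Lemma average_limits : \forall w \ae P, exists2 l : R,
  a + b < 0 -> l = 0 &
  time_avg (X ^~ w) t @[t --> +oo] --> l /\ X t w - U t w @[t --> +oo] --> - (b / a) * l.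
Proof.
apply: filterS3 X_solution ou_path beta_path => w [cX _ eX] [cU eU] [cb [C hC]].
have b0 : beta w 0 = 0 by rewrite subrr mulr0.
exact: (average_and_gap_cvg a_lt0 ab_le0 cX cU cb b0 eX eU hC).
Qed.

(** The envelopes hold almost surely for each dl, hence for a sequence tending
    to 0 simultaneously, and they are monotone in dl. *)
Lemma average_log_limits : \forall w \ae P,
  limf_esup (fun t : R => (X t w / Num.sqrt (2 * ln t))%:E) +oo%R
    = (sigma / Num.sqrt (2 * `|a|))%:E /\
  limf_einf (fun t : R => (X t w / Num.sqrt (2 * ln t))%:E) +oo%R
    = (- (sigma / Num.sqrt (2 * `|a|)))%:E.
Proof.
have s0 := limit_sd_gt0 a_lt0 sigma_gt0.
set s := sigma / _ in s0 *.
pose dl n : R := s / n.+1%:R.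
have dl0 n : 0 < dl n by rewrite divr_gt0.
have dls n : dl n <= s by rewrite ler_pdivrMr// ler_peMr ?ler1n// ltW.
have small e : 0 < e -> exists n, dl n <= e.
  move=> e0; exists (Num.truncn (s / e)); rewrite ler_pdivrMr// mulrC -ler_pdivrMr//.
  exact: ltW (truncnS_gt _).
have up : \forall w \ae P, forall n, \forall t \near +oo,
    `|U t w| <= (s + dl n) * Num.sqrt (2 * ln t).
  by apply: ae_foralln => n; exact: (ou_upper_envelope B_brownian a_lt0 sigma_gt0 ou_path (dl0 n)).
have lo (e : R) : e ^+ 2 = 1 -> \forall w \ae P, forall n, forall N : R, exists2 t, N <= t &
    (s - dl n) * Num.sqrt (2 * ln t) <= e * U t w.
  move=> e2; apply: ae_foralln => n.
  exact: (ou_lower_envelope B_brownian a_lt0 sigma_gt0 ou_path e2 (dl0 n) (dls n)).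
have lo1 := lo 1 (expr1n _ _).
have lo2 := lo (-1) (etrans (sqrrN _) (expr1n _ _)).
have bounded : \forall w \ae P, exists N : R, forall t : R, 0 <= t -> `|X t w - U t w| <= N.
  apply: filterS3 X_solution ou_path beta_path => w [cX _ eX] [cU eU] [cb [C hC]].
  have b0 : beta w 0 = 0 by rewrite subrr mulr0.
  exact: (gap_bounded a_lt0 ab_le0 cX cU cb b0 eX eU hC).
apply: filterS2 bounded (filterI up (filterI lo1 lo2)) => w [N hN] [hup [hlo1 hlo2]].
apply: (@log_envelope_limits R (X ^~ w) (U ^~ w) s N s0 hN).
  move=> e e0 _; have [n ne] := small e e0; apply: filterS (hup n) => t ht.
  by apply: (le_trans ht); rewrite ler_wpM2r ?sqrtr_ge0// lerD2l.
move=> e q e2 q0 _ M; have [n nq] := small q q0.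
have [t Mt ht] : exists2 t, M <= t & (s - dl n) * Num.sqrt (2 * ln t) <= e * U t w.
  have /orP[/eqP->|/eqP->] : (e == 1) || (e == -1) by rewrite -sqrf_eq1 e2.
    exact: hlo1.
  exact: hlo2.
by exists t => //; apply: le_trans ht; rewrite ler_wpM2r ?sqrtr_ge0// lerD2l lerN2.
Qed.

Hypothesis ab0 : a + b = 0.
Local Notation i0 := (\int[mu]_(s in `[-1, 0]) psi s).
Local Notation g := (limit_kernel (- a)).

(** Here - (b / a) = 1, so that the average and the gap have the same limit;
    it is also the limit of the martingale, whose value at 0 is deterministic. *)
Lemma average_gaussian_limit : exists L : {RV P >-> R},
  gaussian_law P L (i0 + g 0 * (psi 0 - i0))
    (sigma * Num.sqrt (\int[mu]_(u in `[0, +oo[) (g u ^+ 2))) /\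
  \forall w \ae P, X t w - U t w @[t --> +oo] --> L w /\ time_avg (X ^~ w) t @[t --> +oo] --> L w.
Proof.
have c0 : 0 < - a by rewrite oppr_gt0.
have bE : b = - a by move: ab0 => ab0'; lra.
have ba1 : - (b / a) = 1 by rewrite bE mulNr divff ?opprK// lt_eqF.
pose M (n : nat) w := limit_martingale (- a) (X ^~ w) n%:R.
pose l w := lim (X t w - U t w @[t --> +oo]).
have lE : \forall w \ae P, X t w - U t w @[t --> +oo] --> l w /\ time_avg (X ^~ w) t @[t --> +oo] --> l w.
  apply: filterS average_limits => w [l' _ [hm]]; rewrite ba1 mul1r => hz.
  by have -> : l w = l' by exact: (cvg_lim _ hz).
have hM : \forall w \ae P, M n w @[n --> \oo] --> l w.
  apply: filterS3 X_solution (filterI ou_path lE) beta_path.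
  move=> w [cX _ eX] [[cU eU] [hz hm]] [cb [C hC]].
  have b0 : beta w 0 = 0 by rewrite subrr mulr0.
  have hy t (t0 : 0 <= t) := drift_u_growth a_lt0 cU cb b0 eU hC t0.
  have := limit_martingale_cvg c0 hC hy hm hz => h.
  exact: (cvg_comp _ _ (@cvgr_idn R) h).
have hS : \forall w \ae P, forall n, \sum_(i < (n * N.+1)%N) g (i.+1%:R * N.+1%:R^-1) *
     (sigma * (B (i.+1%:R * N.+1%:R^-1) w - B (i%:R * N.+1%:R^-1) w))
     @[N --> \oo] --> M n w - (i0 + g 0 * (psi 0 - i0)).
  apply: filterS2 X_solution beta_path => w [cX hpsi eX] [cb _] n.
  have L0 : limit_martingale (- a) (X ^~ w) 0 = i0 + g 0 * (psi 0 - i0).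
    have m0 : time_avg (X ^~ w) 0 = i0.
      rewrite /time_avg addr0 invr1 mul1r; apply: eq_Rintegral => s; rewrite inE/= in_itv/= => hs.
      exact: hpsi.
    by rewrite /limit_martingale m0 hpsi// lexx andbT lerN10.
  rewrite -L0.
  have eX' t : 0 <= t -> X t w = X 0 w + \int[mu]_(s in `[0, t])
      (- (- a) * X s w + - a / (1 + s) * \int[mu]_(q in `[-1, s]) X q w) + beta w t.
    by move=> t0; rewrite opprK -bE; exact: eX.
  have := @limit_martingale_sum R (- a) c0 (X ^~ w) (beta w) cX cb eX' n.
  rewrite -/(M n w); set f := (fun N => _) => hf; rewrite (_ : (fun N => _) = f)//.
  by apply: funext => N; apply: eq_bigr => i _; congr (_ * _); ring.
have [L [lL LE]] := wiener_integral_law B_brownian sigma_gt0 c0 hS hM.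
by exists L; split => //; apply: filterS2 LE lE => w ->.
Qed.

End average_solution.

Theorem theorem3p1 (R : realType) (d : measure_display)
    (T : measurableType d) (P : probability T R)
    (F : R -> set_system T) (B X U : R -> T -> R)
    (a b sigma : R) (psi : R -> R)
    (P_complete : measure_is_complete P)
    (F_filtration : filtration F)
    (F_usual : usual_conditions P F)
    (B_brownian : standard_brownian_motion P B)
    (B_adapted : adapted F B)
    (sigma_gt0 : 0 < sigma)
    (a_lt0 : a < 0)
    (ab_le0 : a + b <= 0)
    (psi_continuous : {within `[-1, 0], continuous psi})
    (X_adapted : adapted F X)
    (X_solution : average_sde_solution P a b sigma psi B X)
    (U_adapted : adapted F U)
    (U_solution : ornstein_uhlenbeck_solution P a sigma B U) :
  [/\ \forall w \ae P,
        limf_esup (fun t : R => (X t w / Num.sqrt (2 * ln t))%:E) +oo%R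
          = (sigma / Num.sqrt (2 * `|a|))%:E /\
        limf_einf (fun t : R => (X t w / Num.sqrt (2 * ln t))%:E) +oo%R
          = (- (sigma / Num.sqrt (2 * `|a|)))%:E,
      a + b < 0 ->
        (\forall w \ae P, X t w - U t w @[t --> +oo] --> (0 : R)) /\
        (\forall w \ae P,
           (1 + t)^-1 * \int[lebesgue_measure]_(s in `[-1, t]) X s w
             @[t --> +oo] --> (0 : R))
    & a + b = 0 ->
        exists L : {RV P >-> R},
          [/\ \forall w \ae P, X t w - U t w @[t --> +oo] --> L w,
              proper_gaussian P L,
              ('E_P[L])%E =
                (b ^+ 2 * Gamma (- b / a)
                   * (\int[lebesgue_measure]_(u in `[-1, 0]) psi u)
                   * (\int[lebesgue_measure]_(s in `[0, +oo[)
                        tricomi (1 - b / a) 2 (- a * (1 + s)))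
                 + b ^+ 2 * Gamma (- b / a) * psi 0
                   * (\int[lebesgue_measure]_(u in `[0, +oo[)
                        (expR (a * u)
                           * \int[lebesgue_measure]_(s in `[u, +oo[)
                               tricomi (1 - b / a) 2 (- a * (1 + s)))))%:E,
              ('V_P[L])%E =
                (sigma ^+ 2
                   * \int[lebesgue_measure]_(u in `[0, +oo[)
                       (expR (- 2 * a * u)
                          * (\int[lebesgue_measure]_(v in `[u, +oo[)
                               (expR (a * v)
                                  * \int[lebesgue_measure]_(s in `[v, +oo[)
                                      (b ^+ 2 * Gamma (- b / a)
                                         * tricomi (1 - b / a) 2
                                             (- a * (1 + s))))) ^+ 2))%:E
            & \forall w \ae P,
                (1 + t)^-1 * \int[lebesgue_measure]_(s in `[-1, t]) X s w
                  @[t --> +oo] --> L w]].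
Proof.
have limits := average_limits B_brownian sigma_gt0 a_lt0 ab_le0 X_solution U_solution.
split.
- exact: (average_log_limits B_brownian sigma_gt0 a_lt0 ab_le0 X_solution U_solution).
- move=> ab_lt0; split; apply: filterS limits => w [l /(_ ab_lt0) ->]; rewrite mulr0 => -[hm hz].
    exact: hz.
  exact: hm.
move=> ab0; have c0 : 0 < - a by rewrite oppr_gt0.
have bE : b = - a by lra.
have ba1 : - b / a = 1 by rewrite bE opprK divff// lt_eqF.
have ba2 : 1 - b / a = 2 by rewrite -mulNr ba1.
have [L [lL limL]] := average_gaussian_limit B_brownian sigma_gt0 a_lt0 ab_le0 X_solution U_solution ab0.
have s0 : 0 < sigma * Num.sqrt (\int[lebesgue_measure]_(u in `[0, +oo[) (limit_kernel (- a) u ^+ 2)).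
  by rewrite mulr_gt0// sqrtr_gt0 kernel_energy_total_gt0.
have [EL VL] := gaussian_law_moments s0 lL.
exists L; split.
- by apply: filterS limL => w [].
- by exists (\int[lebesgue_measure]_(s in `[-1, 0]) psi s + limit_kernel (- a) 0 * (psi 0 - \int[lebesgue_measure]_(s in `[-1, 0]) psi s)), (sigma * Num.sqrt (\int[lebesgue_measure]_(u in `[0, +oo[) (limit_kernel (- a) u ^+ 2))).
- rewrite EL ba1 ba2 Gamma1 mulr1 bE; congr (_%:E).
  have h1 := limit_mean_tail c0; have := limit_mean_start c0; rewrite opprK => h2.
  rewrite -mulrA (mulrCA (_ ^+ 2)) h1 -mulrA (mulrCA (_ ^+ 2)) h2; ring.
- rewrite VL ba1 ba2 Gamma1 mulr1 bE; congr (_%:E).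
  have := limit_variance c0; rewrite opprK => h.
  rewrite exprMn sqr_sqrtr ?(ltW (kernel_energy_total_gt0 c0))// -h.
  by congr (_ * _); apply: eq_Rintegral => u _; congr (expR _ * _); ring.
- by apply: filterS limL => w [].
Qed.
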